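(* Let $T:\Sigma\times G\to\Sigma\times G$ be the extension, by a group $G$, of a Gibbs–Markov map $\theta:\Sigma\to\Sigma$ of finite type as described in the context. Assume that $G$ is hyperbolic, that $T$ is topologically transitive and transient, that there is $C_0\ge1$ with $C_0^{-1}\mathbb G_R(\mathbb X_{\mathrm{id}})(x,g)\le\mathbb G_R(\mathbb X_g)(x,\mathrm{id})\le C_0\,\mathbb G_R(\mathbb X_{\mathrm{id}})(x,g)$ for all $(x,g)\in\Sigma\times G$, and let $1\le r\le R$. Then the map $\Xi:(\partial G,d_{\mathrm{visual}})\to(\mathcal M_r,d^r_{\mathrm{Martin}})$ is a homeomorphism, and, with $d^r_{\mathrm{Martin}}$ defined through the coefficients $(c_h)$ given in the context, for every $\epsilon>0$ there is a constant $K\ge1$ such that for all $\sigma,\tilde\sigma\in\partial G$ $$K^{-1}\,d_{\mathrm{visual}}(\sigma,\tilde\sigma)^{\beta}\le d^r_{\mathrm{Martin}}(\Xi(\sigma),\Xi(\tilde\sigma))\le K\,d_{\mathrm{visual}}(\sigma,\tilde\sigma)^{\alpha},$$ where $\alpha=\log\lambda/\log\lambda_{\mathrm{visual}}$ and $\beta=(2\log\lambda-\log(\mathfrak h+\epsilon))/\log\lambda_{\mathrm{visual}}$. In particular, $\Xi$ and $\Xi^{-1}$ are Hölder continuous with exponents $\alpha$ and $1/\beta$, respectively.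
   Context: **Base map.** $\Sigma\subset\mathcal A^{\mathbb N}$ is a one-sided topological Markov chain (subshift given by a $0$-$1$ transition rule) over a finite alphabet $\mathcal A$, $\theta$ is the left shift on $\Sigma$, assumed topologically mixing and noninvertible. $\mathcal W^n$ is the set of admissible words of length $n$ and $[w]\subset\Sigma$ is the cylinder of $w\in\mathcal W^n$. $\mu$ is a $\theta$-invariant Borel probability measure on $\Sigma$, positive on cylinders. For $w\in\mathcal W^n$, $\tau_w:\theta^n([w])\to[w]$ is the inverse of $\theta^n|_{[w]}$ and $\varphi_w:=d(\mu\circ\tau_w)/d\mu$ (continuous version). The Gibbs–Markov property (of finite type) means: there are $C>0$, $s\in(0,1)$ with $|\log\varphi_w(x)-\log\varphi_w(y)|\le C\,d_s(x,y)$ for all finite admissible $w$ and $x,y\in\theta^{|w|}([w])$, where $d_s(x,y)=s^{\min\{i:x_i\ne y_i\}}$. **Extension.** $G$ is a discrete group, $\kappa:\Sigma\to G$ is constant on cylinders of length one, $T(x,g)=(\theta(x),g\kappa(x))$ on $\Sigma\times G$, and $\kappa^n(x)=\kappa(x)\kappa(\theta x)\cdots\kappa(\theta^{n-1}x)$; for $w\in\mathcal W^n$, $\kappa_w=\kappa^n(x)$ for $x\in[w]$. $T$ is topologically transitive if for all $a,b\in\mathcal A$ and $g,h\in G$ there is $n\in\mathbb N$ with $T^n([a]\times\{g\})\cap([b]\times\{h\})\neq\emptyset$. **Operators.** $\mathcal L^n(f)(x,g)=\sum_{v\in\mathcal W^n,\,x\in\theta^n([v])}\varphi_v(x)\,f(\tau_v(x),g\kappa_v^{-1})$;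 invariance of $\mu$ gives $\mathcal L(\mathbf 1)=\mathbf 1$. $\mathbb G_r(f)=\sum_{n\ge0}r^n\mathcal L^n(f)$. $\mathbb X_g:=\mathbf 1_{\Sigma\times\{g\}}$. $\rho=\limsup_n\sqrt[n]{\mathcal L^n(\mathbb X_g)(x,h)}$, which by transitivity does not depend on $g,h\in G$, $x\in\Sigma$; $R:=1/\rho\ge1$. $T$ is transient if $\mathbb G_R(\mathbb X_{\mathrm{id}})(x,\mathrm{id})<\infty$ for all $x\in\Sigma$. **Group and visual metric.** $G$ carries the word metric $d$ of a finite symmetric generating set, $|g|=d(\mathrm{id},g)$, and is hyperbolic: for some fixed $\delta>0$, $(x\cdot z)_o\ge\min\{(x\cdot y)_o,(y\cdot z)_o\}-\delta$ for all $x,y,z,o\in G$, where $(x\cdot y)_o=\frac12(d(x,o)+d(y,o)-d(x,y))$. $\mathfrak h:=\lim_n\sqrt[n]{\#\{g\in G:|g|=n\}}$. $(g_n)$ converges at infinity if $(g_n\cdot g_m)_{\mathrm{id}}\to\infty$; $(g_n),(h_n)$ have the same limit if $(g_n\cdot h_n)_{\mathrm{id}}\to\infty$; $\partial G$ is the set of limits. For $\xi,\eta\in\partial G$, $(\xi\cdot\eta)=\sup\{\liminf_{m,n}(g_m\cdot h_n)_{\mathrm{id}}: g_n\to\xi,\ h_n\to\eta\}$. Fix $\lambda_{\mathrm{visual}}\in(2^{-1/(2\delta)},1)$ and set $d_{\mathrm{visual}}(\xi,\eta)=\inf\{\sum_{k=1}^{n-1}\lambda_{\mathrm{visual}}^{(x_k\cdot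 x_{k+1})}: n\in\mathbb N,\ x_k\in\partial G,\ x_1=\xi,\ x_n=\eta\}$, a metric on $\partial G$. **Martin boundary.** $\mathbb K_r(h,(x,g))=\mathbb G_r(\mathbb X_h)(x,g)/\mathbb G_r(\mathbb X_{\mathrm{id}})(x,g)$. $M_r$ is the set of $(x,g)\in\Sigma\times G$ such that $\kappa^n(x)$ leaves every finite subset of $G$ and $\lim_n\mathbb K_r(h,T^n(x,g))$ exists for all $h\in G$. $(x,g)\sim(\tilde x,\tilde g)$ if these limits coincide for all $h$; $\mathcal M_r=M_r/\!\sim$. $\Xi:\partial G\to\mathcal M_r$ sends $\eta$ to the class of the points $(x,g)\in M_r$ with $g\kappa^n(x)\to\eta$ (well defined under the assumptions of the theorem). **Martin metric.** Call pairs $\{p,p'\}$, $\{q,q'\}$ in $G$ $n$-separated if, with $F=\{p,p',q,q'\}$, there are a finite metric tree $(\mathcal T,d_{\mathcal T})$, a map $\Theta:F\to\mathcal T$ and $o\in F$ with $d_{\mathcal T}(\Theta(x),\Theta(o))=d(x,o)$ and $d(x,y)-2\delta\le d_{\mathcal T}(\Theta(x),\Theta(y))\le d(x,y)$ for $x,y\in F$, and the arcs $[\Theta(p),\Theta(p')]$, $[\Theta(q),\Theta(q')]$ at distance $>n$ in $\mathcal T$. Fix $\lambda\in(0,1)$ such that for some $C>0$, $$\left|\frac{\mathbb G_r(\mathbb X_h)(x,g)/\mathbb G_r(\mathbb X_h)(y,g')}{\mathbb G_r(\mathbb X_{h'})(x,g)/\mathbb G_r(\mathbb X_{h'})(y,g')}-1\right|\le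 C\lambda^n$$ for all $r\in[1,R]$, $x,y\in\Sigma$, $n\in\mathbb N$ and $g,g',h,h'\in G$ with $\{g,g'\}$, $\{h,h'\}$ $n$-separated (such $\lambda$ exists under the assumptions of the theorem). Fix $x_0\in\Sigma$ and put $$c_h=\frac{\lambda^{2|h|}}{\#\{g\in G:|g|=|h|\}\cdot|\log\mathbb G_r(\mathbb X_h)(x_0,\mathrm{id})|},$$ where for the (at most finitely many) $h$ with vanishing logarithm the factor $|\log\mathbb G_r(\mathbb X_h)(x_0,\mathrm{id})|$ is replaced by $1$. For $(x,g),(\tilde x,\tilde g)\in M_r$, $$d^r_{\mathrm{Martin}}((x,g),(\tilde x,\tilde g))=\lim_{n\to\infty}\sum_{h\in G}c_h\left|\log\mathbb K_r(h,T^n(x,g))-\log\mathbb K_r(h,T^n(\tilde x,\tilde g))\right|,$$ which defines a metric on $\mathcal M_r$. *)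

(* Defs.v *)
From HB Require Import structures.
From mathcomp Require Import all_boot all_order all_algebra.
From mathcomp Require Import finmap.
From mathcomp Require Import all_classical all_reals all_analysis.

Set Implicit Arguments.
Unset Strict Implicit.
Unset Printing Implicit Defensive.

Import Order.TTheory GRing.Theory Num.Theory.
Import numFieldNormedType.Exports.

Local Open Scope classical_set_scope.
Local Open Scope ring_scope.

(* The vertices stand for the points of the tree: after subdividing edges, any
   finite set of points of a metric tree consists of vertices. *)
Record metric_tree (R : realType) := MetricTree {
  mt_vertex :> finType;
  mt_edge : rel mt_vertex;
  mt_len : mt_vertex -> mt_vertex -> R;
  mt_edge_sym : symmetric mt_edge;
  mt_edge_irr : irreflexive mt_edge;
  mt_connected : forall u v, connect mt_edge u v;
  mt_acyclic : forall c : seq mt_vertex, ucycle mt_edge c -> (size c <= 2)%N;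
  mt_len_sym : forall u v, mt_len u v = mt_len v u;
  mt_len_gt0 : forall u v, mt_edge u v -> 0 < mt_len u v
}.

Section MetricTree.
Context {R : realType} (T : metric_tree R).

Definition mt_walk_len (u : T) (p : seq T) : R :=
  \sum_(l <- pairmap (@mt_len R T) u p) l.

Definition mt_dist (u v : T) : R :=
  inf [set l | exists p, [/\ path (@mt_edge R T) u p, last u p = v
                           & l = mt_walk_len u p]].

(* Vertices on the unique simple path from u to v. As the ends of the bridge
   between two disjoint arcs with vertex end points are vertices, and
   intersecting arcs share a vertex, the distance between two arcs is the
   minimal distance between their vertices. *)
Definition mt_arc (u v : T) : set T :=
  [set z | exists p, [/\ path (@mt_edge R T) u p, uniq (u :: p),
                         last u p = v & z \in u :: p]].

End MetricTree.

Section Group.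
Context {R : realType} {G : groupType}.
Variable S : seq G.

Local Open Scope group_scope.

Definition is_word_for (g : G) (n : nat) : Prop :=
  exists s : seq G, [/\ size s = n, {subset s <= S} & \prod_(a <- s) a = g].

Definition sym_generating : Prop :=
  {in S, forall a, a^-1 \in S} /\ forall g : G, exists n, is_word_for g n.

Definition wlen (g : G) : nat :=
  match pselect (exists n, `[< is_word_for g n >]) with
  | left e => ex_minn e
  | right _ => 0%N
  end.

Definition wdist (g h : G) : R := (wlen (g^-1 * h))%:R%R.

Definition gprod (o x z : G) : R :=
  ((wdist x o + wdist z o - wdist x z) / 2)%R.

Definition hyperbolic (delta : R) : Prop := forall x y z o : G,
  (Num.min (gprod o x y) (gprod o y z) - delta <= gprod o x z)%R.

Definition sphere_card (n : nat) : nat :=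
  #|` fset_set [set g : G | wlen g = n] |%N.

Definition growth : R :=
  limn (fun n : nat => ((sphere_card n)%:R `^ (n%:R^-1) : R)%R).

Definition converges_at_infinity (u : nat -> G) : Prop :=
  (gprod 1 (u p.1) (u p.2) : R) @[p --> filter_prod \oo \oo] --> +oo%R.

Definition same_limit (u v : nat -> G) : Prop :=
  (gprod 1 (u n) (v n) : R) @[n --> \oo] --> +oo%R.

Definition boundary : set (set (nat -> G)) :=
  [set xi | exists2 u, converges_at_infinity u &
     xi = [set v | converges_at_infinity v /\ same_limit u v]].

Definition bdry_gprod (xi eta : set (nat -> G)) : \bar R :=
  ereal_sup [set limf_einf (fun p : nat * nat => (gprod 1 (u p.1) (v p.2))%:E)
                           (filter_prod \oo \oo)
            | u in xi & v in eta].

(* Used for 0 < lam < 1 and z in [0, +oo], so that lam ^ +oo = 0. *)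
Definition epow (lam : R) (z : \bar R) : R :=
  (if z is z'%:E then lam `^ z' else 0)%R.

Definition dvisual (lamv : R) (xi eta : set (nat -> G)) : R :=
  inf [set l | exists (m : nat) (x : nat -> set (nat -> G)),
    [/\ forall k, (k <= m)%N -> boundary (x k), x 0%N = xi, x m = eta
      & l = (\sum_(k < m) epow lamv (bdry_gprod (x k) (x k.+1)))%R]].

Definition separated (delta : R) (n : nat) (p p' q q' : G) : Prop :=
  exists (T : metric_tree R) (Theta : G -> T) (o : G),
  let F := [:: p; p'; q; q'] in
  [/\ o \in F,
      {in F, forall x, mt_dist (Theta x) (Theta o) = wdist x o},
      {in F &, forall x y,
        wdist x y - 2 * delta <= mt_dist (Theta x) (Theta y) <= wdist x y}%R
    & forall a b, mt_arc (Theta p) (Theta p') a ->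
        mt_arc (Theta q) (Theta q') b -> (n%:R < mt_dist a b)%R].

End Group.

Definition tmc {A : finType} (adm : rel A) : set {ptws nat -> discrete_topology A} :=
  [set x | forall i, adm (x i) (x i.+1)].

(* The subspace tmc adm of the product of the discrete alphabets, pointed at x0
   since measurable types are pointed. *)
Definition Sigma {A : finType} {adm : rel A} (x0 : tmc adm) : Type := tmc adm.

HB.instance Definition _ (A : finType) (adm : rel A) (x0 : tmc adm) :=
  Topological.copy (Sigma x0) (tmc adm).
HB.instance Definition _ (A : finType) (adm : rel A) (x0 : tmc adm) :=
  isPointed.Build (Sigma x0) x0.

Definition BSigma {A : finType} {adm : rel A} (x0 : tmc adm) :=
  g_sigma_algebraType (@open (Sigma x0)).

Section MarkovChain.
Context {R : realType} {A : finType} {adm : rel A} {x0 : tmc adm}.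
Local Notation Sigma := (Sigma x0).
Local Notation BSigma := (BSigma x0).

Definition letter (x : Sigma) : nat -> A := set_val x.

Lemma theta_subproof (x : Sigma) : (fun i => letter x i.+1) \in tmc adm.
Proof. by apply/mem_set => i; have := set_valP x; apply. Qed.

Definition theta (x : Sigma) : Sigma :=
  exist (fun y => y \in tmc adm) _ (theta_subproof x).

Definition cyl (w : seq A) : set Sigma := [set x | mkseq (letter x) (size w) = w].

Definition theta_cyl (w : seq A) : set Sigma := iter (size w) theta @` cyl w.

(* The inverse branch of theta^|w| on theta_cyl w, junk elsewhere. *)
Definition tau (w : seq A) (x : Sigma) : Sigma :=
  xget point [set y | cyl w y /\ iter (size w) theta y = x].

Definition mixing : Prop := forall U V : set Sigma, open U -> open V ->
  U !=set0 -> V !=set0 ->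
  exists N : nat, forall n, (N <= n)%N -> (iter n theta @` U) `&` V !=set0.

Definition dist_s (s : R) (x y : Sigma) : R :=
  match pselect (exists i, letter x i != letter y i) with
  | left e => s ^+ ex_minn e
  | right _ => 0
  end.

Variable mu : probability BSigma R.

Definition theta_invariant : Prop :=
  forall B : set BSigma, measurable B -> mu (theta @^-1` B) = mu B.

Definition positive_on_cylinders : Prop :=
  forall w : seq A, sorted adm w -> (0 < mu (cyl w))%E.

Variable phi : seq A -> Sigma -> R.

(* phi w is the continuous version of d(mu o tau_w)/dmu on theta_cyl w. *)
Definition inverse_jacobian : Prop := forall w : seq A, sorted adm w ->
  {within theta_cyl w, continuous (phi w)} /\
  forall B : set BSigma, measurable B -> B `<=` theta_cyl w ->
    mu (tau w @` B) = (\int[mu]_(x in B) (phi w x)%:E)%E.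

Definition gibbs_markov : Prop :=
  exists C s : R, [/\ 0 < C, 0 < s < 1 &
    forall w : seq A, sorted adm w ->
      {in theta_cyl w, forall x, 0 < phi w x} /\
      {in theta_cyl w &, forall x y,
        `|ln (phi w x) - ln (phi w y)| <= C * dist_s s x y}].

End MarkovChain.

Arguments mixing {A adm} x0.

Section Extension.
Context {R : realType} {A : finType} {adm : rel A} {x0 : tmc adm}.
Context {G : groupType}.
Local Notation Sigma := (Sigma x0).
Variables (phi : seq A -> Sigma -> R) (kappa : Sigma -> G).

Definition kappa_n (n : nat) (x : Sigma) : G :=
  (\prod_(0 <= i < n) kappa (iter i theta x))%g.

Definition extension (p : Sigma * G) : Sigma * G :=
  (theta p.1, (p.2 * kappa p.1)%g).
Local Notation T := extension.

Definition transitive_ext : Prop := forall (a b : A) (g h : G), exists n : nat,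
  (iter n T @` (cyl [:: a] `*` [set g])) `&` (cyl [:: b] `*` [set h]) !=set0.

(* kappa_v is written kappa_n n (tau v x), as tau v x is in the cylinder of v. *)
Definition transfer (n : nat) (f : Sigma * G -> R) (p : Sigma * G) : R :=
  \sum_(v : n.-tuple A | sorted adm v && (p.1 \in theta_cyl v))
    phi v p.1 * f (tau v p.1, (p.2 * (kappa_n n (tau v p.1))^-1)%g).

Definition green (r : R) (f : Sigma * G -> R) (p : Sigma * G) : \bar R :=
  (\sum_(0 <= n <oo) (r ^+ n * transfer n f p)%:E)%E.

Definition XX (g : G) : Sigma * G -> R := \1_[set p | p.2 = g].

(* Under topological transitivity the limsup is the same at all points and for
   all XX h. *)
Definition rho : \bar R :=
  limn_esup (fun n => (transfer n (XX 1%g) (x0, 1%g) `^ n%:R^-1)%:E).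

Definition Rconv : R := (fine rho)^-1.

Definition transient : Prop :=
  forall x : Sigma, (green Rconv (XX 1%g) (x, 1%g) < +oo)%E.

Definition greenR (r : R) (h : G) (p : Sigma * G) : R := fine (green r (XX h) p).

Definition martinK (r : R) (h : G) (p : Sigma * G) : R :=
  greenR r h p / greenR r 1%g p.

Definition orbitK (r : R) (h : G) (p : Sigma * G) (n : nat) : R :=
  martinK r h (iter n T p).

Definition martin_pts (r : R) : set (Sigma * G) := [set p |
  (forall F : set G, finite_set F -> \forall n \near \oo, ~ F (kappa_n n p.1)) /\
  (forall h, cvgn (orbitK r h p))].

Definition martin_class (r : R) (p : Sigma * G) : set (Sigma * G) :=
  [set q | martin_pts r q /\ forall h, limn (orbitK r h p) = limn (orbitK r h q)].

Definition martin_boundary (r : R) : set (set (Sigma * G)) :=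
  [set P | exists2 p, martin_pts r p & P = martin_class r p].

(* As eta is the set of all sequences converging to eta, eta u says that u
   converges to eta. *)
Definition Xi (r : R) (eta : set (nat -> G)) : set (Sigma * G) :=
  [set q | exists p, [/\ martin_pts r p,
     eta (fun n => (p.2 * kappa_n n p.1)%g) & martin_class r p q]].

Variable S : seq G.

Definition lambda_condition (delta lam : R) : Prop :=
  exists2 C : R, 0 < C & forall (r : R) (x y : Sigma) (n : nat) (g g' h h' : G),
    1 <= r <= Rconv -> separated S delta n g g' h h' ->
    `|(greenR r h (x, g) / greenR r h (y, g')) /
      (greenR r h' (x, g) / greenR r h' (y, g')) - 1| <= C * lam ^+ n.

Definition martin_coef (lam r : R) (h : G) : R :=
  let l := ln (greenR r h (x0, 1%g)) in
  lam ^+ (2 * wlen S h) /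
    ((sphere_card S (wlen S h))%:R * (if l == 0 then 1 else `|l|)).

Definition dMartin_pts (lam r : R) (p q : Sigma * G) : R :=
  fine (limn (fun n => \esum_(h in [set: G])
    (martin_coef lam r h * `|ln (orbitK r h p n) - ln (orbitK r h q n)|)%:E))%E.

(* dMartin_pts does not depend on the choice of representatives. *)
Definition class_repr (P : set (Sigma * G)) : Sigma * G := xget (x0, 1%g) P.

Definition dMartin (lam r : R) (P Q : set (Sigma * G)) : R :=
  dMartin_pts lam r (class_repr P) (class_repr Q).

End Extension.

Section Metric.
Context {R : realType} {X Y : Type}.
Variables (D : set X) (dX : X -> X -> R) (dY : Y -> Y -> R).

Definition dist_continuous (f : X -> Y) : Prop :=
  forall x, D x -> forall e : R, 0 < e -> exists2 d : R, 0 < d &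
    forall y, D y -> dX x y < d -> dY (f x) (f y) < e.

Definition holder (a : R) (f : X -> Y) : Prop :=
  exists2 K : R, 0 < K &
    forall x y, D x -> D y -> dY (f x) (f y) <= K * dX x y `^ a.

End Metric.

Definition dist_homeo {R : realType} {X Y : Type} (D : set X) (E : set Y)
    (dX : X -> X -> R) (dY : Y -> Y -> R) (f : X -> Y) (g : Y -> X) : Prop :=
  [/\ set_bij D E f, {in D, cancel f g}, {in E, cancel g f},
      dist_continuous D dX dY f & dist_continuous E dY dX g].

(* Main.v *)
(* By the Gibbs property, the Green function G_r(X_h)(x, g) is comparable,
   uniformly in x, to f(h^-1 g), where f(k) sums r^n mu[wb] / mu[b] over the
   admissible words w with product k, and f(k l) is comparable to f(k) and f(l k)
   for fixed l.  Splitting words at their last visit to 1 bounds f(k) f(k^-1) by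
   the tail of the convergent series f(1); together with the symmetry of the Green
   function at R this gives f(k) -> 0 as |k| -> oo.

   Four points of a hyperbolic group are approximated by a tree with two hubs, so
   that the assumption on lambda applies to pairs separated in terms of Gromov
   products.  It yields f(ab) ~ f(a) f(b) along geodesics (Ancona's inequality)
   and, with |log K(h, .)| = O(1 + |h|),
     |log K(h, p) - log K(h, p')| <= C (1 + |h|) lambda^((p.p') - |h|).
   Summing against c_h = O(lambda^(2|h|) / #sphere(|h|)) proves that Xi is well
   defined and that d_Martin = O(lambda^(sigma.sigma')).  For the lower bound,
   choose h on a geodesic towards sigma, at a bounded distance beyond the point
   where the geodesic towards sigma' branches off.  Ancona's inequality and the
   decay of f make log K(h, .) differ by at least 1 between sigma and sigma', so
   d_Martin >= c_h, and c_h is estimated by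
   #sphere(n) = O((growth + epsilon / 2)^n).  Finally, Frink's chain argument shows
   that d_visual is comparable to lambda_visual^(sigma.sigma').

   Each sigma is the limit of an orbit, since by transitivity finitely many loops
   at a letter suffice to shadow geodesics; conversely an orbit leaving all finite
   sets has a subsequence converging to some sigma, which makes Xi surjective. *)
Require Import Defs.
From mathcomp Require Import all_boot all_order all_algebra.
From mathcomp Require Import finmap.
From mathcomp Require Import all_classical all_reals all_analysis.
From mathcomp Require Import measurable_realfun ring lra zify.
Set Implicit Arguments.
Unset Strict Implicit.
Unset Printing Implicit Defensive.
Import Order.TTheory GRing.Theory Num.Theory.
Import numFieldNormedType.Exports.
Local Open Scope classical_set_scope.
Local Open Scope ring_scope.

(** * Word metrics and Gromov products *)

(** Two kinds of estimates are kept apart. Up to constants everything is expressed by [f]; but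
    differences of [log K] must become small, and that smallness comes from the assumption on
    [lambda] alone. The symmetry of the Green function is assumed at [R] only. There [f(k) f(k^-1)]
    is comparable to [f(k)^2], so its smallness means decay, and as [f] increases with [r] the decay
    passes to all [r <= R]. It is used twice: for the gap between kernels, and to keep [|log G_r|]
    away from zero in [c_h]. The exponents reflect how [lambda^(2|h|)] is spent. In the upper
    estimate one factor [lambda^|h|] pays for the [lambda^(-|h|)] of the kernel estimate and the
    other makes the series converge. In the lower estimate both stay, together with the sphere size;
    the linear growth of [|log G_r|] is hidden in [epsilon]. The boundary may be empty. Nothing is
    then known about the growth rate, and the claims that involve it are vacuous. *)

Section WordLength.
Variables (G : groupType) (S : seq G) (S_gen : sym_generating S).
Local Open Scope group_scope.
Local Notation wl := (wlen S).

Lemma wlen_word g : is_word_for S g (wl g).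
Proof.
rewrite /wlen; case: pselect => [e|ne]; last first.
  by case: S_gen => _ /(_ g) [n hn]; case: ne; exists n; apply/asboolP.
by case: ex_minnP => n /asboolP.
Qed.

Lemma wlen_min g n : is_word_for S g n -> (wl g <= n)%N.
Proof.
move=> hn; rewrite /wlen; case: pselect => [e|//].
by case: ex_minnP => k _; apply; apply/asboolP.
Qed.

Lemma wlen1 : wl 1 = 0%N.
Proof. by apply/eqP; rewrite -leqn0; apply: wlen_min; exists [::]; rewrite big_nil. Qed.

Lemma wlen_eq0 g : wl g = 0%N -> g = 1.
Proof. by move=> h; case: (wlen_word g) => s []; rewrite h => /size0nil -> _ <-; rewrite big_nil. Qed.

Lemma wlenM g h : (wl (g * h) <= wl g + wl h)%N.
Proof.
case: (wlen_word g) (wlen_word h) => s [<- sS <-] [t [<- tS <-]].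
apply: wlen_min; exists (s ++ t); split; rewrite ?size_cat ?big_cat//.
by move=> a; rewrite mem_cat => /orP[/sS|/tS].
Qed.

Lemma wlenV_le g : (wl g^-1 <= wl g)%N.
Proof.
case: (wlen_word g) => s [<- sS <-]; apply: wlen_min.
exists (rev (map (fun a => a^-1) s)); split; first by rewrite size_rev size_map.
  by move=> a; rewrite mem_rev => /mapP [b /sS bS ->]; case: S_gen => + _; apply.
elim: s sS => [|a s IH] sS; first by rewrite !big_nil invg1.
rewrite map_cons rev_cons -cats1 big_cat big_seq1 big_cons invgM IH//.
by move=> b bs; apply: sS; rewrite inE bs orbT.
Qed.

Lemma wlenV g : wl g^-1 = wl g.
Proof. by apply/eqP; rewrite eqn_leq wlenV_le -{1}(invgK g) wlenV_le. Qed.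

Lemma wlen_gen s : s \in S -> (wl s <= 1)%N.
Proof.
move=> sS; apply: wlen_min; exists [:: s]; rewrite big_seq1; split => //.
by move=> a; rewrite inE => /eqP ->.
Qed.

(** A shortest word cut after [i] letters gives a point on a geodesic: neither factor exceeds the
    length of its piece, and the triangle inequality leaves no slack. *)
Lemma wlen_split g i j : wl g = (i + j)%N ->
  exists a b, [/\ g = a * b, wl a = i & wl b = j].
Proof.
move=> E; case: (wlen_word g) => s [ss sS sg].
set a := \prod_(x <- take i s) x; set b := \prod_(x <- drop i s) x.
have gE : g = a * b by rewrite -sg -{1}(cat_take_drop i s) big_cat.
have ha : (wl a <= i)%N.
  apply: wlen_min; exists (take i s); split=> //.
    by rewrite size_take ss E; case: ltnP => //; lia.
  by move=> x /mem_take /sS.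
have hb : (wl b <= j)%N.
  apply: wlen_min; exists (drop i s); split=> //.
    by rewrite size_drop ss E; lia.
  by move=> x /mem_drop /sS.
have := wlenM a b; rewrite -gE E => H.
by exists a, b; split=> //; lia.
Qed.

Lemma wlen_ind (P : G -> Prop) : P 1 ->
  (forall g s, s \in S -> wl (g * s) = (wl g).+1 -> P g -> P (g * s)) ->
  forall g, P g.
Proof.
move=> P1 PS g; move En : (wl g) => n; elim: n g En => [|n IH] g En.
  by rewrite (wlen_eq0 En).
have [a [s [gE wa ws]]] := @wlen_split g n 1 (etrans En (esym (addn1 n))).
rewrite gE; apply: PS; last exact: IH.
- case: (wlen_word s) => t []; rewrite ws; case: t => [//|b [|//]] _ tS <-.
  by rewrite big_seq1; apply: tS; rewrite inE.
- by rewrite -gE En wa.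
Qed.

Lemma finite_sphere n : finite_set [set g | wl g = n].
Proof.
apply: (@sub_finite_set _ _ ((fun t : n.-tuple (seq_sub S) => \prod_(a <- map val t) a) @` setT)).
  move=> g /= gn; case: (wlen_word g) => s [ss sS sg].
  have [t tE] : exists t : seq (seq_sub S), map val t = s.
    elim: s sS {ss sg} => [|a s IH] sS; first by exists [::].
    have [|t tE] := IH; first by move=> b bs; apply: sS; rewrite inE bs orbT.
    by exists (SeqSub (sS a (mem_head _ _)) :: t); rewrite /= tE.
  have st : size t == n by rewrite -(size_map val) tE ss gn.
  by exists (Tuple st) => //=; rewrite tE.
apply: finite_image; exact: finite_finset.
Qed.

Lemma finite_ball n : finite_set [set g | (wl g <= n)%N].
Proof.
elim: n => [|n IH].
  by apply: sub_finite_set (finite_sphere 0) => g /=; rewrite leqn0 => /eqP.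
apply: (@sub_finite_set _ _ ([set g | (wl g <= n)%N] `|` [set g | wl g = n.+1])); last first.
  by rewrite finite_setU; split => //; exact: finite_sphere.
move=> g /=; rewrite leq_eqVlt => /orP[/eqP|]; by [right|left].
Qed.

Lemma mem_sphere n g : (g \in fset_set [set g | wl g = n]) = (wl g == n).
Proof.
rewrite in_fset_set; last exact: finite_sphere.
by apply/idP/eqP; rewrite inE.
Qed.

End WordLength.

Section Geometry.
Variables (R : realType) (G : groupType) (S : seq G) (S_gen : sym_generating S).
Local Notation wl := (wlen S).
Local Notation d := (@wdist R G S).
Local Notation gp := (@gprod R G S).

Lemma wdist_ge0 x y : 0 <= d x y. Proof. exact: ler0n. Qed.
Lemma wdistxx x : d x x = 0.
Proof. by rewrite /wdist mulVg wlen1. Qed.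
Lemma wdistC x y : d x y = d y x.
Proof. by rewrite /wdist -(wlenV S_gen) invgM invgK. Qed.
Lemma wdist_tri x y z : d x z <= d x y + d y z.
Proof.
rewrite /wdist -natrD ler_nat.
have -> : (x^-1 * z = (x^-1 * y) * (y^-1 * z))%g by rewrite -mulgA mulVKg.
exact: wlenM.
Qed.
Lemma wdistMl g x y : d (g * x)%g (g * y)%g = d x y.
Proof. by rewrite /wdist invgM -mulgA mulKg. Qed.
Lemma wdist1 x : d x 1%g = (wl x)%:R.
Proof. by rewrite wdistC /wdist invg1 mul1g. Qed.

Lemma gprodC o x y : gp o x y = gp o y x.
Proof. by rewrite /gprod (wdistC x y) (addrC (d x o)). Qed.
Lemma gprod_ge0 o x y : 0 <= gp o x y.
Proof. have := wdist_tri x o y; rewrite /gprod (wdistC o y); lra. Qed.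
Lemma gprod_lel o x y : gp o x y <= d x o.
Proof. have := wdist_tri y x o; rewrite /gprod (wdistC y x); lra. Qed.
Lemma gprod_ler o x y : gp o x y <= d y o.
Proof. by rewrite gprodC gprod_lel. Qed.
Lemma gprodxx o x : gp o x x = d x o.
Proof. by rewrite /gprod wdistxx; lra. Qed.
Lemma gprod_shift o x y z : gp o x z - d x y <= gp o y z.
Proof.
have := wdist_tri x y o; have := wdist_tri y x z.
by rewrite /gprod (wdistC y x); lra.
Qed.

Lemma geodesic_point g n : (n <= wl g)%N ->
  exists2 p, wl p = n & gp 1 p g = n%:R /\ d p g = (wl g)%:R - n%:R.
Proof.
move=> ng; have [a [b [gE wa wb]]] := @wlen_split _ _ S_gen g n (wl g - n) (esym (subnKC ng)).
exists a => //.
have dE : d a g = (wl g)%:R - n%:R by rewrite /wdist gE mulKg wb -gE natrB.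
by split=> //; rewrite /gprod !wdist1 dE wa; lra.
Qed.

Variables (delta : R) (G_hyp : hyperbolic S delta).

(** Threshold form of the four point condition: lower bounds on Gromov products pass through an
    intermediate point [y] at the cost of one [delta]. *)
Lemma hyper a o x y z : a <= gp o x y -> a <= gp o y z -> a - delta <= gp o x z.
Proof. by move=> h1 h2; apply: le_trans (G_hyp x y z o); rewrite lerD2r le_min h1. Qed.

End Geometry.

Arguments wdist_ge0 {R G S}.
Arguments wdistxx {R G S}.
Arguments wdistC {R G S}.
Arguments wdist_tri {R G S}.
Arguments wdistMl {R G S}.
Arguments wdist1 {R G S}.
Arguments gprodC {R G S}.
Arguments gprod_ge0 {R G S}.
Arguments gprod_lel {R G S}.
Arguments gprod_ler {R G S}.
Arguments gprodxx {R G S}.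
Arguments gprod_shift {R G S}.
Arguments geodesic_point {R G S}.

(** * Separated pairs and quartet trees *)

Section QuartetTree.
Variables (R : realType) (L : R) (ell : bool -> bool -> R).
Hypotheses (L_gt0 : 0 < L) (ell_gt0 : forall s b, 0 < ell s b).

(* The tree with two hubs [(s, None)] joined by an edge of length [L], and two
   leaves [(s, Some b)] attached to each hub. *)
Definition quartet := (bool * option bool)%type.
Implicit Types u v : quartet.

Definition quartet_edge : rel quartet := fun u v =>
  match u, v with
  | (s, None), (s', None) => s != s'
  | (s, None), (s', Some _) | (s, Some _), (s', None) => s == s'
  | _, _ => false
  end.

Definition leaf_len u : R := if u.2 is Some b then ell u.1 b else 0.

(** One formula serves twice, as the length of an edge and as the distance of any two distinct
    vertices: the legs to the hubs plus, if it is crossed, the bridge. *)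
Definition quartet_len u v : R :=
  leaf_len u + leaf_len v + (if u.1 == v.1 then 0 else L).

Definition quartet_dist u v : R := if u == v then 0 else quartet_len u v.

Lemma quartet_edge_sym : symmetric quartet_edge.
Proof. by move=> [[] [b|]] [[] [c|]]. Qed.

Lemma quartet_edge_irr : irreflexive quartet_edge.
Proof. by move=> [[] [b|]]. Qed.

Lemma quartet_connected u v : connect quartet_edge u v.
Proof.
have hub s b : connect quartet_edge (s, None) (s, b).
  by case: b => [b|]; [apply: connect1; rewrite /= eqxx | exact: connect0].
have hubs s s' : connect quartet_edge (s, None) (s', None).
  by case: (eqVneq s s') => [->//|ne]; apply: connect1.
have sy : connect_sym quartet_edge := sym_connect_sym quartet_edge_sym.
case: u v => [s b] [s' b']; apply: connect_trans (connect_trans (hubs s s') (hub s' b')).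
by rewrite sy; exact: hub.
Qed.

(** On a simple cycle with more than two vertices the two neighbours of a vertex differ, while a
    leaf is adjacent to its hub only. Such a cycle would consist of hubs, of which there are two. *)
Lemma quartet_acyclic (c : seq quartet) : ucycle quartet_edge c -> (size c <= 2)%N.
Proof.
move=> /andP[cyc uc].
case: (ltnP 2 (size c)) => // sc.
have nleaf v : v \in c -> v.2 = None.
  move=> vc; move: (next_cycle cyc vc) (prev_cycle cyc vc).
  have ne : next c v != prev c v.
    have [i c' rE] := rot_to vc.
    rewrite -(next_rot i uc) -(prev_rot i uc) rE.
    have : uniq (v :: c') by rewrite -rE rot_uniq.
    have : (2 < size (v :: c'))%N by rewrite -rE size_rot.
    case: c' {rE} => [|a [|b c']] // _ /andP[nv uc'].
    have prevE y q : v \notin q -> prev_at v v y q = last y q.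
      by elim: q y => [|x q IH] y /=; rewrite ?eqxx// inE negb_or => /andP[/negbTE -> /IH].
    rewrite [prev _ _]prevE // [next _ _]/= eqxx /=.
    by apply: contraTneq uc' => /= ->; rewrite mem_last.
  case: v vc ne => s [b|//] _.
  case: (next c _) => [s1 [b1|]] //; case: (prev c _) => [s2 [b2|]] //= ne.
  by move=> /eqP e1 /eqP e2; rewrite -e1 e2 eqxx in ne.
have sub : {subset c <= [:: (true, None : option bool); (false, None)]}.
  by move=> [[] b] /nleaf /= ->.
by move: (uniq_leq_size uc sub); rewrite leqNgt sc.
Qed.

Lemma quartet_len_sym u v : quartet_len u v = quartet_len v u.
Proof. by rewrite /quartet_len eq_sym; congr (_ + _); rewrite addrC. Qed.

Lemma leaf_len_ge0 u : 0 <= leaf_len u.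
Proof. by case: u => s [b|] //=; rewrite /leaf_len /= ltW. Qed.

Lemma quartet_len_gt0 u v : quartet_edge u v -> 0 < quartet_len u v.
Proof.
have := ell_gt0; have := L_gt0; case: u v => [s [b|]] [s' [b'|]]; rewrite /quartet_len/leaf_len//=.
- by move=> _ h /eqP ->; rewrite eqxx !addr0.
- by move=> _ h /eqP ->; rewrite eqxx addr0 add0r.
- by move=> h _ /negbTE ->; rewrite !add0r.
Qed.

Definition quartet_tree : metric_tree R :=
  MetricTree quartet_edge_sym quartet_edge_irr quartet_connected quartet_acyclic
    quartet_len_sym quartet_len_gt0.

Lemma quartet_dist_tri_edge u v w : quartet_edge u v ->
  quartet_dist u w <= quartet_len u v + quartet_dist v w.
Proof.
have hL := L_gt0; have hl := leaf_len_ge0.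
rewrite /quartet_dist => e; case: eqVneq => [_|uw].
  case: ifP => _; have := quartet_len_gt0 e; have : 0 <= quartet_len v w by
    rewrite /quartet_len; have := hl v; have := hl w; case: ifP => _; lra.
  lra. lra.
case: eqVneq => [<-|vw]; first lra.
move: (hl u) (hl v) (hl w); rewrite /quartet_len.
have : ~~ (u.1 == w.1) -> (u.1 == v.1) && (v.1 == w.1) -> False.
  by move=> /negP h /andP[/eqP h1 /eqP h2]; apply: h; rewrite h1 h2.
case: (u.1 == v.1); case: (v.1 == w.1); case: (u.1 == w.1) => H; rewrite ?addr0; try lra; by case: H.
Qed.

Let D := mt_walk_len (T := quartet_tree).

Lemma walk_ge u p : path quartet_edge u p ->
  quartet_dist u (last u p) <= D u p.
Proof.
elim: p u => [|v p IH] u /=.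
  by rewrite /quartet_dist eqxx /D /mt_walk_len /= big_nil.
move=> /andP[e /IH h]; apply: le_trans (quartet_dist_tri_edge _ e) _.
by rewrite /D /mt_walk_len /= big_cons lerD2l.
Qed.

Let W u v l := exists p, [/\ path quartet_edge u p, last u p = v & l = D u p].

Let W_cat u v w l l' : W u v l -> W v w l' -> W u w (l + l').
Proof.
move=> [p [pp <- ->]] [q [pq <- ->]]; exists (p ++ q); split.
- by rewrite cat_path pp.
- by rewrite last_cat.
- rewrite /D /mt_walk_len; elim: p u {pp pq} => [|x p IH] u /=; first by rewrite big_nil add0r.
  by rewrite !big_cons -addrA IH.
Qed.

(** The walk through the hubs attains the infimum, and no walk is shorter because the formula
    satisfies the triangle inequality along each edge. *)
Lemma mt_distE u v : mt_dist (T := quartet_tree) u v = quartet_dist u v.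
Proof.
have W1 x y : quartet_edge x y -> W x y (quartet_len x y).
  by move=> e; exists [:: y]; rewrite /= e; split=> //; rewrite /D /mt_walk_len /= big_seq1.
have W0 x : W x x 0 by exists [::]; split=> //; rewrite /D /mt_walk_len /= big_nil.
have Whub x : W x (x.1, None) (leaf_len x).
  case: x => s [b|]; last exact: W0.
  have := W1 (s, Some b) (s, None) (eqxx _); rewrite /quartet_len /leaf_len /=.
  by rewrite eqxx !addr0.
have Wsym x : W (x.1, None) x (leaf_len x).
  case: x => s [b|]; last exact: W0.
  have := W1 (s, None) (s, Some b) (eqxx _); rewrite /quartet_len /leaf_len /=.
  by rewrite eqxx addr0 add0r.
have Wh s s' : W (s, None) (s', None) (if s == s' then 0 else L).
  case: eqVneq => [->|ne]; first exact: W0.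
  have := W1 (s, None) (s', None) ne; rewrite /quartet_len /leaf_len /= (negbTE ne).
  by rewrite !add0r.
have Wuv : W u v (quartet_dist u v).
  rewrite /quartet_dist; case: eqVneq => [->|_]; first exact: W0.
  have := W_cat (W_cat (Whub u) (Wh u.1 v.1)) (Wsym v).
  by rewrite /quartet_len addrAC.
apply/eqP; rewrite eq_le; apply/andP; split.
  apply: ge_inf => //; exists 0 => l [p [pp _ ->]].
  apply: le_trans (walk_ge pp); rewrite /quartet_dist; case: ifP => // _.
  rewrite /quartet_len; have := leaf_len_ge0 u; have := leaf_len_ge0 (last u p).
  by have := L_gt0; case: ifP => _; lra.
apply: lb_le_inf; first by case: Wuv => p h; exists (quartet_dist u v), p.
by move=> l [p [pp <- ->]]; exact: walk_ge.
Qed.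

(** A path leaves a side through its hub and can come back only through the same hub, which a simple
    path does not revisit. So arcs need not be computed: on different sides they are at least the
    bridge apart. *)
Lemma mt_arc_side s b b' (z : quartet) :
  mt_arc (T := quartet_tree) (s, b) (s, b') z -> z.1 = s.
Proof.
move=> [p [pp up lp zp]].
have far (u : quartet) q : u.1 != s -> path quartet_edge u q ->
    (s, None) \notin q -> (last u q).1 != s.
  elim: q u => //= v q IH u us /andP[e pq]; rewrite inE negb_or => /andP[nv nq].
  apply: (IH v) => //; case: v e nv {pq IH} => [sv [c|]].
    by case: u us => su [c'|] //= su' /eqP <-.
  by move=> _; rewrite /eq_op /= eqxx andbT eq_sym.
have : all (fun v => v.1 == s) ((s, b) :: p).
  have : (last (s, b) p).1 = s by rewrite lp.
  have : ((s, b) : quartet).1 = s by [].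
  move: {lp zp b'} pp up; move: (s, b) => u.
  elim: p u => [|v p IH] u; first by move=> _ _ /= ->; rewrite eqxx.
  move=> /= /andP[e pp] /and3P[un vn up] us lp; rewrite us eqxx /=.
  have vs : v.1 == s.
    apply: contraT => vs; suff uE : u = (s, None).
      move: un; rewrite uE inE negb_or => /andP[_ /(far v p vs pp)].
      by rewrite lp eqxx.
    case: u us e {un} => su [c|] /= us; last by rewrite us.
    by case: v vs {pp vn lp} => sv [c'|] //= vs /eqP h; rewrite -h us eqxx in vs.
  by have := IH v pp; rewrite /= vn up (eqP vs) eqxx; apply.
by move=> /allP /(_ z zp) /eqP.
Qed.

End QuartetTree.

Section Separated.
Variables (R : realType) (G : groupType) (S : seq G) (S_gen : sym_generating S).
Variables (delta : R) (delta_ge0 : 0 <= delta) (G_hyp : hyperbolic S delta).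
Local Notation d := (@wdist R G S).
Local Notation gp := (@gprod R G S).

(** Seen from [o = q], the points [p] and [p'] share the first [c] units of their way, while [q']
    branches off after [b]; the bridge has length [c - b > n]. Distances to [q] and between [p] and
    [p'] are exact. Those from [q'] to [p] and [p'] fall short by twice the gap between [b] and the
    corresponding product, hence by at most [2 * delta], because hyperbolicity keeps both products
    within [delta] of their maximum [b]. *)
Lemma separated_gprod n p p' q q' :
  Num.max (gp q q' p) (gp q q' p') + n%:R < gp q p p' ->
  Defs.separated S delta n p p' q q'.
Proof.
set b := Num.max _ _; set c := gp q p p' => bc.
have n0 : 0 <= n%:R :> R by [].
have L0 : 0 < c - b by lra.
have b1 : gp q q' p <= b by rewrite le_max lexx.
have b2 : gp q q' p' <= b by rewrite le_max lexx orbT.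
have b0 : 0 <= b := le_trans (gprod_ge0 S_gen _ _ _) b1.
have bq' : b <= d q' q by rewrite ge_max !gprod_lel.
have cp : c <= d p q by exact: gprod_lel.
have cp' : c <= d p' q by exact: gprod_ler.
have b3 : b - delta <= gp q q' p.
  have [h|h] := leP b (gp q q' p); first by move: delta_ge0; lra.
  apply: (hyper G_hyp (y := p')); last by rewrite (gprodC S_gen); move: L0; rewrite /c; lra.
  by move: h; rewrite /b; case: (leP (gp q q' p) (gp q q' p')) => _; lra.
have b4 : b - delta <= gp q q' p'.
  have [h|h] := leP b (gp q q' p'); first by move: delta_ge0; lra.
  apply: (hyper G_hyp (y := p)); last by move: L0; rewrite /c; lra.
  by move: h; rewrite /b; case: (leP (gp q q' p) (gp q q' p')) => _; lra.
pose raw s i := match s, i with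
  | false, true => b | false, false => d q' q - b
  | true, true => d p q - c | true, false => d p' q - c end.
have raw0 s i : 0 <= raw s i by case: s; case: i => /=; lra.
pose ell s i := if raw s i == 0 then 1 else raw s i.
have ell0 s i : 0 < ell s i.
  by rewrite /ell; case: eqP => // /eqP h; rewrite lt_neqAle eq_sym h raw0.
pose P s i : quartet := (s, if raw s i == 0 then None else Some i).
have PE s i : leaf_len ell (P s i) = raw s i.
  by rewrite /leaf_len /P /ell /=; case: eqP => //= /eqP /negbTE ->.
pose T := quartet_tree L0 ell0.
have TD s i s' j : (s, i) != (s', j) -> mt_dist (T := T) (P s i) (P s' j) =
    raw s i + raw s' j + (if s == s' then 0 else c - b).
  move=> ne; rewrite mt_distE /quartet_dist.
  case: eqVneq => [|_]; last by rewrite /quartet_len !PE.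
  rewrite /P => -[ss'] h; subst s'; rewrite eqxx addr0.
  move: h; case: eqP => [->|_]; case: eqP => [->|_] //; first by rewrite addr0.
  by move=> [ij]; rewrite ij eqxx in ne.
have T0 (u : T) : mt_dist u u = 0 by rewrite mt_distE /quartet_dist eqxx.
(* A map on the group must respect coincidences: [q = q'] or [p = p'] makes both legs at that hub
   vanish, and a coincidence across the bridge contradicts [b < c]. *)
pose Theta x : T := if x == q then P false true else if x == q' then P false false
  else if x == p then P true true else P true false.
have Tq : Theta q = P false true by rewrite /Theta eqxx.
have Tq' : Theta q' = P false false.
  rewrite /Theta eqxx; case: eqVneq => // e.
  have bz : b = 0 by apply/eqP; rewrite eq_le b0 andbT; move: bq'; rewrite e wdistxx.
  by rewrite /P /= bz e wdistxx subrr eqxx.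
have pq : p != q by apply/eqP => e; move: cp (L0); rewrite e wdistxx; lra.
have p'q : p' != q by apply/eqP => e; move: cp' (L0); rewrite e wdistxx; lra.
have pq' : p != q'.
  by apply/eqP => e; move: b1 cp (L0); rewrite -e gprodxx; lra.
have p'q' : p' != q'.
  by apply/eqP => e; move: b2 cp' (L0); rewrite -e gprodxx; lra.
have Tp : Theta p = P true true by rewrite /Theta (negbTE pq) (negbTE pq') eqxx.
have Tp' : Theta p' = P true false.
  rewrite /Theta (negbTE p'q) (negbTE p'q'); case: eqVneq => // e.
  have cE : c = d p q by rewrite /c e gprodxx.
  by rewrite /P /= e cE subrr eqxx.
have cE : d p p' = d p q + d p' q - 2 * c by rewrite /c /gprod; lra.
have q'pE : d q' p = d q' q + d p q - 2 * gp q q' p by rewrite /gprod; lra.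
have q'p'E : d q' p' = d q' q + d p' q - 2 * gp q q' p' by rewrite /gprod; lra.
have dC := wdistC (R := R) S_gen; have d0 := @wdistxx R G S.
exists T, Theta, q; split.
- by rewrite !inE eqxx !orbT.
- by move=> x; rewrite !inE => /or4P[] /eqP ->; rewrite ?T0 ?d0// ?Tp ?Tp' ?Tq ?Tq' TD //=; lra.
- move=> x y; rewrite !inE => /or4P[] /eqP -> /or4P[] /eqP ->;
    rewrite ?T0 ?d0 ?Tp ?Tp' ?Tq ?Tq' ?TD //=; move: (dC p p') (dC p q) (dC p' q) (dC p q') (dC p' q') (dC q q')
      delta_ge0; lra.
- move=> x y; rewrite Tp Tp' Tq Tq' => /mt_arc_side hx /mt_arc_side hy.
  rewrite mt_distE /quartet_dist; case: eqVneq => [xy|_]; first by move: hx; rewrite xy hy.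
  rewrite /quartet_len hx hy /=; have := leaf_len_ge0 ell0 x; have := leaf_len_ge0 ell0 y; lra.
Qed.

End Separated.

(** * Weights of admissible words *)

Section EsumFacts.
Local Open Scope ereal_scope.
Variable R : realType.

Lemma ge0_esumZl (T : choiceType) (I : set T) (a : T -> \bar R) (c : R) :
  (0 <= c)%R -> (forall i, I i -> 0 <= a i) ->
  \esum_(i in I) (c%:E * a i) = c%:E * \esum_(i in I) a i.
Proof.
move=> c0 a0.
have le (b : T -> \bar R) (k : R) : (0 <= k)%R -> (forall i, I i -> 0 <= b i) ->
    \esum_(i in I) (k%:E * b i) <= k%:E * \esum_(i in I) b i.
  move=> k0 b0; apply: ge_ereal_sup => _ [X [finX XI] <-].
  rewrite [leLHS](_ : _ = \esum_(i in X) (k%:E * b i)); last first.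
    by rewrite esum_fset// => i; rewrite inE => /XI /b0 h; rewrite mule_ge0.
  rewrite esum_fset//; last by move=> i; rewrite inE => /XI /b0 h; rewrite mule_ge0.
  rewrite fsbig_finite//= big_seq -ge0_sume_distrr; last first.
    by move=> i; rewrite in_fset_set// inE => /XI /b0.
  rewrite -big_seq -fsbig_finite//; apply: lee_wpmul2l => //.
  by apply: esum_ge; exists X.
apply/eqP; rewrite eq_le le//=.
have [->|cn0] := eqVneq c 0%R.
  by rewrite mul0e esum_ge0// => i _; rewrite mul0e.
have cp : (0 < c)%R by rewrite lt_neqAle eq_sym cn0.
rewrite -[leRHS]mul1e -[1]/(1%R%:E) -(divff cn0) EFinM -muleA.
apply: lee_wpmul2l => //; apply: le_trans (le _ c^-1%R _ _); last 2 first.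
- by rewrite invr_ge0.
- by move=> i Ii; rewrite mule_ge0 ?a0.
by apply: le_esum => i Ii; rewrite muleA -EFinM mulVf// mul1e.
Qed.

Lemma esum_subset (T : choiceType) (I J : set T) (a : T -> \bar R) :
  I `<=` J -> \esum_(i in I) a i <= \esum_(i in J) a i.
Proof.
move=> IJ; apply: ereal_sup_le => _ [X [finX XI] <-]; exists X => //.
by split => // x /XI /IJ.
Qed.

Lemma esum_le_inj (T T' : choiceType) (I : set T) (J : set T') (f : T -> T')
    (a : T -> \bar R) (b : T' -> \bar R) (c : R) : (0 <= c)%R ->
  set_inj I f -> (forall i, I i -> J (f i)) -> (forall j, J j -> 0 <= b j) ->
  (forall i, I i -> a i <= c%:E * b (f i)) ->
  \esum_(i in I) a i <= c%:E * \esum_(j in J) b j.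
Proof.
move=> c0 finj IJ b0 ab; apply: le_trans (le_esum ab) _.
rewrite (ge0_esumZl (a := b \o f))//; last by move=> i /IJ /b0.
apply: lee_wpmul2l => //; rewrite -(@esum_image _ _ _ I f b)//.
by apply: (@esum_subset T' (f @` I) J b) => _ [i Ii <-]; exact: IJ.
Qed.

Lemma esum_tail (T : choiceType) (I : set T) (a : T -> \bar R) (e : R) :
  (0 < e)%R -> (forall i, I i -> 0 <= a i) -> \esum_(i in I) a i < +oo ->
  exists2 X : set T, finite_set X & \esum_(i in I `\` X) a i <= e%:E.
Proof.
move=> e0 a0 foo; have finI : \esum_(i in I) a i \is a fin_num.
  by rewrite ge0_fin_numE// esum_ge0.
have [_ [X [finX XI] <-] hX] := ub_ereal_sup_adherent e0 finI.
exists X => //; move: (hX); rewrite -/(esum I a) (esumID X)//.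
have -> : I `&` X = X by apply/setIidr.
rewrite -setDE -(esum_fset finX); last by move=> i; rewrite inE => /XI /a0.
set s := \esum_(i in X) a i; set t := \esum_(i in I `\` X) a i.
have s0 : 0 <= s by apply: esum_ge0 => i /XI /a0.
have sfin : s \is a fin_num.
  by rewrite ge0_fin_numE//; apply: le_lt_trans foo; exact: esum_subset.
have tfin : t \is a fin_num.
  rewrite ge0_fin_numE; last by apply: esum_ge0 => i [/a0].
  by apply: le_lt_trans foo; apply: esum_subset => i [].
by case: s t sfin tfin {s0} => [s| |] [t| |] // _ _; rewrite -EFinD -EFinB lte_fin lee_fin; lra.
Qed.

End EsumFacts.

Section WordWeights.
Local Open Scope ereal_scope.
Variables (R : realType) (A : finType) (adm : rel A) (G : groupType) (kl : A -> G).
Variables (m : seq A -> R) (D : R) (r : R).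
Hypothesis r_ge1 : (1 <= r)%R.
Hypothesis m_ge0 : forall w, (0 <= m w)%R.
Hypothesis m_gt0 : forall w, sorted adm w -> (0 < m w)%R.
Hypothesis D_gt0 : (0 < D)%R.
Hypothesis m_distortion : forall v c w, sorted adm (v ++ c :: w) ->
  (D^-1 * (m (rcons v c) * m (c :: w)) <= m (v ++ c :: w) * m [:: c]
    <= D * (m (rcons v c) * m (c :: w)))%R.

Definition word_prod (w : seq A) : G := (\prod_(a <- w) kl a)%g.
Local Notation kw := word_prod.

(** Transitivity of the extension in terms of words. The form [head b u = a] also covers the empty
    [u], when [a = b]. *)
Hypothesis link : forall a b g, exists u,
  [/\ sorted adm (rcons u b), head b u = a & kw u = g].

Lemma word_prod_cat v w : kw (v ++ w) = (kw v * kw w)%g.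
Proof. exact: big_cat. Qed.

(** When [m] is the measure of cylinders, [m (rcons w b) / m [:: b]] is comparable to [phi w] at any
    point starting with [b]. Completing words by [b] thus replaces points by finitely many
    letters. *)
Definition weight (b : A) (w : seq A) : R := (r ^+ size w * m (rcons w b) / m [:: b])%R.

Definition weight_sum (b : A) (P : set (seq A)) : \bar R :=
  \esum_(w in [set w | sorted adm (rcons w b)] `&` P) (weight b w)%:E.

Local Notation W := weight_sum.
Local Notation F b k := (weight_sum b [set w | kw w = k]).

Lemma weight_ge0 b w : (0 <= weight b w)%R.
Proof. by rewrite /weight divr_ge0// mulr_ge0// exprn_ge0//; move: r_ge1; lra. Qed.

Lemma weight_gt0 b w : sorted adm (rcons w b) -> (0 < weight b w)%R.
Proof.
move=> sw; rewrite /weight divr_gt0// ?m_gt0// mulr_gt0// ?m_gt0// exprn_gt0//.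
by move: r_ge1; lra.
Qed.

Lemma catsI (v : seq A) : injective (cat v).
Proof. by move=> x y /eqP; rewrite eqseq_cat// eqxx => /eqP. Qed.

Lemma catIs (v : seq A) : injective (cat^~ v).
Proof.
move=> x y /= e; have sz : size x = size y.
  by apply/(@addIn (size v)); rewrite -!size_cat e.
by move/eqP: e; rewrite eqseq_cat// eqxx andbT => /eqP.
Qed.

Lemma rcons_head b (w : seq A) : exists w', rcons w b = head b w :: w'.
Proof. by case: w => [|a w]; [exists [::]|exists (rcons w b)]. Qed.

(** Bounded distortion makes weights almost multiplicative. The prefix is completed by the letter
    that follows it, [head b w], which is [b] itself when [w] is empty. *)
Lemma weight_cat b v w : sorted adm (v ++ rcons w b) ->
  (D^-1 * (weight (head b w) v * weight b w) <= weight b (v ++ w)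
    <= D * (weight (head b w) v * weight b w))%R.
Proof.
rewrite /weight rcons_cat; have [w' wE] := rcons_head b w; rewrite wE => sw.
have /andP[h1 h2] := m_distortion sw.
have ma : (0 < m [:: head b w])%R by exact: m_gt0.
have mb : (0 < m [:: b])%R by exact: m_gt0.
rewrite size_cat exprD; set a := head b w in ma h1 h2 *.
have rv : (0 <= r ^+ size v)%R by rewrite exprn_ge0//; move: r_ge1; lra.
have rw : (0 <= r ^+ size w)%R by rewrite exprn_ge0//; move: r_ge1; lra.
set x := (m (rcons v a)) in h1 h2 *; set y := m (a :: w') in h1 h2 *.
set z := m (v ++ _) in h1 h2 *.
have -> : (r ^+ size v * x / m [:: a] * (r ^+ size w * y / m [:: b]) =
  (r ^+ size v * r ^+ size w / (m [:: a] * m [:: b])) * (x * y))%R by field; rewrite !gt_eqF.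
have -> : (r ^+ size v * r ^+ size w * z / m [:: b] =
  (r ^+ size v * r ^+ size w / (m [:: a] * m [:: b])) * (z * m [:: a]))%R by field; rewrite !gt_eqF.
rewrite ![(_ * (_ / _ * _))%R]mulrCA !ler_pM2l//; first by rewrite h1.
all: have rv' : (0 < r ^+ size v)%R by rewrite exprn_gt0//; move: r_ge1; lra.
all: have rw' : (0 < r ^+ size w)%R by rewrite exprn_gt0//; move: r_ge1; lra.
all: by rewrite divr_gt0// mulr_gt0.
Qed.

Lemma weight_sum_ge0 b P : 0 <= W b P.
Proof. by apply: esum_ge0 => w _; rewrite lee_fin weight_ge0. Qed.

Lemma weight_sum_le b b' P Q (f : seq A -> seq A) c : (0 <= c)%R ->
  injective f -> (forall w, sorted adm (rcons w b) -> P w ->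
    [/\ sorted adm (rcons (f w) b'), Q (f w) & (weight b w <= c * weight b' (f w))%R]) ->
  W b P <= c%:E * W b' Q.
Proof.
move=> c0 finj h; apply: (esum_le_inj (f := f)) => //.
- by move=> x y _ _; apply: finj.
- by move=> w [sw Pw]; have [] := h w sw Pw.
- by move=> w _; rewrite lee_fin weight_ge0.
- by move=> w [sw Pw]; rewrite -EFinM lee_fin; have [] := h w sw Pw.
Qed.

Lemma sorted_cat_rcons v (c : A) w :
  sorted adm (v ++ c :: w) = sorted adm (rcons v c) && sorted adm (c :: w).
Proof.
elim: v => [|a v IH] //=.
by rewrite -cats1 !cat_path /= andbT -andbA.
Qed.

Lemma sorted_cat_head v w b :
  sorted adm (v ++ rcons w b) = sorted adm (rcons v (head b w)) && sorted adm (rcons w b).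
Proof. by have [w' ->] := rcons_head b w; exact: sorted_cat_rcons. Qed.

Lemma le_scale (d u x y : R) : (0 < d)%R -> (0 < u)%R ->
  (d^-1 * (u * x) <= y)%R -> (x <= d / u * y)%R.
Proof.
move=> d0 u0; rewrite [(d / u)%R]mulrC -mulrA ler_pdivlMl// => h.
by rewrite -ler_pdivrMl.
Qed.

(** Appending one fixed word over [l] that links [b] to [b'] is injective and costs a bounded
    factor. *)
Lemma weight_sum_right b b' l : exists2 C : R, (0 < C)%R &
  forall k, F b k <= C%:E * F b' (k * l)%g.
Proof.
have [u [su hu <-]] := link b b' l; have wu := weight_gt0 su.
exists (D / weight b' u)%R; first exact: divr_gt0.
move=> k; apply: (weight_sum_le (f := fun w => w ++ u)) => //.
- by rewrite divr_ge0// ltW.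
- exact: catIs.
move=> w sw /= <-; rewrite word_prod_cat rcons_cat sorted_cat_head hu sw; split=> //.
have /weight_cat : sorted adm (w ++ rcons u b') by rewrite sorted_cat_head hu sw.
rewrite hu => /andP[h _]; apply: le_scale => //.
by rewrite (mulrC (weight b' u)).
Qed.

Lemma weight_sum_heads b P : W b P <= \sum_(a : A) W b (P `&` [set w | head b w = a]).
Proof.
rewrite /weight_sum; under eq_bigr do rewrite setIA esum_mkcondr.
rewrite -esum_sum; last by move=> i j _ _; case: ifP => // _; rewrite lee_fin weight_ge0.
apply: le_esum => w _; rewrite (bigD1 (head b w))//= mem_set//= leeDl// sume_ge0//.
by move=> a _; case: ifP => // _; rewrite lee_fin weight_ge0.
Qed.

(** A linking word in front must fit the first letter of [w], so it depends on that letter.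
    Splitting the sum by first letters keeps each prolongation injective. *)
Lemma weight_sum_left b l : exists2 C : R, (0 < C)%R &
  forall k, F b k <= C%:E * F b (l * k)%g.
Proof.
have H a : exists u, [/\ sorted adm (rcons u a) & kw u = l].
  by have [u [su _ ku]] := link a a l; exists u.
have [u hu] := choice H.
pose c a := (D / weight a (u a))%R.
have c0 a : (0 < c a)%R by apply: divr_gt0 => //; apply: weight_gt0; case: (hu a).
exists (\sum_a c a + 1)%R; first by rewrite ltr_wpDl// sumr_ge0// => a _; exact/ltW.
move=> k; apply: le_trans (weight_sum_heads _ _) _.
apply: (@le_trans _ _ ((\sum_a c a)%:E * F b (l * k)%g)); last first.
  by apply: lee_wpmul2r; rewrite ?weight_sum_ge0// lee_fin; lra.
rewrite -sumEFin ge0_sume_distrl; last by move=> a _; rewrite lee_fin ltW.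
apply: lee_sum => a _; apply: (weight_sum_le (f := fun w => u a ++ w)).
- by rewrite ltW.
- exact: catsI.
move=> w sw [/= <- hw]; have [su ku] := hu a.
have sc : sorted adm (u a ++ rcons w b) by rewrite sorted_cat_head hw su.
rewrite word_prod_cat rcons_cat ku; split=> //.
have /andP[h _] := weight_cat sc.
have wu := weight_gt0 su.
by rewrite hw in h; exact: le_scale.
Qed.

(* Splitting off the longest prefix over [1] of a word for [h] leaves such a word. *)
Definition no_return (h : G) : set (seq A) :=
  [set w | kw w = h /\ forall i, (0 < i <= size w)%N -> kw (take i w) <> 1%g].

(** Cutting at the last visit to 1 leaves a word over 1 in front, and the sums over such words are
    at most [M] whichever letter follows. *)
Lemma weight_sum_no_return b h M : (0 <= M)%R -> (forall a, F a 1%g <= M%:E) ->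
  F b h <= (D * M)%:E * W b (no_return h).
Proof.
move=> M0 hM.
have dec (w : seq A) : exists p, w = p.2 ++ p.1 /\ (kw p.2 = 1%g) /\
    no_return (kw w) p.1.
  pose Q i := (i <= size w)%N && (kw (take i w) == 1%g).
  have exQ : exists i, Q i by exists 0%N; rewrite /Q take0 /word_prod big_nil eqxx.
  have ubQ i : Q i -> (i <= size w)%N by case/andP.
  case: (ex_maxnP exQ ubQ) => i /andP[iw /eqP ki] imax.
  exists (drop i w, take i w); rewrite /= cat_take_drop; split=> //; split=> //; split.
    by rewrite -[in RHS](cat_take_drop i w) word_prod_cat ki mul1g.
  move=> j /andP[j0 jw] kj; have : Q (i + j)%N.
    rewrite /Q takeD word_prod_cat ki kj mulg1 eqxx andbT.
    by move: jw; rewrite size_drop; lia.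
  by move=> /imax; lia.
have [f hf] := choice dec.
pose I2 : set (seq A) := [set w | sorted adm (rcons w b)] `&` no_return h.
pose J2 w2 : set (seq A) := [set w | sorted adm (rcons w (head b w2))] `&` [set w | kw w = 1%g].
pose t (w2 w1 : seq A) : \bar R := (weight b w2)%:E * (weight (head b w2) w1)%:E.
have t0 w2 w1 : 0 <= t w2 w1 by rewrite mule_ge0// lee_fin weight_ge0.
have -> : (D * M)%:E * W b (no_return h) = D%:E * \esum_(w in I2) (M%:E * (weight b w)%:E).
  by rewrite EFinM -muleA ge0_esumZl// => w _; rewrite lee_fin weight_ge0.
apply: (@le_trans _ _ (D%:E * \esum_(w in I2) \esum_(w1 in J2 w) t w w1)); last first.
  apply: lee_wpmul2l; first by rewrite lee_fin ltW.
  apply: le_esum => w _; rewrite /t ge0_esumZl ?weight_ge0//; last first.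
    by move=> i _; rewrite lee_fin weight_ge0.
  by rewrite muleC; apply: lee_wpmul2r; [rewrite lee_fin weight_ge0|exact: hM].
rewrite esum_esum//; apply: (esum_le_inj (f := f)).
- exact: ltW.
- move=> x y _ _ exy; have [-> _] := hf x; have [-> _] := hf y.
  by rewrite exy.
- move=> w [/= sw kwh]; have [wE [k1 nr]] := hf w; rewrite kwh in nr.
  move: sw; rewrite {1}wE rcons_cat sorted_cat_head => /andP[s1 s2].
  by split; split.
- by move=> p _; exact: t0.
- move=> w [/= sw kwh]; have [wE _] := hf w.
  move: sw; rewrite {1}wE rcons_cat => /weight_cat /andP[_ h2].
  by rewrite {1}wE /t -!EFinM lee_fin [X in (D * X)%R]mulrC.
Qed.

(** The converse of cutting. As every word over [h] has at least [L] letters, the joined words are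
    long, which turns the product into part of the tail of a sum. *)
Lemma weight_sum_mul b : exists2 C : R, (0 < C)%R & forall g h L,
  F b g < +oo -> (forall w, kw w = h -> (L <= size w)%N) ->
  F b g * W b (no_return h) <=
    C%:E * W b [set w | kw w = (g * h)%g /\ (L <= size w)%N].
Proof.
have [u hu] := choice (fun a => link b a 1%g).
have wu a : (0 < weight a (u a))%R by apply: weight_gt0; case: (hu a).
pose c := (\sum_a (weight a (u a))^-1 + 1)%R.
have c0 : (0 < c)%R by rewrite ltr_wpDl// sumr_ge0// => a _; rewrite invr_ge0 ltW.
exists (D * D * c)%R; first by rewrite !mulr_gt0.
move=> g h L Ffin hL.
(* Joining the two words by a connection over [1] is injective: the difference
   of two possible cuts would be a return to [1] of the second word. *)
pose I2 : set (seq A) := [set w | sorted adm (rcons w b)] `&` no_return h.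
pose I1 : set (seq A) := [set w | sorted adm (rcons w b)] `&` [set w | kw w = g].
have -> : F b g * W b (no_return h) =
    \esum_(w2 in I2) \esum_(w1 in I1) ((weight b w2)%:E * (weight b w1)%:E).
  rewrite -(fineK (_ : F b g \is a fin_num)); last by rewrite ge0_fin_numE// weight_sum_ge0.
  rewrite -ge0_esumZl; last 2 first.
  - by rewrite fine_ge0// weight_sum_ge0.
  - by move=> w _; rewrite lee_fin weight_ge0.
  apply: eq_esum => w _; rewrite ge0_esumZl ?weight_ge0//; last first.
    by move=> i _; rewrite lee_fin weight_ge0.
  by rewrite muleC fineK// ge0_fin_numE// weight_sum_ge0.
rewrite esum_esum; last by move=> i j _ _; rewrite mule_ge0// lee_fin weight_ge0.
pose f (p : seq A * seq A) := p.2 ++ (u (head b p.1) ++ p.1).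
have fle p q : (I2 `*`` (fun=> I1)) p -> (I2 `*`` (fun=> I1)) q -> f p = f q ->
    (size p.2 + size (u (head b p.1)) <= size q.2 + size (u (head b q.1)))%N -> p = q.
  case: p q => [w2 v] [w2' v'] [[/= _ [_ n2]] [/= _ kv]] [[/= _ _] [/= _ kv']].
  rewrite /f /= !catA => e le; have [_ _ ku] := hu (head b w2).
  have [_ _ ku'] := hu (head b w2'); rewrite -!size_cat in le.
  set p := v ++ _ in e le; set p' := v' ++ _ in e le.
  have kp : kw p = kw p' by rewrite /p /p' !word_prod_cat ku ku' !mulg1 kv kv'.
  have p'E : p' = p ++ take (size p' - size p) w2.
    have := congr1 (take (size p')) e; rewrite take_cat ltnNge le /= => ->.
    by rewrite take_size_cat.
  have ke : kw (take (size p' - size p) w2) = 1%g.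
    by move: kp; rewrite [X in _ = kw X]p'E word_prod_cat -{1}[kw p]mulg1 => /mulgI <-.
  have z : (size p' - size p = 0)%N.
    apply/eqP; rewrite -leqn0 leqNgt; apply/negP => z0; apply: n2 ke.
    rewrite z0 /= leq_subLR; apply: (leq_trans (n := size (p ++ w2))).
      by rewrite e size_cat leq_addr.
    by rewrite size_cat.
  rewrite z take0 cats0 in p'E; move: e; rewrite p'E => /catsI e2.
  by subst w2'; move: p'E; rewrite /p /p' => /catIs ->.
apply: (esum_le_inj (f := f)).
- by rewrite !mulr_ge0 ?ltW.
- move=> p q; rewrite !inE => Ip Iq e.
  by case: (leqP (size p.2 + size (u (head b p.1))) (size q.2 + size (u (head b q.1)))) =>
    [|/ltnW] l; [apply: fle|apply/esym/fle].
- move=> [w2 v] [[/= s2 [k2 _]] [/= s1 k1]]; have [su hd ku] := hu (head b w2).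
  rewrite /f /=; split=> /=.
    have hE : head b (u (head b w2) ++ w2) = b.
      by case: (u _) hd => [|x u'] //= hd; rewrite -hd.
    by rewrite rcons_cat sorted_cat_head hE s1 rcons_cat sorted_cat_head su.
  rewrite !word_prod_cat k1 ku k2 mul1g; split=> //.
  by rewrite !size_cat addnA; apply: leq_trans (hL _ k2) (leq_addl _ _).
- by move=> w _; rewrite lee_fin weight_ge0.
move=> [w2 v] [[/= s2 [k2 _]] [/= s1 k1]]; have [su hd ku] := hu (head b w2).
have s3 : sorted adm (u (head b w2) ++ rcons w2 b) by rewrite sorted_cat_head su s2.
have hE : head b (u (head b w2) ++ w2) = b.
  by case: (u _) hd => [|x u'] //= hd; rewrite -hd.
have s4 : sorted adm (v ++ rcons (u (head b w2) ++ w2) b).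
  by rewrite sorted_cat_head hE s1 rcons_cat.
have /andP[h4 _] := weight_cat s4; have /andP[h3 _] := weight_cat s3.
rewrite hE in h4; rewrite -!EFinM lee_fin /f /=.
have w2le : (weight b w2 <= D / weight (head b w2) (u (head b w2)) * weight b (u (head b w2) ++ w2))%R.
  exact: le_scale.
have cu : ((weight (head b w2) (u (head b w2)))^-1 <= c)%R.
  rewrite /c (bigD1 (head b w2))//= -addrA lerDl addr_ge0// sumr_ge0// => a _.
  by rewrite invr_ge0 ltW.
have w3le : (weight b w2 <= D * c * weight b (u (head b w2) ++ w2))%R.
  apply: le_trans w2le _; rewrite ler_wpM2r ?weight_ge0// ler_wpM2l// ltW//.
apply: (@le_trans _ _ (D * c * (weight b v * weight b (u (head b w2) ++ w2))))%R.
  by rewrite [leLHS]mulrC [leRHS]mulrCA; apply: ler_wpM2l => //; exact: weight_ge0.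
have h5 : (weight b v * weight b (u (head b w2) ++ w2) <=
    D * weight b (v ++ (u (head b w2) ++ w2)))%R by rewrite -ler_pdivrMl.
apply: le_trans (ler_wpM2l _ h5) _; first by rewrite mulr_ge0 ?ltW.
by rewrite le_eqVlt; apply/orP; left; apply/eqP; ring.
Qed.

Lemma weight_sum_gt0 b k : 0 < F b k.
Proof.
have [u [su _ ku]] := link b b k.
apply: (@lt_le_trans _ _ (weight b u)%:E); first by rewrite lte_fin weight_gt0.
rewrite -(esum_set1 (a := fun w => (weight b w)%:E)) ?lee_fin ?weight_ge0//.
by apply: esum_subset => _ ->.
Qed.

Lemma weight_sum_fin b1 : F b1 1%g < +oo -> forall b k, F b k < +oo.
Proof.
move=> fin b k; have [C C0 /(_ k)] := weight_sum_right b b1 k^-1%g.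
rewrite mulgV => /le_lt_trans; apply; rewrite -(fineK (_ : F b1 1%g \is a fin_num)).
  by rewrite -EFinM ltry.
by rewrite ge0_fin_numE// weight_sum_ge0.
Qed.

Lemma weight_sum_bound : (forall b, F b 1%g < +oo) ->
  exists2 M : R, (0 < M)%R & forall b, F b 1%g <= M%:E.
Proof.
move=> fin; exists (\sum_b fine (F b 1%g) + 1)%R.
  by rewrite ltr_wpDl// sumr_ge0// => b _; rewrite fine_ge0// weight_sum_ge0.
move=> b; rewrite -(fineK (_ : F b 1%g \is a fin_num)).
  rewrite lee_fin (bigD1 b)//= -addrA lerDl addr_ge0// sumr_ge0// => a _.
  by rewrite fine_ge0// weight_sum_ge0.
by rewrite ge0_fin_numE// weight_sum_ge0.
Qed.

Lemma wlen_word_prod (S : seq G) : sym_generating S ->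
  exists2 K : nat, (0 < K)%N & forall w, (wlen S (kw w) <= K * size w)%N.
Proof.
move=> S_gen; exists (\max_a wlen S (kl a)).+1 => // w.
elim: w => [|a w IH]; first by rewrite /word_prod big_nil wlen1.
rewrite /word_prod big_cons mulnS; apply: leq_trans (wlenM S_gen _ _) _.
by apply: leq_add => //; apply: leqW; exact: leq_bigmax.
Qed.

Lemma weight_sum_mul_inv (S : seq G) b : sym_generating S -> (forall b, F b 1%g < +oo) ->
  forall e : R, (0 < e)%R -> exists n : nat, forall g, (n <= wlen S g)%N ->
    F b g * F b g^-1%g <= e%:E.
Proof.
move=> S_gen fin e e0; have [M M0 hM] := weight_sum_bound fin.
have [C C0 hC] := weight_sum_mul b; have [K K0 hK] := wlen_word_prod S_gen.
pose t := (e / (D * M * C))%R.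
have t0 : (0 < t)%R by rewrite divr_gt0// !mulr_gt0.
have [|X finX hX] := esum_tail t0 _ (fin b).
  by move=> w _; rewrite lee_fin weight_ge0.
(* One letter moves by at most [K], so words over [g^-1] have at least [L] letters once
   [K * L <= wlen S g]; all words that long lie outside [X]. *)
pose L := (\max_(w <- fset_set X) size w).+1.
have hL w : X w -> (size w < L)%N.
  by move=> Xw; rewrite ltnS; apply: leq_bigmax_seq => //; rewrite in_fset_set// inE.
exists (K * L)%N => g gL.
have gsize w : kw w = g^-1%g -> (L <= size w)%N.
  move=> kwg; have := hK w; rewrite kwg wlenV// => /(leq_trans gL).
  by rewrite leq_mul2l eqn0Ngt K0.
have Fg : F b g < +oo by exact: weight_sum_fin (fin b) b g.
have step1 : F b g * F b g^-1%g <= (D * M)%:E * (F b g * W b (no_return g^-1%g)).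
  rewrite muleCA; apply: lee_wpmul2l; first exact: weight_sum_ge0.
  by apply: weight_sum_no_return => //; exact: ltW.
apply: le_trans step1 _.
have step2 : W b [set w | kw w = (g * g^-1)%g /\ (L <= size w)%N] <= t%:E.
  apply: le_trans hX; apply: esum_subset => w [/= sw [kwg Lw]]; split => //.
    by split=> //=; rewrite kwg mulgV.
  by move=> /hL; rewrite ltnNge Lw.
apply: (@le_trans _ _ ((D * M)%:E * (C%:E * t%:E))).
  apply: lee_wpmul2l; first by rewrite lee_fin mulr_ge0 ?ltW.
  apply: le_trans (hC _ _ _ Fg gsize) _; apply: lee_wpmul2l => //.
  by rewrite lee_fin ltW.
rewrite -!EFinM lee_fin /t le_eqVlt; apply/orP; left; apply/eqP.
by field; rewrite !gt_eqF.
Qed.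

End WordWeights.

Lemma weight_sum_le_r (R : realType) (A : finType) (adm : rel A) (m : seq A -> R)
    (r r' : R) (b : A) (P : set (seq A)) : (0 <= r)%R -> (r <= r')%R ->
  (forall w, (0 <= m w)%R) ->
  (weight_sum adm m r b P <= weight_sum adm m r' b P)%E.
Proof.
move=> r0 rr' m0; apply: le_esum => w _; rewrite lee_fin /weight.
by rewrite ler_wpM2r ?invr_ge0// ler_wpM2r// lerXn2r// nnegrE// (le_trans r0).
Qed.

(** * Cylinders and Green functions *)

Section Words.
Variables (A : finType) (adm : rel A) (x0 : tmc adm).
Local Notation Sigma := (Sigma x0).
Implicit Types (x y : Sigma) (v w : seq A).

Lemma letter_theta n x i : letter (iter n (@theta _ _ x0) x) i = letter x (n + i).
Proof. by elim: n i => [|n IH] i //=; rewrite -[LHS]/(letter _ i.+1) IH addnS. Qed.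

Lemma letter_inj x y : (forall i, letter x i = letter y i) -> x = y.
Proof. by move=> e; apply/val_inj/funext. Qed.

Lemma letter_adm x i : adm (letter x i) (letter x i.+1).
Proof. by have := set_valP x; apply. Qed.

Lemma sorted_letters x n : sorted adm (mkseq (letter x) n).
Proof.
case: n => // n; rewrite /mkseq /=; elim: n 0%N => //= n IH i.
by rewrite letter_adm IH.
Qed.

Lemma cyl_cat v w x :
  cyl (v ++ w) x <-> cyl v x /\ cyl w (iter (size v) (@theta _ _ x0) x).
Proof.
have E : mkseq (letter x) (size (v ++ w)) = mkseq (letter x) (size v) ++
    mkseq (letter (iter (size v) (@theta _ _ x0) x)) (size w).
  rewrite /mkseq size_cat iotaD map_cat add0n; congr (_ ++ _).
  rewrite -[X in iota X _]addn0 iotaDl -map_comp; apply: eq_map => i /=.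
  by rewrite letter_theta.
rewrite /cyl /= E; split=> [/eqP|[-> ->]//].
by rewrite eqseq_cat ?size_mkseq// => /andP[/eqP -> /eqP ->].
Qed.

Lemma prepend w x : sorted adm (rcons w (letter x 0)) ->
  exists y, cyl w y /\ iter (size w) (@theta _ _ x0) y = x.
Proof.
elim: w => [|a w IH] sw; first by exists x.
have [|y [cy iy]] := IH; first by case: w sw {IH} => //= b w /andP[].
have ay : adm a (letter y 0).
  case: w sw cy iy {IH} => [|b w] /= /andP[ab _]; first by move=> _ ->.
  by move=> [-> _].
pose z i := if i is i'.+1 then letter y i' else a.
have zP : z \in tmc adm by apply/mem_set => -[|i] //=; exact: letter_adm.
pose Z : Sigma := exist _ z zP.
have Zy : theta Z = y by apply: letter_inj.
exists Z; split; last by rewrite iterSr Zy.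
by apply/(cyl_cat [:: a] w); split=> //=; rewrite Zy.
Qed.

(** The Markov property: the branches defined at [x], hence the words over which the transfer
    operator sums, depend only on its first letter. *)
Lemma theta_cylP w x : theta_cyl w x <-> sorted adm (rcons w (letter x 0)).
Proof.
split=> [[y cy <-]|/prepend [y [cy iy]]]; last by exists y.
suff -> : rcons w (letter (iter (size w) (@theta _ _ x0) y) 0) = mkseq (letter y) (size w).+1.
  exact: sorted_letters.
by rewrite mkseqS cy letter_theta addn0.
Qed.

Lemma cyl_head c w x : cyl (c :: w) x -> letter x 0 = c.
Proof. by move=> []. Qed.

Lemma tauP w x : theta_cyl w x ->
  cyl w (tau w x) /\ iter (size w) (@theta _ _ x0) (tau w x) = x.
Proof. by move=> [y cy iy]; rewrite /tau; case: xgetP => [z _ //|/(_ y)]; case. Qed.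

Lemma cyl_inj w x y : cyl w x -> cyl w y ->
  iter (size w) (@theta _ _ x0) x = iter (size w) (@theta _ _ x0) y -> x = y.
Proof.
move=> cx cy e; apply: letter_inj => i; case: (ltnP i (size w)) => [iw|wi].
  by have := congr1 (fun s => nth (letter x 0) s i) (etrans cx (esym cy)); rewrite !nth_mkseq.
by have := congr1 (fun z => letter z (i - size w)) e; rewrite !letter_theta subnKC.
Qed.

Lemma tau_image v c w : sorted adm (rcons v c) ->
  tau v @` cyl (c :: w) = cyl (x0 := x0) (v ++ c :: w).
Proof.
move=> sv; have tc x : letter x 0 = c -> theta_cyl v x by move=> hx; apply/theta_cylP; rewrite hx.
apply/seteqP; split=> [_ [x cx <-]|y cy].
  by have [h1 h2] := tauP (tc _ (cyl_head cx)); apply/cyl_cat; rewrite h2.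
have [c1 c2] := (cyl_cat _ _ _).1 cy.
exists (iter (size v) (@theta _ _ x0) y) => //.
by have [h1 h2] := tauP (tc _ (cyl_head c2)); apply: cyl_inj h2.
Qed.

Lemma open_letter i (a : A) : open [set x : Sigma | letter x i = a].
Proof.
have c1 : continuous (set_val : Sigma -> {ptws nat -> discrete_topology A}).
  exact: initial_continuous.
have c2 : continuous (fun f : {ptws nat -> discrete_topology A} => f i).
  exact: (@proj_continuous nat (fun=> discrete_topology A) i).
have c3 : continuous (fun x : Sigma => (letter x i : discrete_topology A)).
  move=> x; apply: (@continuous_comp Sigma {ptws nat -> discrete_topology A} _
    set_val (fun f : {ptws nat -> discrete_topology A} => f i) x); first exact: c1.
  exact: c2.
by have /continuousP /(_ [set a : discrete_topology A]) := c3; apply; exact: discrete_open.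
Qed.

Lemma open_cyl w : open (cyl (x0 := x0) w).
Proof.
elim/last_ind: w => [|w a IH].
  by rewrite (_ : cyl [::] = setT); [exact: openT|apply/seteqP; split].
rewrite (_ : cyl _ = cyl w `&` [set x | letter x (size w) = a]).
  by apply: openI => //; exact: open_letter.
apply/seteqP; split=> x /=; rewrite /cyl /= size_rcons mkseqS.
  by move=> /rcons_inj [].
by case=> -> ->.
Qed.

Lemma measurable_cyl w : measurable (cyl w : set (BSigma x0)).
Proof. by apply: sub_sigma_algebra; exact: open_cyl. Qed.

Variables (G : groupType) (kappa : Sigma -> G).
Hypothesis kappa_loc : forall x y, letter x 0%N = letter y 0%N -> kappa x = kappa y.

(** Letters that start no point of the chain receive the junk value [kappa x0]. *)
Definition letter_kappa (a : A) : G := kappa (xget (x0 : Sigma) (cyl [:: a])).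

Lemma kappaE x : kappa x = letter_kappa (letter x 0).
Proof.
apply: kappa_loc; case: xgetP => [y _ []//|/(_ x)] h.
by exfalso; apply: h.
Qed.

Lemma kappa_nE n x : kappa_n kappa n x = word_prod letter_kappa (mkseq (letter x) n).
Proof.
rewrite /kappa_n /word_prod big_map /index_iota subn0; apply: eq_bigr => i _.
by rewrite kappaE letter_theta addn0.
Qed.

Lemma iter_extension n p : iter n (extension kappa) p =
  (iter n (@theta _ _ x0) p.1, (p.2 * kappa_n kappa n p.1)%g).
Proof.
elim: n => [|n IH]; first by rewrite /kappa_n big_geq// mulg1; case: p.
by rewrite iterS IH /extension /= /kappa_n big_nat_recr//= mulgA.
Qed.

Hypothesis T_trans : transitive_ext kappa.

Lemma link_words a b g : exists u,
  [/\ sorted adm (rcons u b), head b u = a & word_prod letter_kappa u = g].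
Proof.
have [n [_ [[[x g0] [/= ca ->] <-]]]] := T_trans a b 1%g g.
rewrite iter_extension /= mul1g => -[/= cb kg].
exists (mkseq (letter x) n); rewrite -kappa_nE kg; split=> //.
  have <- : letter x n = b by have := cyl_head cb; rewrite letter_theta addn0.
  by rewrite -mkseqS; exact: sorted_letters.
case: n cb {kg} => [|n] cb; last exact: (cyl_head ca).
by rewrite -(cyl_head cb) -(cyl_head ca).
Qed.

End Words.

(** * The Gibbs property of cylinder measures *)

Section CylinderMeasure.
Variables (R : realType) (A : finType) (adm : rel A) (x0 : tmc adm).
Local Notation Sigma := (Sigma x0).
Variables (mu : probability (BSigma x0) R) (phi : seq A -> Sigma -> R).
Hypotheses (mu_pos : positive_on_cylinders mu) (phi_jac : inverse_jacobian mu phi).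
Variable C : R.
Hypothesis phi_gt0 : forall w x, sorted adm w -> theta_cyl w x -> 0 < phi w x.
Hypothesis phi_ratio : forall w x y, sorted adm w -> theta_cyl w x -> theta_cyl w y ->
  phi w x <= expR C * phi w y.

Definition cyl_measure (w : seq A) : R := fine (mu (cyl w)).
Local Notation m := cyl_measure.

Lemma cyl_measureE w : mu (cyl w) = (m w)%:E.
Proof.
rewrite /m fineK// ge0_fin_numE ?measure_ge0//.
apply: le_lt_trans (ltry 1); apply: probability_le1; exact: measurable_cyl.
Qed.

Lemma cyl_measure_ge0 w : 0 <= m w.
Proof. by rewrite fine_ge0. Qed.

Lemma cyl_measure_gt0 w : sorted adm w -> 0 < m w.
Proof. by move=> /mu_pos; rewrite cyl_measureE lte_fin. Qed.

Lemma sorted_rconsl w (b : A) : sorted adm (rcons w b) -> sorted adm w.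
Proof. by case: w => //= a w; rewrite rcons_path => /andP[]. Qed.

Lemma open_theta_cyl v : open (theta_cyl (x0 := x0) v).
Proof.
rewrite (_ : theta_cyl v = \bigcup_(c in [set c | sorted adm (rcons v c)])
    [set x | letter x 0 = c]).
  by apply: bigcup_open => c _; exact: open_letter.
apply/seteqP; split=> [x /theta_cylP sx|x [c sc /= hx]]; first by exists (letter x 0).
by apply/theta_cylP; rewrite hx.
Qed.

Lemma measurable_phi v c w : sorted adm (rcons v c) ->
  measurable_fun (cyl (c :: w) : set (BSigma x0)) (phi v : BSigma x0 -> R).
Proof.
move=> sv; have [phic _] := phi_jac (sorted_rconsl sv).
rewrite (continuous_open_subspace _ (open_theta_cyl v)) in phic.
apply: (measurability _ (measurable_realfun.RGenOInfty.measurableE R)).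
move=> _ [_ [a ->] <-]; apply: sub_sigma_algebra.
rewrite /preimage openE => x [cx /= ax].
have tx : theta_cyl v x by apply/theta_cylP; rewrite (cyl_head cx).
apply: filterI; first by apply: open_nbhs_nbhs; split => //; exact: open_cyl.
have := phic x (mem_set tx) => /cvgr_gt /(_ a).
rewrite in_itv /= andbT in ax.
by move=> /(_ ax); apply: filterS => y /= ay; rewrite in_itv /= andbT.
Qed.

(** The cylinder of [v ++ c :: w] is the image of that of [c :: w] under [tau v]. Its measure is the
    integral of [phi v], which varies by a factor of at most [expR C]. *)
Lemma cyl_measure_cat v c w x : sorted adm (rcons v c) -> letter x 0 = c ->
  expR (- C) * phi v x * m (c :: w) <= m (v ++ c :: w) <= expR C * phi v x * m (c :: w).
Proof.
move=> sv hx; have [_ hint] := phi_jac (sorted_rconsl sv).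
have tc (y : Sigma) : letter y 0 = c -> theta_cyl v y.
  by move=> hy; apply/theta_cylP; rewrite hy.
have sv' := sorted_rconsl sv.
have mc := measurable_cyl (x0 := x0) (c :: w).
have := hint _ mc (fun y cy => tc y (cyl_head cy)); rewrite tau_image// cyl_measureE => hE.
have pos y : cyl (c :: w) y -> 0 <= phi v y by move=> /cyl_head /tc /(phi_gt0 sv') /ltW.
have mphi : measurable_fun (cyl (c :: w) : set (BSigma x0)) (EFin \o (phi v : BSigma x0 -> R)).
  by apply/measurable_realfun.measurable_EFinP; exact: measurable_phi.
have cst k : (\int[mu]_(y in cyl (c :: w)) (k%:E) = (k * m (c :: w))%:E)%E.
  by rewrite (integral_cst _ mc)// EFinM; congr (_ * _)%E; exact: cyl_measureE.
rewrite -!lee_fin -!cst hE; apply/andP; split.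
  apply: ge0_le_integral => //; first by move=> y _; rewrite lee_fin mulr_ge0 ?expR_ge0 ?ltW ?phi_gt0//; exact: tc.
  move=> y cy; rewrite lee_fin expRN ler_pdivrMl ?expR_gt0//.
  by apply: phi_ratio => //; apply: tc => //; exact: cyl_head cy.
apply: ge0_le_integral => //.
move=> y cy; rewrite lee_fin.
by apply: phi_ratio => //; apply: tc => //; exact: cyl_head cy.
Qed.

End CylinderMeasure.

Section GreenProfile.
Variables (R : realType) (A : finType) (adm : rel A) (x0 : tmc adm).
Local Notation Sigma := (Sigma x0).
Variables (phi : seq A -> Sigma -> R) (G : groupType) (kappa : Sigma -> G).
Hypothesis kappa_loc : forall x y, letter x 0%N = letter y 0%N -> kappa x = kappa y.
Hypothesis phi_gt0 : forall w x, sorted adm w -> theta_cyl w x -> 0 < phi w x.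
Local Notation kw := (word_prod (letter_kappa kappa)).

Lemma transferE n h x g : transfer phi kappa n (XX h) (x, g) =
  \sum_(v : n.-tuple A | sorted adm (rcons v (letter x 0)) && (kw v == h^-1 * g)%g) phi v x.
Proof.
rewrite /transfer [RHS]big_mkcond [LHS]big_mkcond /=; apply: eq_bigr => v _.
have -> : sorted adm v && (x \in theta_cyl v) = sorted adm (rcons v (letter x 0)).
  apply/andP/idP => [[_]|sv]; first by rewrite inE => /theta_cylP.
  by split; [exact: sorted_rconsl sv|rewrite inE; apply/theta_cylP].
case: ifP => //= /theta_cylP /tauP [cv _].
have -> : kappa_n kappa n (tau v x) = kw v.
  by rewrite kappa_nE// -[X in mkseq _ X](size_tuple v) cv.
rewrite /XX indicE; have -> : ((tau v x, (g * (kw v)^-1)%g) \in [set p | p.2 = h]) =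
   (kw v == h^-1 * g)%g.
  apply/idP/eqP; rewrite inE /=; [move=> <-|move=> ->].
    by rewrite invgM invgK mulgVK.
  by rewrite invgM invgK mulVKg.
by case: eqP; rewrite ?mulr1 ?mulr0.
Qed.

Lemma sum_tuple_esum n (Q : pred (seq A)) (c : seq A -> R) :
  (forall w, Q w -> 0 <= c w) ->
  ((\sum_(v : n.-tuple A | Q v) c v)%:E =
  \esum_(w in [set w | Q w /\ size w = n]) (c w)%:E)%E.
Proof.
move=> c0; rewrite -sumEFin bigfs; last first.
- by move=> i _; rewrite mem_index_enum.
- exact: index_enum_uniq.

rewrite -esum_fset; last 2 first.
- exact: finite_finset.
- by move=> v; rewrite inE lee_fin; exact: c0.
rewrite -(@esum_image _ _ _ _ (@tval n A) (fun w => (c w)%:E)); last first.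
  by move=> x y _ _; exact: val_inj.
congr esum; apply/seteqP; split=> [_ [v /= Qv <-]|w /= [Qw /eqP sw]].
  by rewrite size_tuple.
by exists (Tuple sw).
Qed.

Lemma green_esum (r : R) h x g : 0 <= r -> green phi kappa r (XX h) (x, g) =
  \esum_(w in [set w | sorted adm (rcons w (letter x 0))] `&` [set w | kw w = (h^-1 * g)%g])
    (r ^+ size w * phi w x)%:E.
Proof.
move=> r0; set Q := fun w => sorted adm (rcons w (letter x 0)) && (kw w == h^-1 * g)%g.
have t0 w : Q w -> 0 <= r ^+ size w * phi w x.
  move=> /andP[sw _]; rewrite mulr_ge0 ?exprn_ge0// ltW// phi_gt0//; first exact: sorted_rconsl sw.
  exact/theta_cylP.
have E n : (r ^+ n * transfer phi kappa n (XX h) (x, g))%:E =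
    \esum_(w in [set w | Q w /\ size w = n]) (r ^+ size w * phi w x)%:E.
  rewrite transferE mulr_sumr -sum_tuple_esum//.
  by congr (_%:E); apply: eq_bigr => v _; rewrite size_tuple.
rewrite /green (eq_eseriesr (fun n _ => E n)) nneseries_esumT; last first.
  by move=> n; apply: esum_ge0 => w [Qw _]; rewrite lee_fin t0.
rewrite -esum_bigcup.
- congr esum; apply/seteqP; split=> [w [n _ [/andP[sw /eqP kww] _]]|w [/= sw kww]] //.
  by exists (size w) => //; split => //; rewrite /Q sw kww eqxx.
- by move=> i j _ _ [w [[_ <-] [_ <-]]].
- by move=> w [n _ [Qw _]]; rewrite lee_fin t0.
Qed.

Variables (mu : probability (BSigma x0) R).
Hypotheses (mu_pos : positive_on_cylinders mu) (phi_jac : inverse_jacobian mu phi).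
Variable C : R.
Hypothesis phi_ratio : forall w x y, sorted adm w -> theta_cyl w x -> theta_cyl w y ->
  phi w x <= expR C * phi w y.
Hypothesis T_trans : transitive_ext kappa.
Local Notation m := (cyl_measure mu).

Let link := link_words kappa_loc T_trans.
Let m_ge0 := cyl_measure_ge0 mu.
Let m_gt0 := cyl_measure_gt0 mu_pos.

Lemma weight_phi r x w : 0 <= r -> sorted adm (rcons w (letter x 0)) ->
  r ^+ size w * phi w x <= expR C * weight m r (letter x 0) w /\
  weight m r (letter x 0) w <= expR C * (r ^+ size w * phi w x).
Proof.
move=> r0 sw; set b := letter x 0.
have mb : 0 < m [:: b] by apply: m_gt0.
have /andP[h1 h2] := cyl_measure_cat phi_jac phi_gt0 phi_ratio [::] sw erefl.
rewrite -/b cats1 in h1 h2; have rs : 0 <= r ^+ size w by rewrite exprn_ge0.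
rewrite /weight; split.
  rewrite -mulrA [leRHS]mulrCA; apply: ler_wpM2l => //.
  rewrite mulrA ler_pdivlMr// -ler_pdivrMl ?expR_gt0//.
  by move: h1; rewrite expRN -mulrA.
by rewrite -mulrA [leRHS]mulrCA; apply: ler_wpM2l => //; rewrite ler_pdivrMr.
Qed.

(** The word sums see [x] only through its first letter; this is why Green functions are comparable,
    uniformly in [x], to a function on the group. *)
Lemma green_weight_sum (r : R) h x g : 0 <= r ->
  let F := weight_sum adm m r (letter x 0) [set w | kw w = (h^-1 * g)%g] in
  (green phi kappa r (XX h) (x, g) <= (expR C)%:E * F /\
   F <= (expR C)%:E * green phi kappa r (XX h) (x, g))%E.
Proof.
move=> r0 F; rewrite green_esum//.
have w0 w : 0 <= weight m r (letter x 0) w.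
  by rewrite /weight divr_ge0// mulr_ge0// exprn_ge0.
have p0 w : sorted adm (rcons w (letter x 0)) -> 0 <= r ^+ size w * phi w x.
  move=> sw; rewrite mulr_ge0 ?exprn_ge0// ltW// phi_gt0//; first exact: sorted_rconsl sw.
  exact/theta_cylP.
rewrite /F /weight_sum -!ge0_esumZl ?expR_ge0//; last 2 first.
- by move=> w [/= sw _]; rewrite lee_fin p0.
- by move=> w _; rewrite lee_fin w0.
by split; apply: le_esum => w [sw _]; rewrite -EFinM lee_fin; have [] := weight_phi r0 sw.
Qed.

(** At a point [x] of the cylinder of [c :: w], both [m (v ++ c :: w)] and [m (rcons v c)] are given
    by [phi v x] up to [expR C]; eliminating [phi v x] costs [expR (C + C)]. *)
Lemma cyl_distortion v c w : sorted adm (v ++ c :: w) ->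
  ((expR (C + C))^-1 * (m (rcons v c) * m (c :: w)) <= m (v ++ c :: w) * m [:: c]
    <= expR (C + C) * (m (rcons v c) * m (c :: w))).
Proof.
rewrite sorted_cat_rcons => /andP[sv sw].
have [x cx] : cyl (x0 := x0) (c :: w) !=set0.
  apply/set0P/eqP => e; have := m_gt0 sw; rewrite /cyl_measure e measure0 /=.
  by rewrite ltxx.
have cat := cyl_measure_cat phi_jac phi_gt0 phi_ratio _ sv (cyl_head cx).
have /andP[h1 h2] := cat w; have /andP[h3 h4] := cat [::].
rewrite cats1 in h3 h4; have mc := m_gt0 (erefl : sorted adm [:: c]).
have mcw := m_gt0 sw; have e0 := expR_gt0 C.
rewrite expRN -mulrA ler_pdivrMl// in h1; rewrite expRN -mulrA ler_pdivrMl// in h3.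
rewrite expRD; apply/andP; split.
  rewrite ler_pdivrMl ?mulr_gt0//.
  apply: (@le_trans _ _ ((expR C * phi v x * m [:: c]) * m (c :: w))); first by rewrite ler_pM2r.
  rewrite -!mulrA ler_pM2l// [leLHS](_ : _ = (phi v x * m (c :: w)) * m [:: c]); last by ring.
  by rewrite mulrA ler_pM2r.
apply: (@le_trans _ _ ((expR C * phi v x * m (c :: w)) * m [:: c])); first by rewrite ler_pM2r.
rewrite -!mulrA ler_pM2l// [leLHS](_ : _ = (phi v x * m [:: c]) * m (c :: w)); last by ring.
by rewrite mulrA ler_pM2r.
Qed.

End GreenProfile.

(** * The profile of the Green function *)

Lemma choice_bound (R : realType) (A : finType) (P : A -> R -> Prop) :
  (forall a c c', c <= c' -> P a c -> P a c') ->
  (forall a, exists2 c, 0 < c & P a c) -> exists2 c, 0 < c & forall a, P a c.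
Proof.
move=> mono h; have {}h a : exists c, 0 < c /\ P a c by have [c c0 pc] := h a; exists c.
have [c hc] := choice h; exists (\sum_a c a + 1).
  by rewrite ltr_wpDl// sumr_ge0// => a _; exact/ltW/(hc a).1.
move=> a; apply: mono (hc a).2; rewrite (bigD1 a)//= -addrA lerDl addr_ge0// sumr_ge0// => i _.
exact/ltW/(hc i).1.
Qed.

Lemma gibbs_ratio (R : realType) (A : finType) (adm : rel A) (x0 : tmc adm)
    (phi : seq A -> Sigma x0 -> R) : gibbs_markov phi -> exists C : R,
  (forall w (x : Sigma x0), sorted adm w -> theta_cyl w x -> 0 < phi w x) /\
  (forall w (x y : Sigma x0), sorted adm w -> theta_cyl w x -> theta_cyl w y ->
    phi w x <= expR C * phi w y).
Proof.
move=> [C [s [C0 /andP[s0 s1] h]]]; exists C; split=> [w x sw wx|w x y sw wx wy].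
  by have [+ _] := h w sw; apply; exact: mem_set.
have [pos dist] := h w sw.
have px := pos x (mem_set wx); have py := pos y (mem_set wy).
have d1 : dist_s s x y <= 1.
  by rewrite /dist_s; case: pselect => // e; rewrite exprn_ile1// ltW.
have := dist x y (mem_set wx) (mem_set wy) => /(le_trans (ler_norm _)) hle.
rewrite -[phi w x]lnK ?posrE// -[phi w y in X in _ <= X]lnK ?posrE// -expRD ler_expR.
rewrite -lerBlDr; apply: le_trans hle _.
by rewrite -[leRHS]mulr1 ler_pM2l.
Qed.

Section Profile.
Variables (R : realType) (A : finType) (adm : rel A) (x0 : tmc adm)
  (mu : probability (BSigma x0) R) (phi : seq A -> Sigma x0 -> R).
Hypotheses (mu_pos : positive_on_cylinders mu)
  (phi_jac : inverse_jacobian mu phi) (phi_gm : gibbs_markov phi).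
Variables (G : groupType) (kappa : Sigma x0 -> G).
Hypothesis kappa_loc : forall x y : Sigma x0, letter x 0%N = letter y 0%N ->
     kappa x = kappa y.
Hypotheses (T_trans : transitive_ext kappa) (T_transient : transient phi kappa).
Variables (S : seq G) (S_gen : sym_generating S).
Hypothesis green_sym : exists2 C0 : R, 1 <= C0 & forall (x : Sigma x0) (g : G),
     let Rc := Rconv phi kappa in
     (((C0^-1)%:E * green phi kappa Rc (XX 1%g) (x, g)
        <= green phi kappa Rc (XX g) (x, 1%g)) /\
      (green phi kappa Rc (XX g) (x, 1%g)
        <= C0%:E * green phi kappa Rc (XX 1%g) (x, g)))%E.
Variables (r : R) (r_bnd : 1 <= r <= Rconv phi kappa).

(** [f] is the word sum for the first letter of [x0]; linking words over 1 compare it with the other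
    letters. Its decay goes through [R], where symmetry holds: [f_r(g)^2 <= f_R(g)^2 <= K f_R(g)
    f_R(g^-1) <= e^2], hence the bound [e ^+ 2 / K] asked of the product at [R]. *)
Lemma green_profile : exists f : G -> R, [/\
  forall k, 0 < f k,
  forall l, exists2 C, 0 < C & forall k, f k <= C * f (k * l)%g,
  forall l, exists2 C, 0 < C & forall k, f k <= C * f (l * k)%g,
  forall e, 0 < e -> exists n : nat, forall g, (n <= wlen S g)%N ->
    f g * f g^-1%g <= e /\ f g <= e
& exists2 C, 0 < C & forall x h g,
    greenR phi kappa r h (x, g) <= C * f (h^-1 * g)%g /\
    f (h^-1 * g)%g <= C * greenR phi kappa r h (x, g)].
Proof.
have [C [phi_gt0 phi_ratio]] := gibbs_ratio phi_gm.
have gsym := green_sym; have /andP[r1 rRc] := r_bnd.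
set Rc := Rconv phi kappa in gsym rRc *.
have Rc1 : 1 <= Rc := le_trans r1 rRc.
have r0 : 0 <= r by lra. have Rc0 : 0 <= Rc by lra.
pose kl := letter_kappa kappa; pose m := cyl_measure mu.
pose D := expR (C + C); have D0 : 0 < D := expR_gt0 _.
have m0 := cyl_measure_ge0 mu; have mp := cyl_measure_gt0 mu_pos.
have mD := cyl_distortion phi_gt0 mu_pos phi_jac phi_ratio.
have link := link_words kappa_loc T_trans.
have gw := green_weight_sum kappa_loc phi_gt0 mu_pos phi_jac phi_ratio.
pose b0 := letter (x0 : Sigma x0) 0%N.
pose F q b k := weight_sum adm m q b [set w | word_prod kl w = k].
have F0 q b k : 1 <= q -> (0 <= F q b k)%E by move=> q1; apply: weight_sum_ge0.
have finRc b k : (F Rc b k < +oo)%E.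
  apply: (weight_sum_fin Rc1 m0 mp D0 mD link (b1 := b0)).
  have [_ h] := gw Rc 1%g x0 1%g Rc0; rewrite invg1 mulg1 in h; apply: le_lt_trans h _.
  have gfin := T_transient x0.
  have g0 : (0 <= green phi kappa Rc (XX 1%g) (x0, 1%g))%E.
    rewrite green_esum//; apply: esum_ge0 => w [/= sw _].
    rewrite lee_fin mulr_ge0 ?exprn_ge0// ltW// phi_gt0//; first exact: sorted_rconsl sw.
    exact/theta_cylP.
  have gF : green phi kappa Rc (XX 1%g) (x0, 1%g) \is a fin_num by rewrite ge0_fin_numE.
  by rewrite -(fineK gF) -EFinM ltry.
have le_r b k : (F r b k <= F Rc b k)%E by apply: weight_sum_le_r.
have finr b k : (F r b k < +oo)%E := le_lt_trans (le_r b k) (finRc b k).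
pose fq q b k := fine (F q b k).
have fE b k : F r b k = (fq r b k)%:E by rewrite fineK// ge0_fin_numE ?F0.
have fcE b k : F Rc b k = (fq Rc b k)%:E by rewrite fineK// ge0_fin_numE ?F0.
have fpos b k : 0 < fq r b k by rewrite -lte_fin -fE; exact: (weight_sum_gt0 r1 m0 mp link).
have fcpos b k : 0 < fq Rc b k by rewrite -lte_fin -fcE; exact: (weight_sum_gt0 Rc1 m0 mp link).
exists (fq r b0); split => //.
- move=> l; have [c c0 h] := weight_sum_right r1 m0 mp D0 mD link b0 b0 l.
  by exists c => // k; rewrite -lee_fin EFinM -!fE; exact: h.
- move=> l; have [c c0 h] := weight_sum_left r1 m0 mp D0 mD link b0 l.
  by exists c => // k; rewrite -lee_fin EFinM -!fE; exact: h.
- move=> e e0.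
  have [K K0 sym] : exists2 K, 0 < K & forall g, fq Rc b0 g <= K * fq Rc b0 g^-1%g.
    have [c c1 hc] := gsym; have c0 : 0 < c by lra.
    exists (expR C * (c * expR C)); first by rewrite !mulr_gt0 ?expR_gt0.
    move=> g; rewrite -lee_fin EFinM -!fcE.
    have [_ h1] := gw Rc 1%g x0 g Rc0; rewrite invg1 mul1g in h1.
    have [h2 _] := gw Rc g x0 1%g Rc0; rewrite mulg1 in h2.
    have [h3 _] := hc x0 g.
    apply: le_trans h1 _; rewrite EFinM -muleA; apply: lee_wpmul2l; first by rewrite lee_fin expR_ge0.
    set a := green _ _ _ _ _ in h3 *.
    rewrite -[a]mul1e -[1%E]/(1%:E) -(divff (lt0r_neq0 c0)) !EFinM -!muleA.
    apply: lee_wpmul2l; first by rewrite lee_fin ltW.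
    exact: le_trans h3 h2.
  have mulinv q (q1 : 1 <= q) (finq : forall b k, (F q b k < +oo)%E) :=
    weight_sum_mul_inv q1 m0 mp D0 mD link b0 S_gen (fun b => finq b 1%g).
  have [n1 h1] := mulinv r r1 finr e e0.
  have e20 : 0 < e ^+ 2 / K by rewrite divr_gt0// exprn_gt0.
  have [n2 h2] := mulinv Rc Rc1 finRc _ e20.
  exists (maxn n1 n2) => g; rewrite geq_max => /andP[/h1 hg1 /h2 hg2].
  move: hg1 hg2; rewrite -!/(F _ _ _) !fE !fcE -!EFinM !lee_fin => hg1 hg2; split=> //.
  have le1 : fq r b0 g <= fq Rc b0 g by rewrite -lee_fin -fE -fcE.
  apply: le_trans le1 _; rewrite -(@ler_pXn2r _ 2)// ?nnegrE; [|exact: ltW|exact: ltW].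
  rewrite ler_pdivlMr// in hg2; apply: le_trans _ hg2.
  rewrite expr2 -mulrA; apply: ler_wpM2l; first exact: ltW.
  by rewrite mulrC; exact: sym.
have [c1 c10 h1] : exists2 c, 0 < c & forall b, forall k, fq r b k <= c * fq r b0 k.
  apply: choice_bound => [b c c' cc' h k|b].
    by apply: le_trans (h k) _; rewrite ler_pM2r.
  have [c c0 h] := weight_sum_right r1 m0 mp D0 mD link b b0 1%g.
  by exists c => // k; rewrite -lee_fin EFinM -!fE -{2}(mulg1 k); exact: h.
have [c2 c20 h2] : exists2 c, 0 < c & forall b, forall k, fq r b0 k <= c * fq r b k.
  apply: choice_bound => [b c c' cc' h k|b].
    by apply: le_trans (h k) _; rewrite ler_pM2r.
  have [c c0 h] := weight_sum_right r1 m0 mp D0 mD link b0 b 1%g.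
  by exists c => // k; rewrite -lee_fin EFinM -!fE -{2}(mulg1 k); exact: h.
exists (expR C * (c1 + c2)); first by rewrite mulr_gt0 ?expR_gt0 ?addr_gt0.
move=> x h g; have [] := gw r h x g r0.
rewrite -/(F r (letter x 0%N) (h^-1 * g)%g) fE => k1 k2.
have gfin : green phi kappa r (XX h) (x, g) = (greenR phi kappa r h (x, g))%:E.
  rewrite /greenR fineK// ge0_fin_numE; first by apply: le_lt_trans k1 _; rewrite -EFinM ltry.
  rewrite -(@pmule_rge0 _ (expR C)%:E) ?lte_fin ?expR_gt0//; apply: le_trans k2.
  by rewrite lee_fin ltW.
move: k1 k2; rewrite gfin -!EFinM !lee_fin => k1 k2; split.
  apply: le_trans k1 _; rewrite -mulrA ler_pM2l ?expR_gt0//; apply: le_trans (h1 _ _) _.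
  by rewrite ler_pM2r// lerDl ltW.
apply: le_trans (h2 (letter x 0%N) _) _.
apply: (@le_trans _ _ (c2 * (expR C * greenR phi kappa r h (x, g)))).
  by rewrite ler_pM2l.
rewrite mulrA [c2 * _]mulrC; apply: ler_wpM2r.
  by rewrite -(pmulr_rge0 _ (expR_gt0 C)); apply: le_trans k2; exact: ltW.
by rewrite ler_pM2l ?expR_gt0// lerDr ltW.
Qed.

End Profile.

(** * Ancona's inequality *)

Section Ancona.
Variables (R : realType) (G : groupType) (S : seq G) (S_gen : sym_generating S).
Variables (delta : R) (delta_gt0 : 0 < delta) (G_hyp : hyperbolic S delta).
Local Notation wl := (wlen S).
Local Notation d := (@wdist R G S).
Local Notation gp := (@gprod R G S).
Variable f : G -> R.
Hypothesis f_gt0 : forall k, 0 < f k.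
Hypothesis f_right : forall l, exists2 C, 0 < C & forall k, f k <= C * f (k * l)%g.
Hypothesis f_left : forall l, exists2 C, 0 < C & forall k, f k <= C * f (l * k)%g.

(** Harnack inequality: one constant serves all of the finitely many generators and is spent once
    per letter of a geodesic word. *)
Lemma harnack : exists2 c, 1 <= c & forall l k,
  f k <= c ^+ wl l * f (k * l)%g /\ f k <= c ^+ wl l * f (l * k)%g.
Proof.
have [c c0 hc] : exists2 c, 0 < c & forall s : seq_sub S, forall k,
    f k <= c * f (k * val s)%g /\ f k <= c * f (val s * k)%g.
  apply: choice_bound => [s c c' cc' h k|s].
    have [h1 h2] := h k; split; [apply: le_trans h1 _|apply: le_trans h2 _];
      by rewrite ler_pM2r.
  have [c1 c10 h1] := f_right (val s); have [c2 c20 h2] := f_left (val s).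
  exists (c1 + c2); first exact: addr_gt0.
  move=> k; split; [apply: le_trans (h1 k) _|apply: le_trans (h2 k) _];
    by rewrite ler_pM2r// ?lerDl ?lerDr ltW.
exists (1 + c); first by rewrite lerDl ltW.
have c1 : 0 < 1 + c by lra.
have hS s k : s \in S -> f k <= (1 + c) * f (k * s)%g /\ f k <= (1 + c) * f (s * k)%g.
  move=> sS; have [h1 h2] := hc (SeqSub sS) k; split; [apply: le_trans h1 _|apply: le_trans h2 _];
    by rewrite ler_pM2r//; lra.
move=> l; elim/(wlen_ind S_gen): l => [|g s sS E IH] k.
  by rewrite wlen1 mulg1 mul1g expr0 mul1r.
rewrite E exprS -!mulrA; split.
  have [h _] := IH k; apply: le_trans h _; rewrite mulrCA ler_pM2l ?exprn_gt0//.
  by rewrite mulgA; have [] := hS s (k * g)%g sS.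
have [_ h] := hS s k sS; apply: le_trans h _; rewrite ler_pM2l//.
by rewrite -mulgA; have [_] := IH (s * k)%g.
Qed.

Hypothesis four_point : exists2 C, 0 < C & forall g g' h h',
  Num.max (gp h h' g) (gp h h' g') < gp h g g' ->
  f (h^-1 * g)%g * f (h'^-1 * g')%g <= C * (f (h^-1 * g')%g * f (h'^-1 * g)%g).

(** As [four_point] asks for a strict inequality, one generator [s] is taken beyond [a] on the way
    to [a * b]: seen from 1, the points [a * b] and [a * s] have product [|a| + 1], whereas [a] has
    product [|a|] with each. So [f(ab) f(s)] is comparable to [f(as) f(b)], and [s] is removed by
    the Harnack inequality. *)
Lemma ancona_geodesic : exists2 C, 0 < C & forall a b, wl (a * b)%g = (wl a + wl b)%N ->
  f (a * b)%g <= C * (f a * f b) /\ f a * f b <= C * f (a * b)%g.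
Proof.
have [C C0 four] := four_point; have [c c1 hc] := harnack.
have c0 : 0 < c by lra.
set e := f 1%g; have e0 : 0 < e by exact: f_gt0.
exists (C * c ^+ 2 / e + C * c ^+ 2 * e + e + e^-1).
  by rewrite !addr_gt0// ?invr_gt0// ?mulr_gt0// ?invr_gt0// ?exprn_gt0.
set K := _ + _.
have t1 : 0 < C * c ^+ 2 / e by rewrite !mulr_gt0// ?invr_gt0// ?exprn_gt0.
have t2 : 0 < C * c ^+ 2 * e by rewrite !mulr_gt0// ?exprn_gt0.
have t3 : 0 < e^-1 by rewrite invr_gt0.
move=> a b ab; have [b0|bn0] := eqVneq (wl b) 0%N.
  rewrite (wlen_eq0 S_gen b0) mulg1 -/e; split.
    rewrite mulrA mulrAC -[leLHS]mul1r ler_pM2r// -ler_pdivrMr//.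
    by rewrite div1r /K; lra.
  by rewrite mulrC ler_pM2r// /K; lra.
have [n bn] : exists n, wl b = (1 + n)%N by exists (wl b).-1; lia.
have [s [b' [bE ws wb']]] := wlen_split S_gen bn.
have was : wl (a * s)%g = (wl a + 1)%N.
  have := wlenM S_gen a s; have := wlenM S_gen (a * s)%g b'.
  by rewrite -mulgA -bE ab; lia.
have dE1 : d (a * s)%g (a * b)%g = n%:R by rewrite wdistMl /wdist bE mulKg wb'.
have dE2 : d a (a * b)%g = (wl b)%:R by rewrite /wdist mulKg.
have dE3 : d a (a * s)%g = 1 by rewrite /wdist mulKg ws.
have dC := wdistC (R := R) S_gen.
have wbR : (wl b)%:R = 1 + n%:R :> R by rewrite bn natrD.
have g1 : gp 1%g (a * b)%g (a * s)%g = (wl a)%:R + 1.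
  by rewrite /gprod !wdist1// dC dE1 ab was !natrD wbR; lra.
have g2 : gp 1%g a (a * b)%g = (wl a)%:R.
  by rewrite /gprod !wdist1// dE2 ab natrD; lra.
have g3 : gp 1%g a (a * s)%g = (wl a)%:R.
  by rewrite /gprod !wdist1// dE3 was natrD; lra.
have h1 : f (a * b)%g * f s <= C * (f (a * s)%g * f b).
  have := four (a * b)%g (a * s)%g 1%g a; rewrite !invg1 !mul1g !mulKg; apply.
  by rewrite g1 g2 g3 maxxx; lra.
have h2 : f (a * s)%g * f b <= C * (f (a * b)%g * f s).
  have := four (a * s)%g (a * b)%g 1%g a; rewrite !invg1 !mul1g !mulKg; apply.
  by rewrite (gprodC S_gen 1%g (a * s)%g (a * b)%g) g1 g2 g3 maxxx; lra.
have sE : (s * s^-1 = 1)%g by rewrite mulgV.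
have s1 : e <= c * f s by have [+ _] := hc s 1%g; rewrite ws mul1g expr1.
have s2 : f s <= c * e.
  by have [+ _] := hc s^-1%g s; rewrite wlenV// ws mulgV expr1.
have s3 : f a <= c * f (a * s)%g by have [+ _] := hc s a; rewrite ws expr1.
have s4 : f (a * s)%g <= c * f a.
  by have [+ _] := hc s^-1%g (a * s)%g; rewrite wlenV// ws mulgK expr1.
have fa := f_gt0 a; have fb := f_gt0 b; have fs := f_gt0 s.
have fab := f_gt0 (a * b)%g; have fas := f_gt0 (a * s)%g.
split.
  apply: (@le_trans _ _ (C * c ^+ 2 / e * (f a * f b))); last first.
    by rewrite ler_pM2r ?mulr_gt0// /K; lra.
  rewrite mulrAC ler_pdivlMr//.
  apply: (@le_trans _ _ (c * (f (a * b)%g * f s))); first by rewrite mulrCA ler_pM2l.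
  apply: (@le_trans _ _ (c * (C * (f (a * s)%g * f b)))); first by rewrite ler_pM2l.
  rewrite [leRHS](_ : _ = c * (C * ((c * f a) * f b))); last by ring.
  by rewrite !ler_pM2l// ler_pM2r.
apply: (@le_trans _ _ (C * c ^+ 2 * e * f (a * b)%g)); last first.
  by rewrite ler_pM2r// /K; lra.
apply: (@le_trans _ _ (c * (f (a * s)%g * f b))); first by rewrite mulrA ler_pM2r.
apply: (@le_trans _ _ (c * (C * (f (a * b)%g * f s)))); first by rewrite ler_pM2l.
rewrite [leRHS](_ : _ = c * (C * (f (a * b)%g * (c * e)))); last by ring.
by rewrite !ler_pM2l.
Qed.

(** A bounded product at [y] means that [y] is at bounded distance from a geodesic between [x] and
    [z]; the Harnack inequality moves it there. *)
Lemma ancona (c : R) : exists2 C, 0 < C & forall x y z, gp y x z <= c ->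
  f (x^-1 * z)%g <= C * (f (x^-1 * y)%g * f (y^-1 * z)%g) /\
  f (x^-1 * y)%g * f (y^-1 * z)%g <= C * f (x^-1 * z)%g.
Proof.
have [C C0 anc] := ancona_geodesic; have [q q1 hq] := harnack.
have q0 : 0 < q by lra.
(* Bound, established as [pa], for the distance from [a] to the point [p] at height [k] on a
   geodesic from 1 to [a * b]. *)
pose N := Num.trunc (`|c| + 2 + 2 * delta); pose Q := q ^+ N.
have Q0 : 0 < Q by rewrite exprn_gt0.
exists (C * Q ^+ 2); first by rewrite mulr_gt0// exprn_gt0.
move=> x y z; set a := (x^-1 * y)%g; set b := (y^-1 * z)%g => xyz.
have -> : (x^-1 * z = a * b)%g by rewrite /a /b -mulgA mulVKg.
have {}xyz : gp a 1%g (a * b)%g <= c.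
  move: xyz; rewrite /gprod.
  rewrite -(wdistMl x^-1%g x y) -(wdistMl x^-1%g z y) -(wdistMl x^-1%g x z) mulVg -/a.
  by have -> : (x^-1 * z = a * b)%g by rewrite /a /b -mulgA mulVKg.
have dC := wdistC (R := R) S_gen.
pose k := Num.trunc (gp 1%g a (a * b)%g).
have [k1 k2] : k%:R <= gp 1%g a (a * b)%g /\ gp 1%g a (a * b)%g < k%:R + 1.
  have := truncn_itv (gprod_ge0 (R := R) S_gen 1%g a (a * b)%g).
  by rewrite -/k natr1 => /andP[].
have kle : (k <= wl (a * b)%g)%N.
  by rewrite -(ler_nat R) -(wdist1 S_gen); apply: le_trans k1 (gprod_ler S_gen _ _ _).
have [p wp [gpp dp]] := geodesic_point (R := R) S_gen _ _ kle.
have pab : wl (a * b)%g = (wl p + wl (p^-1 * (a * b))%g)%N.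
  apply/eqP; rewrite -(eqr_nat R) natrD wp; move: dp; rewrite /wdist => ->.
  by apply/eqP; lra.
have pa : d p a <= c + 2 + 2 * delta.
  have := hyper G_hyp k1 (_ : k%:R <= gp 1%g (a * b)%g p).
  rewrite (gprodC S_gen) gpp lexx => /(_ isT).
  have p1 : d p 1%g = k%:R by rewrite wdist1// wp.
  move: xyz k2; rewrite /gprod; move: p1 (dC 1%g a) (dC 1%g (a * b)%g) (dC (a * b)%g a) (dC p a); lra.
have wN : (wl (p^-1 * a)%g <= N)%N.
  rewrite /N truncn_ge_nat//; last by move: (normr_ge0 c) delta_gt0; lra.
  rewrite -/(d p a); apply: le_trans pa _; move: (ler_norm c); lra.
set l := (p^-1 * a)%g in wN.
have wNV : (wl l^-1%g <= N)%N by rewrite wlenV.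
have qle n : (n <= N)%N -> q ^+ n <= Q by move=> nN; rewrite /Q ler_weXn2l.
have B (u v t : R) n : (n <= N)%N -> 0 < t -> u <= q ^+ n * t -> u <= Q * t.
  by move=> nN t0 /le_trans; apply; rewrite ler_pM2r// qle.
have pl : (p * l = a)%g by rewrite /l mulVKg.
have al : (a * l^-1 = p)%g by rewrite -pl mulgK.
have lb : (p^-1 * (a * b) = l * b)%g by rewrite /l mulgA.
have e1 : f p <= Q * f a by have [+ _] := hq l p; rewrite pl; exact: B.
have e2 : f a <= Q * f p by have [+ _] := hq l^-1%g a; rewrite al; exact: B.
have e3 : f b <= Q * f (l * b)%g by have [_] := hq l b; exact: B.
have e4 : f (l * b)%g <= Q * f b by have [_] := hq l^-1%g (l * b)%g; rewrite mulKg; exact: B.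
have [] := anc p (l * b)%g.
  by rewrite -lb mulVKg.
rewrite -{1 4}lb mulVKg => u1 u2; split.
  apply: le_trans u1 _; rewrite -mulrA ler_pM2l//.
  rewrite [leRHS](_ : _ = (Q * f a) * (Q * f b)); last by ring.
  by apply: ler_pM => //; exact: ltW.
apply: (@le_trans _ _ ((Q * f p) * (Q * f (l * b)%g))).
  by apply: ler_pM => //; exact: ltW.
rewrite [leLHS](_ : _ = Q ^+ 2 * (f p * f (l * b)%g)); last by ring.
rewrite [leRHS](_ : _ = Q ^+ 2 * (C * f (a * b)%g)); last by ring.
by rewrite ler_pM2l// exprn_gt0.
Qed.

End Ancona.

(** * Martin kernels *)

Section Kernel.
Variables (R : realType) (G : groupType) (S : seq G) (S_gen : sym_generating S).
Variables (delta : R) (delta_gt0 : 0 < delta) (G_hyp : hyperbolic S delta).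
Local Notation wl := (wlen S).
Local Notation gp := (@gprod R G S).
Variables (X : Type) (x0 : X) (Gr : G -> X * G -> R) (f : G -> R) (lam : R).
Hypothesis f_gt0 : forall k, 0 < f k.
Hypothesis f_right : forall l, exists2 C, 0 < C & forall k, f k <= C * f (k * l)%g.
Hypothesis f_left : forall l, exists2 C, 0 < C & forall k, f k <= C * f (l * k)%g.
Hypothesis f_small : forall e, 0 < e -> exists n : nat, forall g, (n <= wl g)%N ->
  f g * f g^-1%g <= e /\ f g <= e.
Hypothesis Gr_cmp : exists2 C, 0 < C & forall x h g,
  Gr h (x, g) <= C * f (h^-1 * g)%g /\ f (h^-1 * g)%g <= C * Gr h (x, g).
Hypothesis lam_bnd : 0 < lam < 1.
Hypothesis lamc : exists2 C, 0 < C & forall x y n g g' h h',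
  Defs.separated S delta n g g' h h' ->
  `|(Gr h (x, g) / Gr h (y, g')) / (Gr h' (x, g) / Gr h' (y, g')) - 1| <= C * lam ^+ n.

Definition ratioK h p : R := Gr h p / Gr 1%g p.
Local Notation lnK h p := (ln (ratioK h p)).

Lemma Gr_gt0 h p : 0 < Gr h p.
Proof.
have [C C0 cmp] := Gr_cmp; case: p => x g; have [_ h2] := cmp x h g.
by rewrite -(pmulr_rgt0 _ C0); apply: lt_le_trans h2; exact: f_gt0.
Qed.

Lemma ratioK_gt0 h p : 0 < ratioK h p.
Proof. by rewrite divr_gt0// Gr_gt0. Qed.

Lemma lnK_bound : exists2 A, 1 <= A & forall h p, `|lnK h p| <= A * (1 + (wl h)%:R).
Proof.
have [C C0 cmp] := Gr_cmp; have [c c1 hc] := harnack S_gen f_gt0 f_right f_left.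
have c0 : 0 < c by lra.
pose A := 1 + `|ln (C ^+ 2)| + ln c.
have lnc : 0 <= ln c by rewrite ln_ge0.
have A1 : 1 <= A by rewrite /A -addrA lerDl addr_ge0.
exists A => // h [x g]; have [u1 u2] := cmp x h g; have [v1 v2] := cmp x 1%g g.
rewrite invg1 mul1g in v1 v2; have [_ w1] := hc h (h^-1 * g)%g.
have [_ w2] := hc h^-1%g g; rewrite mulVKg in w1; rewrite wlenV// in w2.
have q0 : 0 < c ^+ wl h by rewrite exprn_gt0.
have G1 := Gr_gt0 h (x, g); have G2 := Gr_gt0 1%g (x, g).
have k1 : ratioK h (x, g) <= C ^+ 2 * c ^+ wl h.
  rewrite ler_pdivrMr//; apply: le_trans u1 _.
  apply: (@le_trans _ _ (C * (c ^+ wl h * (C * Gr 1%g (x, g))))).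
    by rewrite ler_pM2l//; apply: le_trans w1 _; rewrite ler_pM2l.
  by rewrite le_eqVlt; apply/orP; left; apply/eqP; ring.
have k2 : (ratioK h (x, g))^-1 <= C ^+ 2 * c ^+ wl h.
  rewrite /ratioK invf_div ler_pdivrMr//; apply: le_trans v1 _.
  apply: (@le_trans _ _ (C * (c ^+ wl h * (C * Gr h (x, g))))).
    by rewrite ler_pM2l//; apply: le_trans w2 _; rewrite ler_pM2l.
  by rewrite le_eqVlt; apply/orP; left; apply/eqP; ring.
have kp := ratioK_gt0 h (x, g).
have lnle : ln (C ^+ 2 * c ^+ wl h) <= A * (1 + (wl h)%:R).
  rewrite lnM ?posrE ?exprn_gt0// [X in _ + X]lnXn// -[X in _ + X <= _]mulr_natr.
  rewrite mulrDr mulr1; apply: lerD.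
    rewrite /A; move: lnc (ler_norm (ln (C ^+ 2))); set a := ln (C ^+ 2); set b := ln c. lra.
  rewrite ler_wpM2r// /A; move: (normr_ge0 (ln (C ^+ 2))); set a := `|_|; set b := ln c; lra.
rewrite ler_norml; apply/andP; split.
  rewrite lerNl -lnV ?posrE//; apply: le_trans lnle.
  by rewrite ler_ln ?posrE ?invr_gt0// mulr_gt0// exprn_gt0.
by apply: le_trans lnle; rewrite ler_ln ?posrE// mulr_gt0// exprn_gt0.
Qed.

(** Products of [h] based at 1 are at most [|h|], so the pair of 1 and [h] is [n]-separated from the
    group coordinates of [p] and [p'] once these have product above [|h| + n]. Applying
    [ln t <= t - 1] in both orders of [p] and [p'] gives the two signs. *)
Lemma lnK_separated : exists2 C, 0 < C & forall h p p' n,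
  (wl h)%:R + n%:R < gp 1%g p.2 p'.2 -> `|lnK h p - lnK h p'| <= C * lam ^+ n.
Proof.
have [C C0 hC] := lamc; exists C => // h.
have main p p' n : (wl h)%:R + n%:R < gp 1%g p.2 p'.2 -> lnK h p' - lnK h p <= C * lam ^+ n.
  case: p p' => x g [y g'] /= sep.
  have := @hC x y n g g' 1%g h; have : Defs.separated S delta n g g' 1%g h.
    apply: separated_gprod => //; first exact: ltW.
    apply: le_lt_trans sep; rewrite lerD2r ge_max -(wdist1 S_gen).
    by rewrite !(gprod_lel S_gen).
  move=> s /(_ s) /(le_trans (ler_norm _)) hle.
  rewrite -ln_div ?posrE ?ratioK_gt0//; apply: le_trans hle.
  have -> : ratioK h (y, g') / ratioK h (x, g) =
      Gr 1%g (x, g) / Gr 1%g (y, g') / (Gr h (x, g) / Gr h (y, g')).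
    by rewrite /ratioK; field; rewrite !gt_eqF// Gr_gt0.
  set t := _ / _; have t0 : 0 < t by rewrite !divr_gt0// Gr_gt0.
  by rewrite -{1}(subrK 1 t) addrC; apply: le_ln1Dx; lra.
move=> p p' n sep; rewrite ler_norml; apply/andP; split; last first.
  by apply: main; rewrite (gprodC S_gen).
by rewrite lerNl opprB; exact: main.
Qed.

(** If [N] exceeds [|h| + 1], the separated case applies. Otherwise the power of [lam] is at least
    [lam], and the crude bound [lnK_bound] suffices; the factor [1 + |h|] stems from this case. *)
Lemma lnK_diff : exists2 B, 0 < B & forall h p p' N, N <= gp 1%g p.2 p'.2 ->
  `|lnK h p - lnK h p'| <= B * (1 + (wl h)%:R) * lam `^ (N - (wl h)%:R).
Proof.
have [C C0 hC] := lnK_separated; have [A A1 hA] := lnK_bound.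
have /andP[l0 l1] := lam_bnd.
exists (2 * A / lam + C / lam ^+ 2).
  by rewrite addr_gt0// !divr_gt0// ?exprn_gt0// mulr_gt0//; lra.
have t1 : 0 < 2 * A / lam by rewrite divr_gt0// mulr_gt0//; lra.
have t2 : 0 < C / lam ^+ 2 by rewrite divr_gt0// exprn_gt0.
move=> h p p' N Nle; set t := N - (wl h)%:R.
have w0 : 0 <= (wl h)%:R :> R by [].
have w1 : 0 < 1 + (wl h)%:R :> R by lra.
have pt : 0 < lam `^ t by rewrite powR_gt0.
have [tl1|tg1] := leP t 1.
  apply: (@le_trans _ _ (2 * A * (1 + (wl h)%:R))).
    apply: le_trans (ler_normB _ _) _; have := hA h p; have := hA h p'; lra.
  apply: (@le_trans _ _ (2 * A / lam * (1 + (wl h)%:R) * lam `^ t)); last first.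
    by rewrite ler_pM2r// ler_pM2r//; lra.
  have pl : lam <= lam `^ t by apply: ger1_powR => //; rewrite l0 ltW.
  rewrite [leRHS](_ : _ = 2 * A * (1 + (wl h)%:R) * (lam `^ t / lam)); last by field; rewrite gt_eqF.
  rewrite -[leLHS]mulr1 ler_pM2l ?ler_pdivlMr ?mul1r// !mulr_gt0//; lra.
(* Subtracting 1 gives the strict inequality required for separation; this and the rounding are
   repaid by the constant [C / lam ^+ 2]. *)
pose n := Num.trunc (t - 1).
have tn : 0 <= t - 1 by lra.
have /andP[n1 n2] := truncn_itv tn; rewrite -natr1 -/n in n1 n2.
apply: (@le_trans _ _ (C * lam ^+ n)).
  by apply: hC; apply: lt_le_trans Nle; rewrite /t in n1; lra.
apply: (@le_trans _ _ (C / lam ^+ 2 * lam `^ t)); last first.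
  rewrite ler_pM2r// -[leLHS]mulr1; apply: ler_pM; [exact: ltW|exact: ler01| lra |lra].
rewrite -mulrA ler_pM2l// ler_pdivlMl ?exprn_gt0// -exprD -powR_mulrn; last exact: ltW.
by apply: ger_powR; [rewrite l0 ltW|rewrite natrD; lra].
Qed.

Lemma Gr_four_point : exists2 C, 0 < C & forall g g' h h',
  Num.max (gp h h' g) (gp h h' g') < gp h g g' ->
  f (h^-1 * g)%g * f (h'^-1 * g')%g <= C * (f (h^-1 * g')%g * f (h'^-1 * g)%g).
Proof.
have [C C0 hC] := lamc; have [D D0 cmp] := Gr_cmp.
exists (D ^+ 4 * (1 + C)); first by rewrite mulr_gt0 ?exprn_gt0// addr_gt0.
move=> g g' h h' sep.
have /(hC x0 x0) : Defs.separated S delta 0 g g' h h'.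
  by apply: separated_gprod => //; rewrite ?addr0// ltW.
rewrite expr0 mulr1 => /(le_trans (ler_norm _)); rewrite lerBlDr addrC.
have [a1 a2] := cmp x0 h g; have [b1 b2] := cmp x0 h g'.
have [c1 c2] := cmp x0 h' g; have [d1 d2] := cmp x0 h' g'.
have ga := Gr_gt0 h (x0, g); have gb := Gr_gt0 h (x0, g').
have gc := Gr_gt0 h' (x0, g); have gd := Gr_gt0 h' (x0, g').
rewrite invf_div mulrA ler_pdivrMr// mulrAC ler_pdivrMr// => hle.
apply: (@le_trans _ _ ((D * Gr h (x0, g)) * (D * Gr h' (x0, g')))).
  by apply: ler_pM => //; exact: ltW.
rewrite [leLHS](_ : _ = D ^+ 2 * (Gr h (x0, g) * Gr h' (x0, g'))); last by ring.
apply: (@le_trans _ _ (D ^+ 2 * ((1 + C) * Gr h' (x0, g) * Gr h (x0, g')))).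
  by rewrite ler_pM2l// exprn_gt0.
rewrite [leLHS](_ : _ = D ^+ 2 * (1 + C) * (Gr h (x0, g') * Gr h' (x0, g))); last by ring.
rewrite [leRHS](_ : _ = D ^+ 2 * (1 + C) * ((D * f (h^-1 * g')%g) * (D * f (h'^-1 * g)%g))); last by ring.
rewrite ler_pM2l; last by rewrite mulr_gt0// ?exprn_gt0// addr_gt0.
by apply: ler_pM => //; exact: ltW.
Qed.

(* [h] lies near a geodesic from [1] to [u], while the way from [h] to [v] turns
   back to [p], so the ratio of the kernels picks up the square
   [f (p^-1 * h) * f (h^-1 * p)], which is small. *)
Lemma kernel_gap (c : R) : exists L : nat, forall h p u v x y,
  gp h 1%g u <= c -> gp p 1%g v <= c -> gp p h v <= c -> gp p 1%g h <= c ->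
  (L <= wl (p^-1 * h)%g)%N -> 1 <= lnK h (x, u) - lnK h (y, v).
Proof.
have [C C0 anc] := ancona S_gen delta_gt0 G_hyp f_gt0 f_right f_left Gr_four_point c.
have [D D0 cmp] := Gr_cmp.
pose e := (expR 1 * D ^+ 4 * C ^+ 4)^-1.
(* The constant [e] compensates four uses of Ancona's inequality, four comparisons of [f] with Green
   functions, and the factor [expR 1] of the desired gap. *)
have e0 : 0 < e by rewrite invr_gt0 !mulr_gt0// ?exprn_gt0// expR_gt0.
have [L hL] := f_small e0; exists L => h p u v x y hu pv phv ph /hL [small _].
have [a1 _] := anc _ _ _ hu; have [_ a2] := anc _ _ _ pv.
have [a3 _] := anc _ _ _ phv; have [a4 _] := anc _ _ _ ph.
rewrite invg1 !mul1g in a1 a2 a4; rewrite invgM invgK in small.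
have [b1 _] := cmp y h v; have [_ b2] := cmp x h u.
have [_ b3] := cmp y 1%g v; have [b4 _] := cmp x 1%g u.
rewrite invg1 !mul1g in b3 b4.
have gxu := Gr_gt0 h (x, u); have gyv := Gr_gt0 h (y, v).
have g1u := Gr_gt0 1%g (x, u); have g1v := Gr_gt0 1%g (y, v).
have f0 := f_gt0.
move: small a1 a2 a3 a4 b1 b2 b3 b4.
have := f0 (p^-1 * h)%g; have := f0 (h^-1 * p)%g; have := f0 u; have := f0 v.
have := f0 h; have := f0 p; have := f0 (h^-1 * u)%g; have := f0 (h^-1 * v)%g.
have := f0 (p^-1 * v)%g.
set pv' := f (p^-1 * v)%g; set hv := f (h^-1 * v)%g; set hu' := f (h^-1 * u)%g.
set fp := f p; set fh := f h; set fv := f v; set fu := f u.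
set hp := f (h^-1 * p)%g; set ph' := f (p^-1 * h)%g.
move=> ? ? ? ? ? ? ? ? ? small a1 a2 a3 a4 b1 b2 b3 b4.
have key : fu * hv <= C ^+ 4 * e * (fv * hu').
  apply: (@le_trans _ _ ((C * (fh * hu')) * (C * (hp * pv')))).
    by apply: ler_pM => //; exact: ltW.
  apply: (@le_trans _ _ ((C * ((C * (fp * ph')) * hu')) * (C * (hp * pv')))).
    by rewrite ler_pM2r ?mulr_gt0// ler_pM2l// ler_pM2r.
  rewrite [leLHS](_ : _ = C ^+ 3 * hu' * ((ph' * hp) * (fp * pv'))); last by ring.
  rewrite [leRHS](_ : _ = C ^+ 3 * hu' * (e * (C * fv))); last by ring.
  rewrite ler_pM2l ?mulr_gt0 ?exprn_gt0//.
  by apply: ler_pM => //; rewrite ltW// mulr_gt0.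
rewrite -ln_div ?posrE ?ratioK_gt0// -[leLHS](expRK 1).
rewrite ler_ln ?posrE ?divr_gt0 ?ratioK_gt0 ?expR_gt0//.
have -> : ratioK h (x, u) / ratioK h (y, v) =
   (Gr h (x, u) * Gr 1%g (y, v)) / (Gr 1%g (x, u) * Gr h (y, v)).
  by rewrite /ratioK; field; rewrite !gt_eqF.
rewrite ler_pdivlMr ?mulr_gt0//.
have k1 : Gr 1%g (x, u) * Gr h (y, v) <= (D * fu) * (D * hv).
  by apply: ler_pM => //; exact: ltW.
have k2 : fv * hu' <= (D * Gr 1%g (y, v)) * (D * Gr h (x, u)).
  by apply: ler_pM => //; exact: ltW.
apply: (@le_trans _ _ (expR 1 * ((D * fu) * (D * hv)))); first by rewrite ler_pM2l ?expR_gt0.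
rewrite [leLHS](_ : _ = expR 1 * D ^+ 2 * (fu * hv)); last by ring.
have cc : 0 < expR 1 * D ^+ 2 by rewrite mulr_gt0 ?expR_gt0 ?exprn_gt0.
apply: (@le_trans _ _ (expR 1 * D ^+ 2 * (C ^+ 4 * e * (fv * hu')))); first by rewrite ler_pM2l.
apply: (@le_trans _ _ (expR 1 * D ^+ 2 * (C ^+ 4 * e *
    ((D * Gr 1%g (y, v)) * (D * Gr h (x, u)))))).
  by rewrite ler_pM2l// ler_pM2l// mulr_gt0// exprn_gt0.
rewrite le_eqVlt; apply/orP; left; apply/eqP; rewrite /e; field.
by rewrite !gt_eqF// expR_gt0.
Qed.

End Kernel.

(** * Sphere sizes and the growth rate *)

Lemma fekete (R : realType) (a : R^nat) : (forall n, 0 <= a n) -> a 0%N = 0 ->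
  (forall n m, a (n + m)%N <= a n + a m) -> cvgn (fun n => a n / n%:R).
Proof.
move=> a0 a00 sub; pose E := [set x | exists2 n : nat, (0 < n)%N & x = a n / n%:R].
have lbE : lbound E 0 by move=> _ [n n0 ->]; rewrite divr_ge0.
have infE : has_inf E by split; [exists (a 1%N / 1%:R), 1%N|exists 0].
pose l := inf E; apply/cvg_ex; exists l; apply/cvgrPdist_lt => e e0.
have e2 : 0 < e / 2 by rewrite divr_gt0.
have [_ [m m0 ->] hm] := inf_adherent e2 infE.
have mR : 0 < m%:R :> R by rewrite ltr0n.
pose M := \sum_(i < m) a i.
have aM i : (i < m)%N -> a i <= M.
  move=> im; rewrite /M (bigD1 (Ordinal im))//= lerDl sumr_ge0// => j _; exact: a0.
have M0 : 0 <= M by rewrite sumr_ge0.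
have aq q : a (q * m)%N <= q%:R * a m.
  elim: q => [|q IH]; last first.
    by rewrite mulSn; apply: le_trans (sub _ _) _; rewrite -natr1 mulrDl mul1r addrC lerD2r.
  by rewrite mul0n mul0r a00.
exists (Num.trunc (2 * M / e)).+1 => // n /= nN.
have n0 : (0 < n)%N by apply: leq_ltn_trans nN.
have nR : 0 < n%:R :> R by rewrite ltr0n.
have ln_ : l <= a n / n%:R by apply: (ge_inf infE.2); exists n.
rewrite distrC ger0_norm ?subr_ge0// ltrBlDl.
have hn : 2 * M / e < n%:R.
  by apply: lt_le_trans (truncnS_gt _) _; rewrite ler_nat.
have Mn : M < e / 2 * n%:R.
  by move: hn; rewrite ltr_pdivrMr//; lra.
have an : a n <= n%:R * (a m / m%:R) + M.
  rewrite {1}(divn_eq n m); apply: le_trans (sub _ _) _; apply: lerD; last first.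
    by apply: aM; rewrite ltn_mod.
  apply: le_trans (aq _) _; rewrite mulrCA [leLHS]mulrC ler_wpM2l// ler_pdivlMr//.
  by rewrite -natrM ler_nat leq_trunc_div.
rewrite ltr_pdivrMr//; apply: le_lt_trans an _.
have : n%:R * (a m / m%:R) < n%:R * (l + e / 2) by rewrite ltr_pM2l.
by move: Mn; lra.
Qed.

Section Growth.
Variables (R : realType) (G : groupType) (S : seq G) (S_gen : sym_generating S).
Local Notation wl := (wlen S).
Local Notation s := (sphere_card S).

Lemma sphere_card_gt0 g : (0 < s (wl g))%N.
Proof.
by rewrite /sphere_card cardfs_gt0; apply/fset0Pn; exists g; rewrite mem_sphere.
Qed.

Lemma sphere_cardM n m : (s (n + m) <= s n * s m)%N.
Proof.
rewrite /sphere_card -(@size_allpairs _ _ _ (fun a b : G => (a * b)%g)).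
apply: uniq_leq_size => [|g]; first exact: fset_uniq.
rewrite mem_sphere// => /eqP gE; have [a [b [-> wa wb]]] := wlen_split S_gen gE.
by apply: allpairs_f; rewrite mem_sphere// ?wa ?wb.
Qed.

Hypothesis infG : forall n, exists g, wl g = n.

Lemma sphere_card_ge1 n : (1 <= s n)%N.
Proof. by have [g <-] := infG n; exact: sphere_card_gt0. Qed.

Let s1 n : 1 <= (s n)%:R :> R. Proof. by rewrite ler1n sphere_card_ge1. Qed.
Let s0 n : 0 < (s n)%:R :> R. Proof. by rewrite ltr0n sphere_card_ge1. Qed.

(** The logarithm of the sphere size is subadditive, because elements of length [n + m] split into
    factors of lengths [n] and [m]; [infG] keeps it nonnegative. Convergence is what makes the
    [limn] in [growth] the intended number. *)
Lemma cvg_growth : cvgn (fun n : nat => ((s n)%:R `^ (n%:R^-1) : R)).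
Proof.
pose a n : R := ln (s n)%:R.
have : cvgn (fun n => a n / n%:R).
  apply: fekete => [n||n m].
  - by rewrite ln_ge0.
  - rewrite /a (_ : s 0 = 1%N) ?ln1//; apply/eqP; rewrite eqn_leq sphere_card_ge1 andbT.
    rewrite /sphere_card -(cardfs1 (1%g : G)); apply: fsubset_leq_card; apply/fsubsetP => g.
    by rewrite mem_sphere// inE => /eqP /(wlen_eq0 S_gen) ->.
  - rewrite /a -lnM ?posrE// ler_ln ?posrE ?mulr_gt0// -natrM ler_nat.
    exact: sphere_cardM.
move=> /cvg_ex[l hl]; apply/cvg_ex; exists (expR l).
have := cvg_comp _ _ hl (@continuous_expR R l).
apply: cvg_trans; apply: near_eq_cvg; near=> n => /=.
by rewrite /powR gt_eqF// mulrC.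
Unshelve. all: by end_near. Qed.

Lemma growth_ge1 : 1 <= growth S :> R.
Proof.
rewrite /growth; apply: limr_ge; first exact: cvg_growth.
near=> n; apply: (@le_trans _ _ (1 `^ (n%:R^-1))); first by rewrite powR1.
by apply: ge0_ler_powR; rewrite ?nnegrE// invr_ge0.
Unshelve. all: by end_near. Qed.

Lemma sphere_card_le (eps : R) : 0 < eps -> exists2 K : R, 0 < K &
  forall n, (s n)%:R <= K * (growth S + eps) ^+ n.
Proof.
move=> e0; have g1 := growth_ge1.
have gcv : (fun n : nat => ((s n)%:R `^ (n%:R^-1) : R)) @ \oo --> (growth S : R) := cvg_growth.
move/cvgr_lt: gcv => /(_ (growth S + eps)).
rewrite ltrDl => /(_ e0) [N _ hN].
pose b : R := growth S + eps; have b1 : 1 <= b by rewrite /b; lra.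
exists (1 + \sum_(i < N.+1) (s i)%:R); first by rewrite ltr_wpDr// sumr_ge0.
move=> n; have bn : 1 <= b ^+ n by rewrite exprn_ege1.
have [nN|Nn] := leqP n N.
  apply: (@le_trans _ _ (1 + \sum_(i < N.+1) (s i)%:R)); last first.
    by rewrite -[leLHS]mulr1 ler_wpM2l// addr_ge0// sumr_ge0.
  have iN : (n < N.+1)%N by [].
  by rewrite (bigD1 (Ordinal iN))//= addrCA lerDl addr_ge0// sumr_ge0.
have := hN n (ltnW Nn); rewrite /= => /ltW h.
have n0 : (0 < n)%N by apply: leq_ltn_trans Nn.
apply: (@le_trans _ _ (b ^+ n)).
  have -> : (s n)%:R = ((s n)%:R `^ n%:R^-1) ^+ n :> R.
    rewrite -powR_mulrn ?powR_ge0// -powRrM mulVf ?powRr1//.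
    by rewrite pnatr_eq0 -lt0n.
  by apply: lerXn2r; rewrite ?nnegrE ?powR_ge0//; lra.
by rewrite -[leLHS]mul1r ler_pM2r; [rewrite lerDl sumr_ge0|lra].
Unshelve. all: by end_near. Qed.

End Growth.

Section SphereSum.
Variables (R : realType) (G : groupType) (S : seq G) (S_gen : sym_generating S).
Local Notation wl := (wlen S).
Local Open Scope ereal_scope.

(** This is the purpose of the sphere size in [c_h]: grouping by word length turns a sum over the
    group into a series over radii. *)
Lemma esum_sphere (u : nat -> R) (B : R) : (forall k, 0 <= u k)%R ->
  (forall n, \sum_(0 <= k < n) u k <= B)%R ->
  \esum_(h in [set: G]) (u (wl h) / (sphere_card S (wl h))%:R)%:E <= B%:E.
Proof.
move=> u0 uB; pose t h := (u (wl h) / (sphere_card S (wl h))%:R)%:E.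
have t0 h : 0 <= t h by rewrite lee_fin divr_ge0.
have -> : [set: G] = \bigcup_(k in [set: nat]) [set h | wl h = k].
  by apply/seteqP; split=> // h _; exists (wl h).
rewrite esum_bigcupT//; last by move=> i j _ _ [h [/= -> ->]].
apply: (@le_trans _ _ (\esum_(k in [set: nat]) (u k)%:E)).
  apply: le_esum => k _; rewrite (eq_esum (b := fun=> (u k / (sphere_card S k)%:R)%:E)); last first.
    by move=> h /= ->.
  have fin := finite_sphere S_gen k.
  rewrite esum_fset//; last by move=> h _; rewrite lee_fin divr_ge0.
  rewrite fsbig_finite//= sumEFin lee_fin big_const_seq count_predT iter_addr_0 -/(sphere_card S k).
  have [->|n0] := eqVneq (sphere_card S k) 0%N; first by rewrite mulr0n.
  by rewrite -[leLHS]mulr_natr divfK// pnatr_eq0.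
rewrite -nneseries_esumT; last by move=> n; rewrite lee_fin.
apply: lime_le; first by apply: is_cvg_nneseries => n _ _; rewrite lee_fin.
by near=> n; rewrite sumEFin lee_fin.
Unshelve. all: by end_near. Qed.

End SphereSum.

(** The bound is the full sum, the derivative of the geometric series; the induction is on the
    closed form of the partial sums. *)
Lemma sum_arith_geom (R : realType) (x : R) n : 0 < x < 1 ->
  \sum_(0 <= k < n) (x ^+ k * (1 + k%:R)) <= (1 - x)^-1 ^+ 2.
Proof.
move=> /andP[x0 x1]; have y0 : 0 < 1 - x by lra.
rewrite exprVn -[leRHS]mulr1 ler_pdivlMl ?exprn_gt0//.
have -> : (1 - x) ^+ 2 * \sum_(0 <= k < n) (x ^+ k * (1 + k%:R)) =
    1 - x ^+ n * (n%:R * (1 - x) + 1).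
  elim: n => [|n IH]; first by rewrite big_geq// expr0 !mul0r; ring.
  rewrite big_nat_recr//= mulrDr IH [x ^+ n.+1]exprS -[n.+1%:R]natr1. ring.
by rewrite gerDl oppr_le0 mulr_ge0// ?exprn_ge0 ?addr_ge0 ?mulr_ge0// ltW.
Qed.

(** * The visual boundary *)

Section Chain.
Variables (R : realType) (q : nat -> nat -> R) (K : R) (m : nat).
Hypotheses (q_ge0 : forall i j, 0 <= q i j) (K_bnd : 1 <= K <= 2).
Hypothesis q_ultra : forall i j k, (i <= m)%N -> (j <= m)%N -> (k <= m)%N ->
  q i k <= K * Num.max (q i j) (q j k).

Let e i j := \sum_(i <= k < j) q k k.+1.

(* Frink's metrization lemma: interior edges are counted twice, so that the
   estimates for two overlapping subchains add up. *)
Lemma chain_bound n i : (i + n.+2 <= m)%N ->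
  q i (i + n.+2) <= K * (2 * e i (i + n.+2) - q i i.+1 - q (i + n.+1) (i + n.+2)).
Proof.
have /andP[K1 K2] := K_bnd; have K0 : 0 < K by lra.
elim/ltn_ind: n i => n IH i im.
have e0 a b : 0 <= e a b by rewrite sumr_ge0.
set x := q i (i + n.+2).
(* Take the last index [k] still far from the end of the chain. By maximality the next index is far
   from the start, so the subchain up to [k + 1] and the one from [k] on both have distant ends, and
   they overlap in one edge. *)
pose P k := (k <= n.+1)%N && (x <= K * q (i + k) (i + n.+2)).
have exP : exists k, P k.
  by exists 0%N; rewrite /P addn0 /= -/x -[leLHS]mul1r ler_wpM2r// q_ge0.
have ubP k : P k -> (k <= n.+1)%N by case/andP.
case: (ex_maxnP exP ubP) => k /andP[kn xk] kmax.
have xk1 : x <= K * q i (i + k.+1).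
  have [kE|kn1] := eqVneq k n.+1.
    by rewrite kE -[leLHS]mul1r ler_wpM2r// q_ge0.
  have kn2 : (k.+1 <= n.+1)%N by lia.
  have nP : ~~ (x <= K * q (i + k.+1) (i + n.+2)).
    apply/negP => h; have /kmax : P k.+1 by rewrite /P kn2.
    by lia.
  have := @q_ultra i (i + k.+1)%N (i + n.+2)%N _ _ _; rewrite -/x.
  have -> : (i <= m)%N by lia. have -> : (i + k.+1 <= m)%N by lia. rewrite im => /(_ isT isT isT).
  by case: (leP (q i (i + k.+1)) (q (i + k.+1) (i + n.+2))) => // _ h; rewrite h in nP.
have eS : e i (i + n.+2) = q i i.+1 + e i.+1 (i + n.+1) + q (i + n.+1) (i + n.+2).
  rewrite /e (addnS i n.+1) big_nat_recr/=; last by lia.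
  by congr (_ + _); rewrite big_ltn//; lia.
have em := e0 i.+1 (i + n.+1).
have b1 : K * q i i.+1 <= K * (2 * e i (i + n.+2) - q i i.+1 - q (i + n.+1) (i + n.+2)).
  rewrite ler_pM2l// eS; have := q_ge0 i i.+1; have := q_ge0 (i + n.+1) (i + n.+2); lra.
have b2 : K * q (i + n.+1) (i + n.+2) <= K * (2 * e i (i + n.+2) - q i i.+1 - q (i + n.+1) (i + n.+2)).
  rewrite ler_pM2l// eS; have := q_ge0 i i.+1; have := q_ge0 (i + n.+1) (i + n.+2); lra.
have [k0|k0] := eqVneq k 0%N; first by apply: le_trans b1; rewrite k0 addn1 in xk1.
have [kE|kn1] := eqVneq k n.+1; first by apply: le_trans b2; rewrite kE in xk.
have [a kE] : exists a, k = a.+1 by exists k.-1; lia.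
have [b nE] : exists b, n = (a.+1 + b)%N by exists (n - a.+1)%N; lia.
rewrite kE in xk xk1.
have iE : (i + n.+2 = (i + a.+1) + b.+2)%N by lia.
have h1 := IH a ltac:(lia) i ltac:(lia).
have h2 := IH b ltac:(lia) (i + a.+1)%N ltac:(lia).
rewrite -iE in h2; have jE : ((i + a.+1) + b.+1 = i + n.+1)%N by lia.
rewrite jE -addnS in h2.
have eC : e i (i + n.+2) = e i (i + a.+2) + e (i + a.+1) (i + n.+2) - q (i + a.+1) (i + a.+2).
  rewrite /e (@big_cat_nat _ _ _ (i + a.+1) i (i + n.+2))//=; [|lia|lia].
  by rewrite (addnS i a.+1) big_nat_recr/=; [ring|lia].
have u0 := q_ge0 i (i + a.+2); have v0 := q_ge0 (i + a.+1) (i + n.+2).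
(* [x] is at most [K] times either summand; averaging the two bounds removes the constant, as
   [K <= 2]. *)
apply: (@le_trans _ _ (q i (i + a.+2) + q (i + a.+1) (i + n.+2))).
  have : K * q i (i + a.+2) <= 2 * q i (i + a.+2) by rewrite ler_wpM2r.
  have : K * q (i + a.+1) (i + n.+2) <= 2 * q (i + a.+1) (i + n.+2) by rewrite ler_wpM2r.
  by move: xk xk1; lra.
apply: le_trans (lerD h1 h2) _; rewrite eC -mulrDr ler_pM2l//; lra.
Qed.

Lemma chain_le : (0 < m)%N -> q 0 m <= 4 * \sum_(k < m) q k k.+1.
Proof.
have /andP[K1 K2] := K_bnd.
case: m chain_bound => [//|[|n]] h _.
  by rewrite big_ord_recl big_ord0 addr0 /=; have := q_ge0 0 1; lra.
have := h n 0%N (leqnn _); rewrite !add0n /e big_mkord => /le_trans; apply.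
set s := \sum_(_ < _) _; have s0 : 0 <= s by rewrite sumr_ge0.
have := q_ge0 0 1; have := q_ge0 n.+1 n.+2 => h1 h2.
apply: (@le_trans _ _ (K * (2 * s))); first by rewrite ler_pM2l//; lra.
by rewrite mulrA ler_wpM2r//; lra.
Qed.

End Chain.

Section Boundary.
Variables (R : realType) (G : groupType) (S : seq G) (S_gen : sym_generating S).
Variables (delta : R) (delta_gt0 : 0 < delta) (G_hyp : hyperbolic S delta).
Local Notation gp := (@gprod R G S 1%g).
Local Notation conv u := (@converges_at_infinity R G S u).
Local Notation dG := (@boundary R G S).
Implicit Types (u v w : nat -> G) (xi eta zeta : set (nat -> G)).

Lemma converges_at_infinityP u : conv u <->
  forall M : R, exists N, forall m n, (N <= m)%N -> (N <= n)%N -> M <= gp (u m) (u n).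
Proof.
rewrite /converges_at_infinity cvgryPge; split=> [h M|h M].
  have [[P Q] [/= [N1 _ hN1] [N2 _ hN2]] PQ] := h M.
  exists (maxn N1 N2) => m n; rewrite !geq_max => /andP[m1 _] /andP[_ n2].
  by apply: (PQ (m, n)); split; [apply: hN1|apply: hN2].
have [N hN] := h M.
exists ([set n | (N <= n)%N], [set n | (N <= n)%N]); first by split; exists N.
by move=> [m n] [/= hm hn]; exact: hN.
Qed.

Lemma same_limitP u v : @same_limit R G S u v <->
  forall M : R, exists N, forall n, (N <= n)%N -> M <= gp (u n) (v n).
Proof.
rewrite /same_limit cvgryPge; split=> h M.
  by have [N _ hN] := h M; exists N => n nN; exact: hN.
by have [N hN] := h M; exists N => // n /= nN; exact: hN.
Qed.

Lemma limf_einf_gt u v (a : R) :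
  (a%:E < limf_einf (fun p : nat * nat => (gp (u p.1) (v p.2))%:E) (filter_prod \oo \oo))%E ->
  exists N, forall m n, (N <= m)%N -> (N <= n)%N -> a <= gp (u m) (v n).
Proof.
rewrite limf_einfE => /ereal_sup_gt [_ [V FV <-] aV].
have [[P Q] [/= [N1 _ hN1] [N2 _ hN2]] PQ] := FV.
exists (maxn N1 N2) => m n; rewrite !geq_max => /andP[m1 _] /andP[_ n2].
have Vmn : V (m, n) by apply: PQ; split; [apply: hN1|apply: hN2].
rewrite -lee_fin; apply: le_trans (ltW aV) _.
by apply: ereal_inf_lbound; exists (m, n).
Qed.

Lemma limf_einf_ge u v (a : R) :
  (exists N, forall m n, (N <= m)%N -> (N <= n)%N -> a <= gp (u m) (v n)) ->
  (a%:E <= limf_einf (fun p : nat * nat => (gp (u p.1) (v p.2))%:E) (filter_prod \oo \oo))%E.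
Proof.
move=> [N hN]; rewrite limf_einfE.
pose V := [set p : nat * nat | (N <= p.1)%N /\ (N <= p.2)%N].
apply: (@le_trans _ _ (ereal_inf [set (gp (u p.1) (v p.2))%:E | p in V])).
  by apply: le_ereal_inf_tmp => _ [[m n] [/= hm hn] <-]; rewrite lee_fin hN.
apply: ereal_sup_ubound; exists V => //.
exists ([set n | (N <= n)%N], [set n | (N <= n)%N]); first by split; exists N.
by move=> [m n] [].
Qed.

Lemma bdry_conv xi u : dG xi -> xi u -> conv u.
Proof. by move=> [u0 _ ->] []. Qed.

Lemma bdry_nonempty xi : dG xi -> exists u, xi u.
Proof.
move=> [u0 cu0 ->]; exists u0; split => //; apply/same_limitP => M.
by have [N hN] := (converges_at_infinityP u0).1 cu0 M; exists N => n nN; exact: hN.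
Qed.

Lemma conv_bdry u : conv u -> dG [set v | conv v /\ @same_limit R G S u v].
Proof. by move=> cu; exists u. Qed.

Let hyp := hyper G_hyp.
Let gpC := gprodC (R := R) S_gen.

(** [same_limit] compares equal indices only. Passing through [u m], [u k], [u0 k], [v k], [v n]
    with large [k] makes the two indices independent, at a cost of [3 * delta]. *)
Lemma bdry_joint xi u v : dG xi -> xi u -> xi v ->
  forall M : R, exists N, forall m n, (N <= m)%N -> (N <= n)%N -> M <= gp (u m) (v n).
Proof.
move=> [u0 cu0 ->] [cu /same_limitP su] [cv /same_limitP sv] M.
pose M' := M + 3 * delta.
have [N1 h1] := su M'; have [N2 h2] := sv M'.
have [N3 h3] := (converges_at_infinityP u).1 cu M'.
have [N4 h4] := (converges_at_infinityP v).1 cv M'.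
pose k := (N1 + N2 + N3 + N4)%N; exists k => m n km kn.
have a1 : M' <= gp (u m) (u k) by apply: h3; lia.
have a2 : M' <= gp (u k) (u0 k) by rewrite gpC; apply: h1; lia.
have a3 : M' <= gp (u0 k) (v k) by apply: h2; lia.
have a4 : M' <= gp (v k) (v n) by apply: h4; lia.
have b1 := hyp a1 a2; have b2 : M' - delta - delta <= gp (u m) (v k).
  by apply: (hyp b1); move: delta_gt0 a3; lra.
have b3 : M' - delta - delta - delta <= gp (u m) (v n).
  by apply: (hyp b2); move: delta_gt0 a4; lra.
by move: b3; rewrite /M'; lra.
Qed.

Lemma bdry_mem xi u v : dG xi -> xi u -> conv v ->
  (forall M : R, exists N, forall n, (N <= n)%N -> M <= gp (u n) (v n)) -> xi v.
Proof.
move=> dxi; case: (dxi) => [u0 cu0 xiE] xu cv h; rewrite xiE; split => //.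
apply/same_limitP => M.
have xu0 : xi u0.
  rewrite xiE; split=> //; apply/same_limitP => M'.
  by have [N hN] := (converges_at_infinityP u0).1 cu0 M'; exists N => n nN; exact: hN.
have [N1 h1] := h (M + delta); have [N2 h2] := bdry_joint dxi xu0 xu (M + delta).
exists (N1 + N2)%N => n nN.
have a1 : M + delta <= gp (u0 n) (u n) by apply: h2; lia.
have a2 : M + delta <= gp (u n) (v n) by apply: h1; lia.
by have := hyp a1 a2; rewrite addrK.
Qed.

Lemma bdry_eq xi eta u : dG xi -> dG eta -> xi u -> eta u -> xi = eta.
Proof.
have sub xi' eta' : dG xi' -> dG eta' -> xi' u -> eta' u -> xi' `<=` eta'.
  move=> d1 d2 x1 x2 v xv; apply: (bdry_mem d2 x2); first exact: bdry_conv xv.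
  by move=> M; have [N hN] := bdry_joint d1 x1 xv M; exists N => n nN; exact: hN.
by move=> d1 d2 x1 x2; apply/seteqP; split; apply: sub.
Qed.

Lemma bdry_gprod_gt xi eta (a : R) : (a%:E < bdry_gprod S xi eta)%E ->
  exists u v, [/\ xi u, eta v & exists N, forall m n, (N <= m)%N -> (N <= n)%N ->
    a <= gp (u m) (v n)].
Proof.
rewrite /bdry_gprod => /ereal_sup_gt [_ [u xu [v ev <-]] h].
by exists u, v; split => //; exact: limf_einf_gt h.
Qed.

Lemma bdry_gprod_ge xi eta u v (a : R) : xi u -> eta v ->
  (exists N, forall m n, (N <= m)%N -> (N <= n)%N -> a <= gp (u m) (v n)) ->
  (a%:E <= bdry_gprod S xi eta)%E.
Proof.
move=> xu ev /limf_einf_ge /le_trans; apply.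
by apply: ereal_sup_ubound; exists u => //; exists v.
Qed.

Lemma bdry_gprod_ge0 xi eta : dG xi -> dG eta -> (0 <= bdry_gprod S xi eta :> \bar R)%E.
Proof.
move=> /bdry_nonempty [u xu] /bdry_nonempty [v ev].
by apply: (bdry_gprod_ge xu ev); exists 0%N => m n _ _; exact: gprod_ge0.
Qed.

(** Every choice of sequences almost attains the supremum in [bdry_gprod]: passing to a near optimal
    pair and back costs [delta] twice. *)
Lemma bdry_gprod_lower xi eta u v (a : R) : dG xi -> dG eta -> xi u -> eta v ->
  (a%:E < bdry_gprod S xi eta)%E ->
  exists N, forall m n, (N <= m)%N -> (N <= n)%N -> a - 2 * delta <= gp (u m) (v n).
Proof.
move=> dx de xu ev /bdry_gprod_gt [u' [v' [xu' ev' [N hN]]]].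
have [N1 h1] := bdry_joint dx xu xu' a; have [N2 h2] := bdry_joint de ev' ev a.
pose k := (N + N1 + N2)%N; exists k => m n km kn.
have a1 : a <= gp (u m) (u' k) by apply: h1; lia.
have a2 : a <= gp (u' k) (v' k) by apply: hN; lia.
have a3 : a <= gp (v' k) (v n) by apply: h2; lia.
have b1 := hyp a1 a2; have := hyp b1 (_ : a - delta <= gp (v' k) (v n)).
by move=> /(_ ltac:(move: delta_gt0 a3; lra)); lra.
Qed.

(** A single late pair with product [a + 2 * delta] would force all late pairs, and hence the
    boundary product, to be at least [a]. *)
Lemma bdry_gprod_upper xi eta u v (a : R) : dG xi -> dG eta -> xi u -> eta v ->
  (bdry_gprod S xi eta < a%:E)%E ->
  exists N, forall m n, (N <= m)%N -> (N <= n)%N -> gp (u m) (v n) < a + 2 * delta.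
Proof.
move=> dx de xu ev hlt.
have [N1 h1] := bdry_joint dx xu xu (a + 2 * delta).
have [N2 h2] := bdry_joint de ev ev (a + 2 * delta).
exists (N1 + N2)%N => m n km kn; rewrite ltNge; apply/negP => h.
suff : (a%:E <= bdry_gprod S xi eta)%E by rewrite leNgt hlt.
apply: (bdry_gprod_ge xu ev); exists (N1 + N2)%N => m' n' km' kn'.
have a1 : a + 2 * delta <= gp (u m') (u m) by apply: h1; lia.
have a3 : a + 2 * delta <= gp (v n) (v n') by apply: h2; lia.
have b1 := hyp a1 h; have := hyp b1 (_ : a + 2 * delta - delta <= gp (v n) (v n')).
by move=> /(_ ltac:(move: delta_gt0 a3; lra)); lra.
Qed.

Lemma bdry_gprod_inf xi eta : dG xi -> dG eta -> bdry_gprod S xi eta = +oo%E :> \bar R -> xi = eta.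
Proof.
move=> dx de E; have [u xu] := bdry_nonempty dx; have [v ev] := bdry_nonempty de.
apply: (bdry_eq dx de _ ev); apply: (bdry_mem dx xu (bdry_conv de ev)) => M.
have lt : ((M + 2 * delta)%:E < bdry_gprod S xi eta)%E by rewrite E ltry.
have [N hN] := bdry_gprod_lower dx de xu ev lt.
by exists N => n nN; have := hN n n nN nN; lra.
Qed.

Lemma bdry_gprod_self xi : dG xi -> bdry_gprod S xi xi = +oo%E :> \bar R.
Proof.
move=> dx; have [u xu] := bdry_nonempty dx; apply/eqyP => M M0.
by apply: (bdry_gprod_ge xu xu); exact: (bdry_joint dx xu xu).
Qed.

Lemma bdry_gprod_hyper xi eta zeta (a : R) : dG xi -> dG eta -> dG zeta ->
  (a%:E < bdry_gprod S xi eta)%E -> (a%:E < bdry_gprod S eta zeta)%E ->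
  ((a - 2 * delta)%:E <= bdry_gprod S xi zeta)%E.
Proof.
move=> dx de dz /bdry_gprod_gt [u [v [xu ev [N1 h1]]]] /bdry_gprod_gt [v' [w [ev' zw [N2 h2]]]].
have [N3 h3] := bdry_joint de ev ev' a.
apply: (bdry_gprod_ge xu zw); pose k := (N1 + N2 + N3)%N; exists k => m n km kn.
have a1 : a <= gp (u m) (v k) by apply: h1; lia.
have a2 : a <= gp (v k) (v' k) by apply: h3; lia.
have a3 : a <= gp (v' k) (w n) by apply: h2; lia.
have b1 := hyp a1 a2; have := hyp b1 (_ : a - delta <= gp (v' k) (w n)).
by move=> /(_ ltac:(move: delta_gt0 a3; lra)); lra.
Qed.

Variables (lamv : R) (lamv_bnd : 2 `^ (- (2 * delta)^-1) < lamv < 1).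
Local Notation q xi eta := (epow lamv (bdry_gprod S xi eta)).

Lemma lamv_gt0 : 0 < lamv.
Proof. by case/andP: lamv_bnd => h _; apply: le_lt_trans h; exact: powR_ge0. Qed.

Let K := lamv `^ (- (2 * delta)).

(** The boundary product is hyperbolic with constant [2 * delta], whence [K]. The lower bound on
    [lamv] gives [K <= 2], as required by the chain argument. *)
Lemma frink_constant : 1 <= K <= 2.
Proof.
have l0 := lamv_gt0; have /andP[l1 l2] := lamv_bnd.
have d0 : 0 < 2 * delta by rewrite mulr_gt0.
rewrite /K powRN; apply/andP; split.
  rewrite invf_ge1 ?powR_gt0//; apply: (@le_trans _ _ (lamv `^ 0)); last by rewrite powRr0.
  by apply: ger_powR; [rewrite l0 ltW|exact: ltW].
rewrite invf_ple ?posrE ?powR_gt0//.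
apply: (@le_trans _ _ ((2 `^ (- (2 * delta)^-1)) `^ (2 * delta))).
  by rewrite -powRrM mulNr mulVf ?gt_eqF// powRN powRr1.
by apply: ge0_ler_powR; rewrite ?nnegrE ?powR_ge0// ltW.
Qed.

Lemma epow_ge0 (z : \bar R) : 0 <= epow lamv z.
Proof. by case: z => [z||] //=; exact: powR_ge0. Qed.

Lemma q_ultra xi eta zeta : dG xi -> dG eta -> dG zeta ->
  q xi zeta <= K * Num.max (q xi eta) (q eta zeta).
Proof.
move=> dx de dz; have l0 := lamv_gt0; have /andP[_ l1] := lamv_bnd.
have /andP[K1 _] := frink_constant.
have qm x y z : 0 <= x -> z = Num.max x y \/ z = Num.max y x -> x <= K * z.
  move=> x0 h; apply: (@le_trans _ _ z); first by case: h => ->; rewrite le_max lexx ?orbT.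
  rewrite -[leLHS]mul1r ler_wpM2r//; apply: le_trans x0 _.
  by case: h => ->; rewrite le_max lexx ?orbT.
have [/(bdry_gprod_inf dx de) ->|n1] := eqVneq (bdry_gprod S xi eta : \bar R) +oo%E.
  by apply: qm; [exact: epow_ge0|right].
have [/(bdry_gprod_inf de dz) ->|n2] := eqVneq (bdry_gprod S eta zeta : \bar R) +oo%E.
  by apply: qm; [exact: epow_ge0|left].
have := bdry_gprod_ge0 dx de; have := bdry_gprod_ge0 de dz; have := bdry_gprod_ge0 dx dz.
move: (fun a => @bdry_gprod_hyper xi eta zeta a dx de dz) n1 n2.
case: (bdry_gprod S xi eta) => [s| |]//; case: (bdry_gprod S eta zeta) => [t| |]//.
move=> h _ _; case: (bdry_gprod S xi zeta) h => [z| |]// h _ _ _ /=; last first.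
  by rewrite mulr_ge0// ?le_max ?powR_ge0//; lra.
have zle : Num.min s t - 2 * delta <= z.
  apply/ler_addgt0Pr => e e0; rewrite -lerBlDr.
  have := h (Num.min s t - e); rewrite !lte_fin lee_fin => H.
  have : Num.min s t - e - 2 * delta <= z.
    by apply: H; rewrite ltrBlDr; [apply: (@le_lt_trans _ _ s)|apply: (@le_lt_trans _ _ t)];
      rewrite ?ge_min ?lexx ?orbT// ltrDl.
  by lra.
have -> : Num.max (lamv `^ s) (lamv `^ t) = lamv `^ (Num.min s t).
  have mono x y : x <= y -> lamv `^ y <= lamv `^ x by move=> xy; apply: ger_powR => //; rewrite l0 ltW.
  case: (leP s t) => [st|/ltW ts]; first by rewrite max_l// mono.
  by rewrite max_r// mono.
rewrite /K -powRD; last by rewrite (gt_eqF l0) implybT.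
apply: ger_powR; [by rewrite l0 ltW|lra].
Qed.

Lemma dvisual_le xi eta : dG xi -> dG eta -> dvisual S lamv xi eta <= q xi eta.
Proof.
move=> dx de; apply: ge_inf.
  exists 0 => _ [m [x [_ _ _ ->]]]; rewrite sumr_ge0// => k _; exact: epow_ge0.
exists 1%N, (fun k => if k is 0 then xi else eta); split=> //.
  by case=> [|[|]].
by rewrite big_ord_recl big_ord0 addr0.
Qed.

Lemma dvisual_ge xi eta : dG xi -> dG eta -> q xi eta <= 4 * dvisual S lamv xi eta.
Proof.
move=> dx de; rewrite -ler_pdivrMl//; apply: lb_le_inf.
  exists (q xi eta), 1%N, (fun k => if k is 0 then xi else eta); split=> //.
    by case=> [|[|]].
  by rewrite big_ord_recl big_ord0 addr0.
move=> _ [m [x [dxk x0 xm ->]]]; rewrite ler_pdivrMl//.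
(* A chain without steps has sum 0, but then [xi = eta] and the product is infinite. *)
case: m dxk xm => [|m] dxk xm.
  by rewrite big_ord0 mulr0 -xm -x0 bdry_gprod_self//; apply: dxk.
rewrite -xm -x0; apply: (chain_le (q := fun i j => q (x i) (x j)) (K := K)) => //.
- by move=> i j; exact: epow_ge0.
- exact: frink_constant.
- by move=> i j k im jm km; apply: q_ultra; apply: dxk.
Qed.

Lemma dvisual_ge0 xi eta : 0 <= dvisual S lamv xi eta.
Proof.
rewrite /dvisual; set E := (X in inf X); have [->|/set0P ne] := eqVneq E set0.
  by rewrite inf0.
apply: lb_le_inf => // _ [m [x [_ _ _ ->]]]; rewrite sumr_ge0// => k _; exact: epow_ge0.
Qed.

Lemma dvisual_self xi : dG xi -> dvisual S lamv xi xi = 0.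
Proof.
move=> dx; apply/eqP; rewrite eq_le dvisual_ge0 andbT.
by apply: le_trans (dvisual_le dx dx) _; rewrite bdry_gprod_self.
Qed.

Lemma dvisual_eq0 xi eta : dG xi -> dG eta -> dvisual S lamv xi eta = 0 -> xi = eta.
Proof.
move=> dx de E; apply: (bdry_gprod_inf dx de).
have := dvisual_ge dx de; rewrite E mulr0; have := bdry_gprod_ge0 dx de.
case: (bdry_gprod S xi eta) => [s| |]// _ /=.
by rewrite leNgt powR_gt0// lamv_gt0.
Qed.

End Boundary.

Arguments converges_at_infinityP {R G S}.

(** * Orbits converging at infinity *)

Section Subsequence.
Variables (R : realType) (G : groupType) (S : seq G) (S_gen : sym_generating S).
Variables (delta : R) (G_hyp : hyperbolic S delta).
Local Notation wl := (wlen S).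
Local Notation gp := (@gprod R G S 1%g).

(** The geodesic starts at 1; lying on one is equality in the triangle inequality. *)
Definition on_geodesic (p z : G) : Prop := wl z = (wl p + wl (p^-1 * z)%g)%N.

Lemma on_geodesic_trans p q z : on_geodesic p q -> on_geodesic q z -> on_geodesic p z.
Proof.
rewrite /on_geodesic => h1 h2.
have E : (p^-1 * q * (q^-1 * z) = p^-1 * z)%g by rewrite -mulgA mulVKg.
have := wlenM S_gen (p^-1 * q)%g (q^-1 * z)%g; rewrite E.
by have := wlenM S_gen p (p^-1 * z)%g; rewrite mulVKg; lia.
Qed.

Lemma gprod_on_geodesic p z : on_geodesic p z -> gp p z = (wl p)%:R.
Proof. by rewrite /on_geodesic /gprod !wdist1// /wdist => ->; rewrite natrD; lra. Qed.

Lemma finite_sub_bound (T0 : seq G) (P : G -> nat -> Prop) :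
  (forall s m n, (m <= n)%N -> P s m -> P s n) ->
  (forall s, s \in T0 -> exists n, P s n) -> exists n, forall s, s \in T0 -> P s n.
Proof.
move=> mono; elim: T0 => [|s T IH] h; first by exists 0%N.
have [n hn] : exists n, forall s, s \in T -> P s n.
  by apply: IH => t tT; apply: h; rewrite inE tT orbT.
have [m hm] := h s (mem_head _ _).
exists (maxn m n) => t; rewrite inE => /orP[/eqP ->|tT].
  by apply: mono hm; rewrite leq_maxl.
by apply: mono (hn t tT); rewrite leq_maxr.
Qed.

Variable z : nat -> G.
Hypothesis z_escapes : forall F : set G, finite_set F -> \forall n \near \oo, ~ F (z n).

Let Inf p := forall N, exists2 n, (N <= n)%N & on_geodesic p (z n).

(** The step of Koenig's lemma. If each of the finitely many prolongations of [p] were passed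
    finitely often, a late [z n] beyond [p] and outside the ball of radius [|p|] would contradict
    this with its next generator. *)
Let Inf_step p : Inf p -> exists2 q, Inf q & on_geodesic p q /\ wl q = (wl p).+1.
Proof.
move=> Ip; apply: contrapT => no.
have [||N hN] := @finite_sub_bound S (fun s N => wl (p * s)%g = (wl p).+1 ->
    forall n, (N <= n)%N -> ~ on_geodesic (p * s)%g (z n)).
- by move=> s m n mn h w k nk; apply: h => //; exact: leq_trans nk.
- move=> s sS; apply: contrapT => none; apply: no; exists (p * s)%g.
    move=> N; apply: contrapT => noN; apply: none; exists N => _ n nN gn.
    by apply: noN; exists n.
  have w : wl (p * s)%g = (wl p).+1.
    apply: contrapT => w; apply: none; exists 0%N => w'; by [].
  split=> //; rewrite /on_geodesic mulKg w.
  have := wlen_gen sS; have := wlenM S_gen p s; rewrite w; lia.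
have [M _ hM] := z_escapes (finite_ball S_gen (wl p)).
have [n nM gn] := Ip (maxn N M); move: nM; rewrite geq_max => /andP[nN nM].
have /= /negP := hM n nM; rewrite -ltnNge => wz.
have : exists k, wl (p^-1 * z n)%g = (1 + k)%N.
  by exists (wl (p^-1 * z n)%g).-1; move: wz gn; rewrite /on_geodesic; lia.
move=> [k wk]; have [s [b [E ws wb]]] := wlen_split S_gen wk.
have zE : z n = (p * s * b)%g by rewrite -mulgA -E mulVKg.
have sS : s \in S.
  have [t [st tS <-]] := wlen_word S_gen s; rewrite ws in st.
  by case: t st tS => [|a []] //= _ tS; rewrite big_seq1 tS// inE.
have bE : ((p * s)^-1 * z n = b)%g by rewrite zE mulKg.
have wps : wl (p * s)%g = (wl p).+1.
  have := wlenM S_gen p s; have := wlenM S_gen (p * s)%g b; rewrite -zE.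
  by move: gn wk; rewrite /on_geodesic ws wb; lia.
apply: (hN s sS wps n nN); rewrite /on_geodesic wps bE wb.
by move: gn wk; rewrite /on_geodesic; lia.
Qed.


(** The prolongations form a geodesic ray, and [iota k] selects a term beyond its [k]-th point.
    Terms sharing the point at distance [N] have product at least [N - delta]. *)
Lemma convergent_subsequence : exists iota : nat -> nat,
  (forall k, (k <= iota k)%N) /\ @converges_at_infinity R G S (z \o iota).
Proof.
have step (p : {p | Inf p}) : exists q : {p | Inf p},
    on_geodesic (sval p) (sval q) /\ wl (sval q) = (wl (sval p)).+1.
  by have [q Iq h] := Inf_step (svalP p); exists (exist _ q Iq).
have [next hnext] := choice step.
have I1 : Inf 1%g.
  by move=> N; exists N => //; rewrite /on_geodesic wlen1 invg1 mul1g.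
pose P k := iter k next (exist _ 1%g I1).
have wP k : wl (sval (P k)) = k.
  by elim: k => [|k IH]; [rewrite /= wlen1|rewrite (hnext _).2 IH].
have gP k j : on_geodesic (sval (P k)) (sval (P (k + j)%N)).
  elim: j => [|j IH]; first by rewrite addn0 /on_geodesic mulVg wlen1 addn0.
  by rewrite addnS; apply: on_geodesic_trans IH (hnext _).1.
have ex k : exists n, (k <= n)%N /\ on_geodesic (sval (P k)) (z n).
  by have [n kn gn] := svalP (P k) k; exists n.
have [iota hiota] := choice ex; exists iota; split=> [k|]; first exact: (hiota k).1.
apply/converges_at_infinityP => M.
pose N := (Num.trunc (M + delta)).+1; exists N => m n Nm Nn /=.
have gpN k : (N <= k)%N -> N%:R <= gp (sval (P N)) (z (iota k)).
  move=> Nk; rewrite gprod_on_geodesic ?wP//; apply: on_geodesic_trans (hiota k).2.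
  by rewrite -(subnKC Nk); exact: gP.
have := hyper G_hyp (_ : N%:R <= gp (z (iota m)) (sval (P N))) (gpN _ Nn).
rewrite (gprodC S_gen) => /(_ (gpN _ Nm)); apply: le_trans.
by rewrite lerBrDr; apply/ltW/truncnS_gt.
Qed.

End Subsequence.

(** * Coding boundary points by orbits *)

Section Coding.
Variables (R : realType) (A : finType) (adm : rel A) (x0 : tmc adm).
Local Notation Sigma := (Sigma x0).
Variables (G : groupType) (kappa : Sigma -> G).
Hypothesis kappa_loc : forall x y : Sigma, letter x 0%N = letter y 0%N -> kappa x = kappa y.
Hypothesis T_trans : transitive_ext kappa.
Variables (S : seq G) (S_gen : sym_generating S).
Variables (delta : R) (delta_gt0 : 0 < delta) (G_hyp : hyperbolic S delta).
Local Notation wl := (wlen S).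
Local Notation gp := (@gprod R G S 1%g).
Local Notation kw := (word_prod (letter_kappa kappa)).

Variable a : A.

Let loop V := sorted adm (rcons V a) /\ head a V = a.

Let loop_cat V W : loop V -> loop W -> loop (V ++ W).
Proof.
move=> [sV hV] [sW hW]; split; last by case: V hV {sV} => //= b V ->.
by rewrite rcons_cat sorted_cat_head hW sV.
Qed.

(* The loop for [g * s] prolongs that for [g] by one of finitely many loops, so its
   partial products stay near a geodesic. *)
Lemma shadowing_loops : exists D0 : nat, forall g, exists V, [/\ loop V, kw V = g &
  forall i, exists y, on_geodesic S y g /\ (wl (y^-1 * kw (take i V))%g <= D0)%N].
Proof.
have link := link_words kappa_loc T_trans.
have [V hV] := choice (fun s => link a a s).
have VE s : kw (V s) = s by have [] := hV s.
have Vloop s : loop (V s) by have [] := hV s.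
have [||D0 hD0] := @finite_sub_bound G S (fun s n => forall i, (wl (kw (take i (V s))) <= n)%N).
- by move=> s m n mn h i; apply: leq_trans (h i) mn.
- move=> s _; exists (\max_(i < (size (V s)).+1) wl (kw (take i (V s))))%N => i.
  have [si|si] := ltnP i (size (V s)).+1.
    exact: (leq_bigmax (F := fun j : 'I__ => wl (kw (take j (V s)))) (Ordinal si)).
  rewrite take_oversize ?(ltnW si)// -{1}(take_size (V s)).
  exact: (leq_bigmax (F := fun j : 'I__ => wl (kw (take j (V s)))) (Ordinal (ltnSn _))).
exists D0; apply: (wlen_ind S_gen) => [|g s sS E [W [lW kW hW]]].
  exists [::]; split; [by []|by rewrite /word_prod big_nil|move=> i; exists 1%g].
  by rewrite /on_geodesic /= /word_prod big_nil invg1 mulg1 wlen1.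
have gs : on_geodesic S g (g * s)%g.
  rewrite /on_geodesic mulKg; have := wlenM S_gen g s; have := wlen_gen sS; rewrite E; lia.
exists (W ++ V s); split; [exact: loop_cat|by rewrite word_prod_cat kW VE|move=> i].
have [iW|Wi] := ltnP i (size W).
  have [y [yg hy]] := hW i; exists y; split; last by rewrite takel_cat// ltnW.
  exact: on_geodesic_trans yg gs.
exists g; split=> //; rewrite take_cat ltnNge Wi /= word_prod_cat kW mulKg.
exact: hD0.
Qed.

(** The point [x] reads the shadowing loops of the increments of [u] one after another, so a partial
    product ending in block [j] is within [D0] of a geodesic from [u j] to [u j.+1]. As a letter
    moves by a bounded amount, unboundedness of [u] makes the words grow forever. *)
Lemma code_path (u : nat -> G) : (forall M : nat, exists n, (M <= wl (u n))%N) ->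
  exists (x : Sigma) (D0 : nat), forall k, exists N, forall n, (N <= n)%N ->
    exists j y, [/\ (k <= j)%N, on_geodesic S y ((u j)^-1 * u j.+1)%g &
      (wl ((u j * y)^-1 * (u 0%N * kappa_n kappa n x))%g <= D0)%N].
Proof.
move=> u_unb; have [D0 hD0] := shadowing_loops.
have [V hV] := choice hD0.
pose W := fix W k := if k is j.+1 then W j ++ V ((u j)^-1 * u j.+1)%g else [::].
have kWE k : kw (W k) = ((u 0%N)^-1 * u k)%g.
  elim: k => [|k IH]; first by rewrite mulVg /word_prod big_nil.
  rewrite /= word_prod_cat IH; have [_ -> _] := hV ((u k)^-1 * u k.+1)%g.
  by rewrite -mulgA mulVKg.
have lW k : loop (W k).
  by elim: k => [|k IH] //=; apply: loop_cat => //; have [] := hV ((u k)^-1 * u k.+1)%g.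
have WS k j : exists t, W (k + j)%N = W k ++ t.
  elim: j => [|j [t IH]]; first by exists [::]; rewrite addn0 cats0.
  by rewrite addnS /= IH -catA; eexists.
have nthW k l i : (i < size (W k))%N -> (i < size (W l))%N -> nth a (W k) i = nth a (W l) i.
  wlog kl : k l / (k <= l)%N.
    by move=> h; case: (leqP k l) => [|/ltnW] kl ik il; [exact: h|apply/esym/h].
  by move=> ik _; have [t] := WS k (l - k)%N; rewrite subnKC// => ->; rewrite nth_cat ik.
have [K K0 hK] := wlen_word_prod (letter_kappa kappa) S_gen.
have big n : exists k, (n < size (W k))%N.
  have [k hk] := u_unb (K * n + wl (u 0%N) + 1)%N; exists k.
  have := hK (W k); rewrite kWE; have := wlenM S_gen (u 0%N) ((u 0%N)^-1 * u k)%g.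
  rewrite mulVKg => h1 h2; rewrite ltnNge; apply/negP => h3.
  have h4 : (K * size (W k) <= K * n)%N by rewrite leq_mul2l h3 orbT.
  move: hk h1 h2 h4; set p := (K * n)%N; set q := (K * size _)%N; lia.
have [kk hkk] := choice big.
pose z i := nth a (W (kk i)) i.
have zP : z \in tmc adm.
  apply/mem_set => i; rewrite /z.
  have i1 : (i < size (W (kk i.+1)))%N by apply: ltn_trans (hkk i.+1).
  rewrite (nthW (kk i) (kk i.+1) i)//.
  have /sortedP : sorted adm (W (kk i.+1)) by have [/sorted_rconsl] := lW (kk i.+1).
  by move=> /(_ a i); apply; exact: hkk.
pose x : Sigma := exist _ z zP; exists x, D0.
have takeW k n : (n <= size (W k))%N -> mkseq (letter x) n = take n (W k).
  move=> nk; apply: (@eq_from_nth _ a); first by rewrite size_mkseq size_takel.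
  move=> i; rewrite size_mkseq => ni; rewrite nth_mkseq// nth_take//.
  by apply: nthW => //; exact: leq_trans nk.
move=> k; exists (size (W k)) => n kn.
have mono i j : (i <= j)%N -> (size (W i) <= size (W j))%N.
  by move=> ij; have [t] := WS i (j - i)%N; rewrite subnKC// => ->; rewrite size_cat leq_addr.
have [l hl] := big n.
(* The block of [n] is the last one starting at or before [n]. Loops may be empty, and the maximum
   selects a nonempty block. *)
pose Q j := (size (W j) <= n)%N.
have exQ : exists j, Q j by exists k.
have ubQ j : Q j -> (j <= l)%N.
  by move=> Qj; rewrite leqNgt; apply/negP => /ltnW /mono; move: Qj hl; rewrite /Q; lia.
case: (ex_maxnP exQ ubQ) => j Qj jmax.
have nj : (n < size (W j.+1))%N.
  by rewrite ltnNge; apply/negP => /jmax; rewrite ltnn.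
have [_ _ /(_ (n - size (W j))%N) [y [gy hy]]] := hV ((u j)^-1 * u j.+1)%g.
exists j, y; split=> //; first exact: jmax.
rewrite kappa_nE// (takeW j.+1)//; last exact: ltnW.
rewrite /= take_cat ltnNge (Qj : (_ <= _)%N) /= word_prod_cat kWE.
set t := kw _ in hy *.
have -> : ((u j * y)^-1 * (u 0%N * ((u 0%N)^-1 * u j * t)) = y^-1 * t)%g.
  by rewrite invgM -!mulgA mulVKg mulKg.
exact: hy.
Qed.

(** By the triangle inequality, a point on a geodesic from [u j] to [u j.+1] has with [u j.+1] at
    least the product of the two ends. Hence the orbit follows [u], and the distance [D0] shifts
    products by a constant only. *)
Lemma boundary_coding (eta : set (nat -> G)) : boundary (R := R) S eta ->
  exists (x : Sigma) (g : G), eta (fun n => (g * kappa_n kappa n x)%g).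
Proof.
move=> deta; have [u eu] := bdry_nonempty deta; have cu := bdry_conv deta eu.
have cuP := (converges_at_infinityP u).1 cu.
have [|x [D0 hx]] := @code_path u.
  move=> M; have [N hN] := cuP M%:R; exists N.
  by rewrite -(ler_nat R) -(wdist1 S_gen) -gprodxx; exact: hN.
exists x, (u 0%N); set z := fun n => _.
have close M : exists N, forall m n, (N <= m)%N -> (N <= n)%N -> M <= gp (u m) (z n).
  have [k hk] := cuP (M + D0%:R + delta); have [N hN] := hx k.
  exists (k + N)%N => m n km kn.
  have [|j [y [kj gy hy]]] := hN n; first by lia.
  have a1 : M + D0%:R + delta <= gp (u m) (u j.+1) by apply: hk; lia.
  have a2 : M + D0%:R + delta <= gp (u j.+1) (u j * y)%g.
    apply: le_trans (hk j.+1 j _ _) _; [by lia|by lia|].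
    have gE : wdist S (u j) (u j.+1) = wdist S (u j) (u j * y)%g + wdist S (u j * y)%g (u j.+1) :> R.
      move: gy; rewrite /on_geodesic /wdist mulKg invgM -mulgA => ->.
      by rewrite natrD.
    have := wdist_tri (R := R) S_gen (u j) (u j * y)%g 1%g.
    have dC := wdistC (R := R) S_gen.
    by rewrite /gprod; move: gE (dC (u j.+1) (u j)) (dC (u j.+1) (u j * y)%g); lra.
  have a3 := hyper G_hyp a1 a2.
  have dy : wdist S (u j * y)%g (z n) <= D0%:R :> R by rewrite /wdist ler_nat.
  have := gprod_shift (R := R) S_gen 1%g (u j * y)%g (z n) (u m).
  rewrite (gprodC S_gen _ _ (u m)) (gprodC S_gen _ _ (u m)); lra.
apply: (bdry_mem S_gen delta_gt0 G_hyp deta eu).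
  apply/converges_at_infinityP => M; have [N hN] := close (M + delta).
  exists N => m n Nm Nn; rewrite -[M](addrK delta).
  apply: (hyper G_hyp (y := u N)); last exact: hN.
  by rewrite (gprodC S_gen); exact: hN.
by move=> M; have [N hN] := close M; exists N => n Nn; exact: hN.
Qed.

End Coding.

(** * Dominated convergence and continuity of Hölder maps *)

Lemma cvg_sum_seq (R : realType) (T : Type) (a : nat -> T -> R) (l : T -> R) (s : seq T) :
  (forall t, a n t @[n --> \oo] --> l t) ->
  \sum_(t <- s) a n t @[n --> \oo] --> \sum_(t <- s) l t.
Proof.
move=> al; elim: s => [|t s IH].
  rewrite big_nil; under eq_fun do rewrite big_nil; exact: cvg_cst.
rewrite big_cons; under eq_fun do rewrite big_cons; exact: cvgD.
Qed.

(** A finite set carries all but [e / 2] of the sum of [M], uniformly in [n], and on it the sums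
    converge termwise. *)
Lemma esum_dominated (R : realType) (T : choiceType) (a : nat -> T -> R) (l M : T -> R) :
  (forall n t, 0 <= a n t <= M t) -> (forall t, a n t @[n --> \oo] --> l t) ->
  (\esum_(t in [set: T]) (M t)%:E < +oo)%E ->
  limn (fun n => \esum_(t in [set: T]) (a n t)%:E)%E = (\esum_(t in [set: T]) (l t)%:E)%E.
Proof.
move=> aM al Mfin.
have a0 n t : 0 <= a n t by have /andP[] := aM n t.
have a1 n t : a n t <= M t by have /andP[] := aM n t.
have M0 t : 0 <= M t := le_trans (a0 0%N t) (a1 0%N t).
have l0 t : 0 <= l t by apply: (cvgr_to_ge (al t)); apply: nearW => n.
have l1 t : l t <= M t by apply: (cvgr_to_le (al t)); apply: nearW => n.
pose E (b : T -> R) := (\esum_(t in [set: T]) (b t)%:E)%E.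
have Efin b : (forall t, 0 <= b t) -> (forall t, b t <= M t) -> E b \is a fin_num.
  move=> b0 b1; rewrite ge0_fin_numE; last by apply: esum_ge0 => t _; rewrite lee_fin.
  by apply: le_lt_trans Mfin; apply: le_esum => t _; rewrite lee_fin.
have split_ (X : set T) b : finite_set X -> (forall t, 0 <= b t) -> (forall t, b t <= M t) ->
    forall e, (\esum_(t in [set: T] `\` X) (M t)%:E <= e%:E)%E ->
    \sum_(t <- fset_set X) b t <= fine (E b) <= \sum_(t <- fset_set X) b t + e.
  move=> finX b0 b1 e he.
  have EE : E b = ((\sum_(t <- fset_set X) b t)%:E + \esum_(t in [set: T] `\` X) (b t)%:E)%E.
    rewrite /E (esumID X) => [|t _]; last by rewrite lee_fin.
    rewrite setTI -setDE esum_fset//; last by move=> t _; rewrite lee_fin.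
    by rewrite fsbig_finite//= sumEFin.
  have t0 : (0 <= \esum_(t in [set: T] `\` X) (b t)%:E)%E by apply: esum_ge0 => t _; rewrite lee_fin.
  have t1 : (\esum_(t in [set: T] `\` X) (b t)%:E <= e%:E)%E.
    by apply: le_trans he; apply: le_esum => t _; rewrite lee_fin.
  move: (Efin b b0 b1) EE t0 t1; case: (E b) => [x| |]//= _.
  case: (esum _ _) => [y| |]//= [->]; rewrite !lee_fin => y0 y1; lra.
apply/cvg_lim => //.
rewrite -/(E l) -(fineK (Efin l l0 l1)); apply: cvg_EFin.
  by apply: nearW => n; exact: Efin.
apply/cvgrPdist_lt => e e0; have e2 : 0 < e / 2 by lra.
have [|X finX hX] := esum_tail e2 _ Mfin; first by move=> t _; rewrite lee_fin.
have := cvg_sum_seq (s := fset_set X) al => /cvgrPdist_lt /(_ _ e2).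
apply: filterS => n; have := split_ X _ finX (a0 n) (a1 n) _ hX.
have := split_ X _ finX l0 l1 _ hX => /=.
rewrite -/(E (a n)); set x := fine (E l); set y := fine _.
set p := \sum_(t <- _) l t; set q := \sum_(t <- _) a n t.
by move=> /andP[h1 h2] /andP[h3 h4]; rewrite !ltr_norml => /andP[h5 h6]; apply/andP; split; lra.
Qed.

Lemma holder_continuous (R : realType) (X Y : Type) (D : set X) (dX : X -> X -> R)
    (dY : Y -> Y -> R) (f : X -> Y) (a : R) : 0 < a -> (forall x y, D x -> D y -> 0 <= dX x y) ->
  holder D dX dY a f -> dist_continuous D dX dY f.
Proof.
move=> a0 dX0 [K K0 h] x Dx e e0; exists ((e / K) `^ a^-1).
  by rewrite powR_gt0// divr_gt0.
move=> y Dy dxy; apply: le_lt_trans (h x y Dx Dy) _.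
rewrite mulrC -ltr_pdivlMr//.
have -> : e / K = ((e / K) `^ a^-1) `^ a.
  by rewrite -powRrM mulVf ?gt_eqF// powRr1// ltW// divr_gt0.
by apply: gt0_ltr_powR; rewrite ?nnegrE ?powR_ge0// dX0.
Qed.

(** * The Martin metric *)

Section Martin.
Variables (R : realType) (A : finType) (adm : rel A) (x0 : tmc adm).
Local Notation Sigma := (Sigma x0).
Variables (phi : seq A -> Sigma -> R) (G : groupType) (kappa : Sigma -> G).
Hypothesis kappa_loc : forall x y : Sigma, letter x 0%N = letter y 0%N -> kappa x = kappa y.
Hypothesis T_trans : transitive_ext kappa.
Variables (S : seq G) (S_gen : sym_generating S).
Variables (delta : R) (delta_gt0 : 0 < delta) (G_hyp : hyperbolic S delta).
Variables (lam r : R) (lam_bnd : 0 < lam < 1).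
Local Notation wl := (wlen S).
Local Notation gp := (@gprod R G S 1%g).
Local Notation logK h p := (ln (martinK phi kappa r h p)).
Local Notation T := (extension kappa).
Local Notation dG := (boundary (R := R) S).
Local Notation mpts := (martin_pts phi kappa r).
Local Notation mclass := (martin_class phi kappa r).
Implicit Types (p q : Sigma * G).

Hypothesis K_gt0 : forall h p, 0 < martinK phi kappa r h p.
Variables (bK : R) (dK : R).
Hypothesis bK_ge1 : 1 <= bK.
Hypothesis lnK_le : forall h p, `|logK h p| <= bK * (1 + (wl h)%:R).
Hypothesis dK_gt0 : 0 < dK.
Hypothesis lnK_close : forall h p p' N, N <= gp p.2 p'.2 ->
  `|logK h p - logK h p'| <= dK * (1 + (wl h)%:R) * lam `^ (N - (wl h)%:R).

Definition trace p (n : nat) : G := (p.2 * kappa_n kappa n p.1)%g.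

Lemma traceE p n : (iter n T p).2 = trace p n.
Proof. by rewrite iter_extension. Qed.

Let lam_gt0 : 0 < lam. Proof. by case/andP: lam_bnd. Qed.

Lemma lnK_small h e : 0 < e -> exists M : R, forall p p', M <= gp p.2 p'.2 ->
  `|logK h p - logK h p'| < e.
Proof.
move=> e0; have /andP[_ l1] := lam_bnd; pose c := dK * (1 + (wl h)%:R).
have c0 : 0 < c by rewrite mulr_gt0// ltr_pwDl.
have ln0 : ln lam < 0 by rewrite ln_lt0// lam_gt0.
pose t := ln (e / (2 * c)) / ln lam.
exists (t + (wl h)%:R) => p p' /lnK_close /le_lt_trans; apply.
rewrite addrK -/c /powR gt_eqF// /t divfK ?lt_eqF// lnK ?posrE ?divr_gt0 ?mulr_gt0//.
rewrite [ltLHS](_ : _ = e / 2); last by field; rewrite gt_eqF.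
by lra.
Qed.

Lemma orbitK_gt0 h p n : 0 < orbitK phi kappa r h p n.
Proof. exact: K_gt0. Qed.

(** Growing products along the orbit make the logarithms of the kernels Cauchy; continuity of the
    exponential then gives convergence of the kernels. *)
Lemma conv_martin_pts p : converges_at_infinity (R := R) S (trace p) -> mpts p.
Proof.
move=> /converges_at_infinityP cv; split.
  move=> F finF.
  pose M := (\max_(g <- fset_set F) wl (p.2 * g)%g).+1.
  have [N hN] := cv M%:R; exists N => // n /= Nn Fn.
  have := hN n n Nn Nn; rewrite gprodxx wdist1// ler_nat /trace leqNgt ltnS => /negP; apply.
  apply: (leq_bigmax_seq (F := fun g => wl (p.2 * g)%g)) => //.
  by rewrite in_fset_set// inE.
move=> h; have clt e : 0 < e -> exists N, forall m n, (N <= m)%N -> (N <= n)%N ->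
    `|logK h (iter m T p) - logK h (iter n T p)| < e.
  move=> /(lnK_small h) [M hM]; have [N hN] := cv M; exists N => m n Nm Nn.
  by apply: hM; rewrite !traceE; exact: hN.
have : cvgn (fun n => logK h (iter n T p)).
  apply/cauchy_cvgP/cauchy_exP => e e0; have [N hN] := clt e e0.
  exists (logK h (iter N T p)); exists N => // n /= Nn.
  exact: hN.
move=> /cvg_ex[l hl]; apply/cvg_ex; exists (expR l).
have := cvg_comp _ _ hl (@continuous_expR R l).
apply: cvg_trans; apply: near_eq_cvg; apply: nearW => n /=.
by rewrite lnK ?posrE.
Qed.

Definition limK h p : R := ln (limn (orbitK phi kappa r h p)).

Lemma lim_orbitK_gt0 h p : mpts p -> 0 < limn (orbitK phi kappa r h p).
Proof.
move=> [_ /(_ h) cv].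
apply: (@lt_le_trans _ _ (expR (- (bK * (1 + (wl h)%:R))))); first exact: expR_gt0.
apply: limr_ge => //; apply: nearW => n.
rewrite -[leRHS]lnK ?posrE ?orbitK_gt0// ler_expR lerNl.
by have := lnK_le h (iter n T p); rewrite ler_norml => /andP[]; rewrite lerNl.
Qed.

Lemma cvg_lnK h p : mpts p -> logK h (iter n T p) @[n --> \oo] --> limK h p.
Proof.
by move=> mp; exact: (cvg_comp _ _ (mp.2 h) (continuous_ln (lim_orbitK_gt0 h mp))).
Qed.

Lemma limK_lim h p q : mpts p -> mpts q -> limK h p = limK h q ->
  limn (orbitK phi kappa r h p) = limn (orbitK phi kappa r h q).
Proof.
move=> mp mq e.
exact: (ln_inj (lim_orbitK_gt0 h mp : _ \is Num.pos) (lim_orbitK_gt0 h mq : _ \is Num.pos) e).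
Qed.

Lemma martin_class_limK p q : mpts p -> mclass p q -> mpts q /\ forall h, limK h q = limK h p.
Proof. by move=> mp [mq e]; split; [exact: mq|move=> h; rewrite /limK (e h)]. Qed.

Lemma limK_diff_le h p q N : mpts p -> mpts q ->
  (exists n0, forall n, (n0 <= n)%N -> N <= gp (trace p n) (trace q n)) ->
  `|limK h p - limK h q| <= dK * (1 + (wl h)%:R) * lam `^ (N - (wl h)%:R).
Proof.
move=> mp mq [n0 hn0].
apply: (cvgr_to_le (cvg_norm (cvgB (cvg_lnK (h := h) mp) (cvg_lnK (h := h) mq)))).
exists n0; [by []|move=> n /= nn].
by apply: lnK_close; rewrite !traceE; exact: hn0.
Qed.

(** Both limits exist beforehand, so closeness along the times [iota] is enough. This serves orbits
    of which only a subsequence is known to converge. *)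
Lemma limK_eq p q (iota : nat -> nat) : mpts p -> mpts q -> (forall k, (k <= iota k)%N) ->
  (forall M : R, exists N, forall k, (N <= k)%N -> M <= gp (trace p (iota k)) (trace q k)) ->
  forall h, limK h p = limK h q.
Proof.
move=> mp mq iotak close h; apply/eqP; rewrite -subr_eq0 -normr_le0; apply/ler_addgt0Pr => e e0.
rewrite add0r; have io : iota @ \oo --> \oo.
  move=> P [N _ hN]; exists N => // k /= Nk; apply: hN => /=; exact: leq_trans (iotak k).
apply: (cvgr_to_le (cvg_norm (cvgB (cvg_comp _ _ io (cvg_lnK (h := h) mp)) (cvg_lnK (h := h) mq)))).
have [M hM] := lnK_small h e0; have [N hN] := close M.
by exists N => // k /= Nk; apply: ltW; apply: hM; rewrite !traceE; exact: hN.
Qed.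

Lemma mclass_eq p q : mpts p -> mpts q -> (forall h, limK h p = limK h q) -> mclass p = mclass q.
Proof.
move=> mp mq e; have e' h := limK_lim mp mq (e h).
apply/seteqP; split=> z [mz hz]; (split; first exact: mz) => h.
  by rewrite -(hz h) (e' h).
by rewrite -(hz h) -(e' h).
Qed.

(** Points whose orbits tend to [eta] all have the same limit kernels, so the union in [Xi] is a
    single class. *)
Lemma XiE eta p : dG eta -> eta (trace p) -> mpts p /\ Xi phi kappa r eta = mclass p.
Proof.
move=> de ep; have mp : mpts p := conv_martin_pts (bdry_conv de ep); split=> //.
apply/seteqP; split=> [q [p' [mp' ep' cq]]|q cq]; last by exists p.
rewrite (mclass_eq (q := p') mp mp'); first exact: cq.
move=> h; apply: (limK_eq (iota := id) mp mp'); [by []|move=> M].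
by have [N hN] := bdry_joint S_gen delta_gt0 G_hyp de ep ep' M; exists N => k Nk; exact: hN.
Qed.

Lemma boundary_point eta : dG eta -> exists p, eta (trace p).
Proof.
move=> /(boundary_coding kappa_loc T_trans S_gen delta_gt0 G_hyp (letter (x0 : Sigma) 0%N)) [x [g h]].
by exists (x, g).
Qed.

(** Only a subsequence of the orbit of [p] is known to tend to [eta]. A coded point [q] has a full
    orbit tending to [eta], and comparison along the subsequence puts [p] and [q] into one class. *)
Lemma Xi_surj P : martin_boundary phi kappa r P -> exists2 eta, dG eta & Xi phi kappa r eta = P.
Proof.
move=> [p mp ->].
have esc F : finite_set F -> \forall n \near \oo, ~ F (trace p n).
  move=> finF; have /(mp.1) : finite_set ((fun g => (p.2^-1 * g)%g) @` F) by exact: finite_image.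
  by apply: filterS => n h Fn; apply: h; exists (trace p n) => //; rewrite /trace mulKg.
have [iota [iotak cv]] := convergent_subsequence S_gen G_hyp esc.
set eta : set (nat -> G) := [set v | converges_at_infinity (R := R) S v /\
  same_limit (R := R) S (trace p \o iota) v].
have de : dG eta by exact: conv_bdry.
have ep : eta (trace p \o iota).
  split=> //; apply/same_limitP => M.
  by have [N hN] := (converges_at_infinityP _).1 cv M; exists N => n nN; exact: hN.
have [q eq_] := boundary_point de; have [mq XE] := XiE de eq_.
exists eta; [exact: de|rewrite XE; apply: esym; apply: (mclass_eq mp mq) => h].
apply: (limK_eq (iota := iota) mp mq iotak) => M; have [N hN] := bdry_joint S_gen delta_gt0 G_hyp de ep eq_ M.
by exists N => k Nk; exact: hN.
Qed.

Variable cw : R.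
Hypothesis cw_gt0 : 0 < cw.
Local Notation c_ h := (martin_coef phi kappa S lam r h).
Hypothesis coef_le : forall h, 0 <= c_ h <= lam ^+ (2 * wl h) / (cw * (sphere_card S (wl h))%:R).

Let geo := (1 - lam)^-1 ^+ 2.

(** One of the two factors [lam ^+ wl h] in [c_h] cancels the division by [lam ^+ wl h] that comes
    from the kernel estimate; the other is left for convergence. *)
Lemma coef_weighted_le h : c_ h * ((1 + (wl h)%:R) / lam ^+ wl h) <=
  cw^-1 * (lam ^+ wl h * (1 + (wl h)%:R) / (sphere_card S (wl h))%:R).
Proof.
have /andP[_ h2] := coef_le h; have l0 : 0 < lam ^+ wl h by rewrite exprn_gt0.
have w0 : 0 <= (1 + (wl h)%:R) / lam ^+ wl h :> R by apply: divr_ge0; [rewrite addr_ge0|exact: ltW].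
apply: le_trans (ler_wpM2r w0 h2) _; rewrite mul2n -addnn exprD invfM.
rewrite le_eqVlt; apply/orP; left; apply/eqP; field.
by rewrite !gt_eqF// ltr0n sphere_card_gt0.
Qed.

Lemma esum_coef (b : R) : 0 <= b ->
  (\esum_(h in [set: G]) (b * (c_ h * ((1 + (wl h)%:R) / lam ^+ wl h)))%:E <= (b * (cw^-1 * geo))%:E)%E.
Proof.
move=> b0; apply: (@le_trans _ _ (\esum_(h in [set: G])
   ((b * (cw^-1 * (lam ^+ wl h * (1 + (wl h)%:R)))) / (sphere_card S (wl h))%:R)%:E)).
  apply: le_esum => h _; rewrite lee_fin; apply: le_trans (ler_wpM2l b0 (coef_weighted_le h)) _.
  by rewrite !mulrA.
apply: (esum_sphere S_gen (u := fun k => b * (cw^-1 * (lam ^+ k * (1 + k%:R))))) => [k|n].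
  apply: mulr_ge0; first exact: b0.
  apply: mulr_ge0; first by rewrite invr_ge0 ltW.
  by apply: mulr_ge0; [rewrite exprn_ge0// ltW|rewrite addr_ge0].
rewrite -!mulr_sumr; do 2 (apply: ler_wpM2l; rewrite ?invr_ge0 ?(ltW cw_gt0)//).
exact: sum_arith_geom.
Qed.

Let bK2 : 0 <= 2 * bK. Proof. by rewrite mulr_ge0// (le_trans ler01). Qed.

Lemma one_le_weight h : 1 + (wl h)%:R <= (1 + (wl h)%:R) / lam ^+ wl h.
Proof.
have /andP[l0 l1] := lam_bnd.
by rewrite ler_pdivlMr ?exprn_gt0// ger_pMr ?ltr_pwDl// exprn_ile1// ltW.
Qed.

(** Limit and sum are exchanged; [lnK_le] provides a summable bound that is uniform in [n]. *)
Lemma dMartin_ptsE p q : mpts p -> mpts q -> dMartin_pts phi kappa S lam r p q =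
  fine (\esum_(h in [set: G]) (c_ h * `|limK h p - limK h q|)%:E)%E.
Proof.
move=> mp mq; rewrite /dMartin_pts; congr fine.
pose M h := 2 * bK * (c_ h * ((1 + (wl h)%:R) / lam ^+ wl h)).
apply: (esum_dominated (M := M)) => [n h|h|].
- have /andP[c0 _] := coef_le h; rewrite mulr_ge0//=.
  rewrite /M mulrCA ler_wpM2l//; apply: le_trans (ler_normB _ _) _.
  apply: (@le_trans _ _ (2 * bK * (1 + (wl h)%:R))).
    apply: le_trans (lerD (lnK_le h _) (lnK_le h _)) _.
    by rewrite le_eqVlt; apply/orP; left; apply/eqP; ring.
  by apply: ler_wpM2l; [exact: bK2|exact: one_le_weight].
- apply: cvgM; first exact: cvg_cst.
  exact: (cvg_norm (cvgB (cvg_lnK (h := h) mp) (cvg_lnK (h := h) mq))).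
- exact: le_lt_trans (esum_coef bK2) (ltry _).
Qed.

Lemma class_reprP p : mpts p -> mclass p (class_repr (mclass p)).
Proof. by move=> mp; rewrite /class_repr; case: xgetP => [z _ //|/(_ p)] h; case: h. Qed.

Lemma dMartinE p q : mpts p -> mpts q ->
  dMartin phi kappa S lam r (mclass p) (mclass q) =
  fine (\esum_(h in [set: G]) (c_ h * `|limK h p - limK h q|)%:E)%E.
Proof.
move=> mp mq; have [mp' ep] := martin_class_limK mp (class_reprP mp).
have [mq' eq_] := martin_class_limK mq (class_reprP mq).
rewrite /dMartin (dMartin_ptsE mp' mq').
have ep' := funext ep; have eq' := funext eq_.
exact: (congr2 (fun a b : G -> R => fine (\esum_(h in [set: G]) (c_ h * `|a h - b h|)%:E)%E) ep' eq').
Qed.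

Lemma dMartin_ge0 P Q : martin_boundary phi kappa r P -> martin_boundary phi kappa r Q ->
  0 <= dMartin phi kappa S lam r P Q.
Proof.
move=> [p mp ->] [q mq ->]; rewrite (dMartinE mp mq); apply/fine_ge0/esum_ge0 => h _.
by have /andP[c0 _] := coef_le h; rewrite lee_fin mulr_ge0.
Qed.

Lemma dMartin_self p : mpts p -> dMartin phi kappa S lam r (mclass p) (mclass p) = 0.
Proof.
move=> mp; rewrite (dMartinE mp mp) esum1; first by [].
by move=> h _; rewrite subrr normr0 mulr0.
Qed.

Lemma limK_diff_bound h p q :  mpts p -> mpts q -> `|limK h p - limK h q| <= 2 * bK * (1 + (wl h)%:R).
Proof.
move=> mp mq.
apply: (cvgr_to_le (cvg_norm (cvgB (cvg_lnK (h := h) mp) (cvg_lnK (h := h) mq)))).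
apply: nearW => n; apply: le_trans (ler_normB _ _) _.
apply: le_trans (lerD (lnK_le h _) (lnK_le h _)) _.
by rewrite le_eqVlt; apply/orP; left; apply/eqP; ring.
Qed.

Lemma dMartin_upper p q N : mpts p -> mpts q ->
  (exists n0, forall n, (n0 <= n)%N -> N <= gp (trace p n) (trace q n)) ->
  dMartin phi kappa S lam r (mclass p) (mclass q) <= dK * (cw^-1 * geo) * lam `^ N.
Proof.
move=> mp mq close; rewrite (dMartinE mp mq).
have b0 : 0 <= dK * lam `^ N by rewrite mulr_ge0 ?powR_ge0// ltW.
have E0 : (0 <= \esum_(h in [set: G]) (c_ h * `|limK h p - limK h q|)%:E)%E.
  by apply: esum_ge0 => h _; have /andP[c0 _] := coef_le h; rewrite lee_fin mulr_ge0.
have E1 : (\esum_(h in [set: G]) (c_ h * `|limK h p - limK h q|)%:E <=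
    (dK * lam `^ N * (cw^-1 * geo))%:E)%E.
  apply: le_trans (esum_coef b0); apply: le_esum => h _; rewrite lee_fin.
  have /andP[c0 _] := coef_le h; rewrite [leRHS]mulrCA; apply: ler_wpM2l => //.
  apply: le_trans (limK_diff_le h mp mq close) _.
  rewrite powRB; last by rewrite (gt_eqF lam_gt0) implybT.
  rewrite powR_mulrn; last exact: ltW.
  by rewrite le_eqVlt; apply/orP; left; apply/eqP; ring.
rewrite -lee_fin fineK; first by rewrite mulrAC.
by rewrite ge0_fin_numE//; apply: le_lt_trans E1 (ltry _).
Qed.

Lemma dMartin_lower p q h : mpts p -> mpts q -> 1 <= `|limK h p - limK h q| ->
  c_ h <= dMartin phi kappa S lam r (mclass p) (mclass q).
Proof.
move=> mp mq gap; rewrite (dMartinE mp mq).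
pose a h := c_ h * `|limK h p - limK h q|.
have a0 k : 0 <= a k.
  by have /andP[c0 _] := coef_le k; apply: mulr_ge0; [exact: c0|exact: normr_ge0].
have Efin : (\esum_(h in [set: G]) (a h)%:E)%E \is a fin_num.
  rewrite ge0_fin_numE; last by apply: esum_ge0 => k _; rewrite lee_fin.
  apply: le_lt_trans (ltry (2 * bK * (cw^-1 * geo))).
  apply: le_trans (esum_coef bK2).
  apply: le_esum => k _; rewrite lee_fin /a mulrCA; have /andP[c0 _] := coef_le k.
  apply: ler_wpM2l; [exact: c0|apply: le_trans (limK_diff_bound k mp mq) _].
  by apply: ler_wpM2l; [exact: bK2|exact: one_le_weight].
have /andP[c0 _] := coef_le h.
rewrite -lee_fin (fineK Efin); apply: (@le_trans _ _ (a h)%:E).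
  by rewrite lee_fin /a -[leLHS]mulr1; apply: ler_wpM2l; [exact: c0|exact: gap].
rewrite -(esum_set1 (a := fun k => (a k)%:E)); last by rewrite lee_fin; exact: a0.
exact: esum_subset.
Qed.

End Martin.

(** A boundary point makes spheres of all radii nonempty, so that [growth] is controlled. *)
Lemma unbounded_boundary (R : realType) (G : groupType) (S : seq G) (eta : set (nat -> G)) :
  sym_generating S -> boundary (R := R) S eta -> forall n, exists g, wlen S g = n.
Proof.
move=> S_gen de n; have [u eu] := bdry_nonempty de.
have [N hN] := (converges_at_infinityP u).1 (bdry_conv de eu) n%:R.
have := hN N N (leqnn _) (leqnn _); rewrite gprodxx wdist1// ler_nat => nle.
by have [g wg _] := geodesic_point (R := R) S_gen _ _ nle; exists g.
Qed.

(** * Separation of boundary points and bounds on the coefficients *)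

Section Gap.
Variables (R : realType) (A : finType) (adm : rel A) (x0 : tmc adm).
Local Notation Sigma := (Sigma x0).
Variables (phi : seq A -> Sigma -> R) (G : groupType) (kappa : Sigma -> G).
Variables (S : seq G) (S_gen : sym_generating S).
Variables (delta : R) (delta_gt0 : 0 < delta) (G_hyp : hyperbolic S delta).
Variable r : R.
Local Notation wl := (wlen S).
Local Notation gp := (@gprod R G S).
Local Notation logK h p := (ln (martinK phi kappa r h p)).
Local Notation dG := (boundary (R := R) S).
Local Notation mpts := (martin_pts phi kappa r).
Local Notation limK h p := (limK phi kappa r h p).
Local Notation trace := (trace kappa).

Hypothesis cvg_logK : forall h p, mpts p ->
  logK h (iter n (extension kappa) p) @[n --> \oo] --> limK h p.
Hypothesis gap : forall c : R, exists L : nat, forall h p u v (x y : Sigma),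
  gp h 1%g u <= c -> gp p 1%g v <= c -> gp p h v <= c -> gp p 1%g h <= c ->
  (L <= wl (p^-1 * h)%g)%N -> 1 <= logK h (x, u) - logK h (y, v).

(** [pp] approximates the point where the ways to [s] and [t] part, and [h] lies [L0] further
    towards [s]. The products are estimated at late times of both orbits, and the gap passes to the
    limit. *)
Lemma limK_gap : exists L0 : nat, forall s t p q, dG s -> dG t -> s <> t ->
  mpts p -> mpts q -> s (trace p) -> t (trace q) ->
  exists h, (wl h)%:R <= fine (bdry_gprod (R := R) S s t) + L0%:R /\ 1 <= `|limK h p - limK h q|.
Proof.
(* The largest product to be bounded is that of [h] and [v] at [pp]: the bounds [hv] and [pv] leave
   [N - k + 2 + 7 * delta], and [N < k + 1]. *)
have [L hL] := gap (3 + 7 * delta).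
(* [L] is the distance required by [gap]. The summand [2 + 4 * delta] raises the product of [h] and
   [u] to at least [N + 1 + 3 * delta], so that an equally large product of [h] and [v] would
   contradict [uv2]. *)
pose L0 := (L + Num.trunc (2 + 4 * delta)).+1.
have L0R : 2 + 4 * delta <= L0%:R.
  apply: (@le_trans _ _ (Num.trunc (2 + 4 * delta)).+1%:R); first exact/ltW/truncnS_gt.
  by rewrite ler_nat /L0 ltnS leq_addl.
exists L0 => s t p q ds dt st mp mq sp tq.
have bfin : bdry_gprod (R := R) S s t \is a fin_num.
  rewrite ge0_fin_numE ?bdry_gprod_ge0// lt_neqAle leey andbT; apply/eqP => E.
  by apply: st; apply: (bdry_gprod_inf S_gen delta_gt0 G_hyp ds dt E).
set N := fine _; have bE : bdry_gprod (R := R) S s t = N%:E by rewrite fineK.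
have N0 : 0 <= N by rewrite fine_ge0// bdry_gprod_ge0.
have [n1 h1] : exists n, forall m k, (n <= m)%N -> (n <= k)%N ->
    N - 1 - 2 * delta <= gp 1%g (trace p m) (trace q k).
  by apply: (bdry_gprod_lower S_gen delta_gt0 G_hyp ds dt sp tq); rewrite bE lte_fin; lra.
have [n2 h2] : exists n, forall m k, (n <= m)%N -> (n <= k)%N ->
    gp 1%g (trace p m) (trace q k) < N + 1 + 2 * delta.
  by apply: (bdry_gprod_upper S_gen delta_gt0 G_hyp ds dt sp tq); rewrite bE lte_fin; lra.
pose k := Num.trunc N; have := truncn_itv N0; rewrite -/k -natr1 => /andP[k1 k2].
pose M := (k + L0)%N.
have [n3 h3] := bdry_joint S_gen delta_gt0 G_hyp ds sp sp M%:R.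
pose n0 := (n1 + n2 + n3)%N.
have Mle : (M <= wl (trace p n0))%N.
  by rewrite -(ler_nat R) -(wdist1 S_gen) -gprodxx; apply: h3; lia.
have [h wh [gh dh]] := geodesic_point (R := R) S_gen _ _ Mle.
have kM : (k <= wl h)%N by rewrite wh leq_addr.
have [pp wp [gpp dpp]] := geodesic_point (R := R) S_gen _ _ kM.
have MR : M%:R = k%:R + L0%:R :> R by rewrite natrD.
exists h; split; first by rewrite wh MR lerD2r.
suff : 1 <= limK h p - limK h q by move=> /le_trans; apply; exact: ler_norm.
apply: (cvgr_to_ge (cvgB (cvg_logK (h := h) mp) (cvg_logK (h := h) mq))).
exists n0; [by []|move=> n /= nn].
have it p' : iter n (extension kappa) p' = ((iter n (extension kappa) p').1, trace p' n).
  by rewrite -traceE; case: (iter _ _ _).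
suff : 1 <= logK h (iter n (extension kappa) p) - logK h (iter n (extension kappa) q) by apply.
rewrite (it p) (it q).
set u := trace p n; set v := trace q n.
have uv1 : N - 1 - 2 * delta <= gp 1%g u v by apply: h1; lia.
have uv2 : gp 1%g u v < N + 1 + 2 * delta by apply: h2; lia.
have dC := wdistC (R := R) S_gen; have gC := gprodC (R := R) S_gen 1%g.
have hy := hyper G_hyp.
have hu : M%:R - delta <= gp 1%g h u.
  by apply: (hy _ _ _ (trace p n0)); [rewrite gh|apply: h3; lia].
have pv : k%:R - 1 - 4 * delta <= gp 1%g pp v.
  have e1 : k%:R - delta <= gp 1%g pp u.
    by apply: (hy _ _ _ h); [rewrite gpp|move: hu; rewrite MR; lra].
  have e2 : k%:R - 1 - 2 * delta - delta <= gp 1%g pp v.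
    by apply: (hy _ _ _ u); [move: e1; lra|move: uv1; lra].
  by move: e2 delta_gt0; lra.
have hv : gp 1%g h v < N + 1 + 3 * delta.
  rewrite ltNge; apply/negP => hv.
  have : N + 1 + 3 * delta - delta <= gp 1%g u v.
    apply: (hy _ _ _ h) => //; rewrite gC; move: hu; rewrite MR; lra.
  by move: uv2; lra.
have w1 := wdist1 (R := R) S_gen.
have whR : (wl h)%:R = M%:R :> R by rewrite wh.
have wpR : (wl pp)%:R = k%:R :> R by rewrite wp.
have c1 : gp h 1%g u = (wl h)%:R - gp 1%g h u.
  by rewrite /gprod w1; move: (dC 1%g u) (dC u h) (dC 1%g h) (w1 h); lra.
have c2 : gp pp 1%g v = (wl pp)%:R - gp 1%g pp v.
  by rewrite /gprod w1; move: (dC 1%g v) (dC v pp) (dC 1%g pp) (w1 pp); lra.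
have c3 : gp pp h v = gp 1%g h v - gp 1%g pp v.
  by rewrite /gprod; move: (dC h pp) (dC v pp) dpp (w1 pp) (w1 h); rewrite wpR; lra.
have c4 : gp pp 1%g h = 0.
  by rewrite /gprod; move: (dC h pp) (dC 1%g pp) (dC 1%g h) dpp (w1 pp) (w1 h); rewrite wpR; lra.
apply: (hL h pp u v).
- by rewrite c1; move: delta_gt0; lra.
- by rewrite c2; move: delta_gt0; lra.
- by rewrite c3; move: delta_gt0; lra.
- by rewrite c4; move: delta_gt0; lra.
- rewrite -(ler_nat R); move: dpp; rewrite /wdist => ->; rewrite whR MR addrAC subrr add0r.
  by rewrite ler_nat /L0 -addnS leq_addr.
Qed.

Variables (f : G -> R) (lam bK : R) (lam_bnd : 0 < lam < 1).
Local Notation c_ h := (martin_coef phi kappa S lam r h).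
Hypothesis f_small : forall e, 0 < e -> exists n : nat, forall g, (n <= wl g)%N -> f g <= e.
Hypothesis Gr_gt0 : forall h p, 0 < greenR phi kappa r h p.
Hypothesis Gr_le : exists2 C, 0 < C & forall x h g, greenR phi kappa r h (x, g) <= C * f (h^-1 * g)%g.
Hypothesis bK_ge1 : 1 <= bK.
Hypothesis logK_le : forall h p, `|logK h p| <= bK * (1 + (wl h)%:R).

Let lw h : R := let l := ln (greenR phi kappa r h (x0 : Sigma, 1%g)) in if l == 0 then 1 else `|l|.

Let lw_gt0 h : 0 < lw h.
Proof. by rewrite /lw; case: eqP => // /eqP l0; rewrite normr_gt0. Qed.

Let coefE h : c_ h = lam ^+ (2 * wl h) / ((sphere_card S (wl h))%:R * lw h).
Proof. by []. Qed.

(** Outside a ball the Green function is at most [expR (- 1)], so its logarithm has modulus at least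
    1. In the ball the convention for vanishing logarithms keeps the finitely many factors positive,
    and [cw] is a lower bound for them. *)
Lemma coef_upper : exists2 cw, 0 < cw &
  forall h, 0 <= c_ h <= lam ^+ (2 * wl h) / (cw * (sphere_card S (wl h))%:R).
Proof.
have /andP[l0 l1] := lam_bnd; have [C C0 hC] := Gr_le.
have [|n hn] := f_small (e := expR (- 1) / C); first by rewrite divr_gt0// expR_gt0.
pose B := fset_set [set g | (wl g <= n)%N].
pose cw := (1 + \sum_(g <- B) (lw g)^-1)^-1.
have s0 : 0 <= \sum_(g <- B) (lw g)^-1 by rewrite sumr_ge0// => g _; rewrite invr_ge0 ltW.
have c0 : 0 < cw by rewrite invr_gt0 ltr_pwDl.
have cle h : cw <= lw h.
  have [hn'|nh] := leqP (wl h) n.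
    rewrite -[lw h]invrK lef_pV2 ?posrE ?ltr_pwDl ?invr_gt0//.
    have hB : h \in B by rewrite in_fset_set ?inE//; exact: finite_ball.
    rewrite (big_rem h hB)/= addrCA lerDl addr_ge0// sumr_ge0// => g _.
    by rewrite invr_ge0 ltW.
  apply: (@le_trans _ _ 1); first by rewrite /cw invf_le1 ?ltr_pwDl// lerDl.
  have : greenR phi kappa r h (x0 : Sigma, 1%g) <= expR (- 1).
    apply: le_trans (hC _ _ _) _; rewrite mulrC -ler_pdivlMr// mulg1; apply: hn.
    by rewrite wlenV// ltnW.
  rewrite /lw -ler_ln ?posrE ?expR_gt0// expRK => hl.
  case: eqP => [//|_]; rewrite ler0_norm; lra.
exists cw => // h; have sp := sphere_card_gt0 S_gen h; rewrite -(ltr0n R) in sp.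
have lp : 0 < lam ^+ (2 * wl h) by rewrite exprn_gt0.
rewrite coefE; apply/andP; split; first by rewrite ltW// divr_gt0// mulr_gt0.
rewrite ler_pM2l// lef_pV2 ?posrE ?mulr_gt0//.
by rewrite mulrC ler_pM2l.
Qed.

(** The logarithm of the Green function grows at most linearly in [|h|], which accounts for the
    factor [1 + |h|]. *)
Lemma coef_lower : exists2 aw, 0 < aw & forall h,
  lam ^+ (2 * wl h) / ((sphere_card S (wl h))%:R * (aw * (1 + (wl h)%:R))) <= c_ h.
Proof.
have /andP[l0 l1] := lam_bnd.
pose g1 := ln (greenR phi kappa r 1%g (x0 : Sigma, 1%g)).
have bg : 0 < bK + `|g1| by move: bK_ge1 (normr_ge0 g1); lra.
exists (bK + `|g1|); first exact: bg.
move=> h; have sp := sphere_card_gt0 S_gen h; rewrite -(ltr0n R) in sp.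
have w0 : 0 <= (wl h)%:R :> R by [].
have a0 : 0 < (bK + `|g1|) * (1 + (wl h)%:R).
  by apply: mulr_gt0; [exact: bg|lra].
have lp : 0 < lam ^+ (2 * wl h) by rewrite exprn_gt0.
rewrite coefE ler_pM2l// lef_pV2 ?posrE ?mulr_gt0// ler_pM2l//.
rewrite /lw; set l := ln _; case: eqP => _.
  rewrite -[leLHS]mulr1; apply: ler_pM => //; last by lra.
  by move: bK_ge1 (normr_ge0 g1); lra.
have lE : l = logK h (x0 : Sigma, 1%g) + g1.
  by rewrite /martinK ln_div ?posrE// subrK.
rewrite lE; apply: le_trans (ler_normD _ _) _; rewrite mulrDl; apply: lerD => //.
by rewrite -[leLHS]mulr1 ler_wpM2l//; lra.
Qed.

End Gap.

(** The change of base behind both exponents: powers of [lamv] become powers of [lam] for [alpha],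
    and of [lam ^+ 2 / (growth S + eps)] for [beta]. *)
Lemma powR_ln (R : realType) (v b N : R) : 0 < v < 1 -> 0 < b ->
  (v `^ N) `^ (ln b / ln v) = b `^ N.
Proof.
move=> /andP[v0 v1] b0; rewrite -powRrM /powR !gt_eqF//.
by rewrite -mulrA divfK// lt_eqF// ln_lt0// v0.
Qed.

Lemma linear_le_geometric (R : realType) (x : R) : 1 < x ->
  exists2 K, 0 < K & forall n : nat, 1 + n%:R <= K * x ^+ n.
Proof.
move=> x1; have y0 : 0 < x - 1 by lra.
exists (1 + (x - 1)^-1); first by rewrite addr_gt0// invr_gt0.
have bern (n : nat) : 1 + n%:R * (x - 1) <= x ^+ n.
  elim: n => [|n IH]; first by rewrite mul0r addr0 expr0.
  rewrite exprS -natr1; apply: (@le_trans _ _ (x * (1 + n%:R * (x - 1)))); last first.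
    by rewrite ler_pM2l//; lra.
  have n0 : 0 <= n%:R :> R by [].
  have : 0 <= n%:R * (x - 1) * (x - 1) by rewrite !mulr_ge0// ltW.
  lra.
move=> n; have h := bern n; have n0 : 0 <= n%:R :> R by [].
have xn : 1 <= x ^+ n by rewrite exprn_ege1// ltW.
rewrite mulrDl mul1r; apply: lerD => //.
by rewrite ler_pdivlMl// mulrC; lra.
Qed.

(** * Coefficients compared with powers of the Gromov product *)

Section GrowthWeight.
Variables (R : realType) (G : groupType) (S : seq G) (S_gen : sym_generating S).
Local Notation wl := (wlen S).
Hypothesis infG : forall n, exists g, wl g = n.
Variables (lam aw eps : R) (L0 : nat).
Hypotheses (lam_bnd : 0 < lam < 1) (aw_gt0 : 0 < aw) (eps_gt0 : 0 < eps).
Let b := lam ^+ 2 / (growth S + eps).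

Lemma growth_base : 0 < b < 1.
Proof.
have /andP[l0 l1] := lam_bnd; have g1 := growth_ge1 R S_gen infG.
have g0 : 0 < growth S + eps :> R by rewrite ltr_wpDl// (le_trans ler01).
rewrite /b divr_gt0// ?exprn_gt0//= ltr_pdivrMr// mul1r.
apply: (@lt_le_trans _ _ 1); first by rewrite exprn_ilt1// ltW.
by move: eps_gt0; lra.
Qed.

(** [eps] is spent in halves: powers of [growth S + eps / 2] bound the sphere sizes, and powers of
    the quotient of [growth S + eps] by it absorb the linear factor. Division by [b ^+ L0] allows
    [h] to lie [L0] beyond [N]. *)
Lemma growth_weight : exists2 K, 0 < K & forall h (N : R), (wl h)%:R <= N + L0%:R ->
  b `^ N <= K * (lam ^+ (2 * wl h) / ((sphere_card S (wl h))%:R * (aw * (1 + (wl h)%:R)))).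
Proof.
have /andP[b0 b1] := growth_base; have /andP[l0 l1] := lam_bnd.
have g1 : 1 <= growth S :> R := growth_ge1 R S_gen infG.
have e2 : 0 < eps / 2 by rewrite divr_gt0.
have [K1 K10 h1] := sphere_card_le S_gen infG e2.
pose g2 := growth S + eps / 2; have g20 : 0 < g2 by rewrite /g2; lra.
pose g3 := growth S + eps; have g30 : 0 < g3 by rewrite /g3; move: eps_gt0; lra.
have rho1 : 1 < g3 / g2 by rewrite ltr_pdivlMr// mul1r /g3 /g2; move: eps_gt0; lra.
have [K2 K20 h2] := linear_le_geometric rho1.
exists (aw * K1 * K2 / b ^+ L0); first by rewrite divr_gt0 ?exprn_gt0// !mulr_gt0.
move=> h N hN; set M := wl h; set s := (sphere_card S M)%:R.
have s0 : 0 < s by rewrite /s ltr0n /M sphere_card_gt0.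
have M0 : 0 < 1 + M%:R :> R by rewrite ltr_pwDl.
have step1 : s * (1 + M%:R) <= K1 * K2 * g3 ^+ M.
  apply: (@le_trans _ _ ((K1 * g2 ^+ M) * (K2 * (g3 / g2) ^+ M))).
    by apply: ler_pM; [exact: ltW|exact: ltW|exact: h1|exact: h2].
  rewrite expr_div_n le_eqVlt; apply/orP; left; apply/eqP; field.
  by rewrite gt_eqF// exprn_gt0.
have step2 : b `^ N <= b ^+ M / b ^+ L0.
  rewrite ler_pdivlMr ?exprn_gt0// -!powR_mulrn ?(ltW b0)//.
  rewrite -powRD; last by rewrite (gt_eqF b0) implybT.
  by apply: ger_powR; [rewrite b0 ltW|exact: hN].
apply: le_trans step2 _.
have -> : b ^+ M = lam ^+ (2 * M) / g3 ^+ M by rewrite /b expr_div_n exprM.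
have g3M : 0 < g3 ^+ M by rewrite exprn_gt0.
have lM : 0 < lam ^+ (2 * M) by rewrite exprn_gt0.
have bL : 0 < b ^+ L0 by rewrite exprn_gt0.
rewrite [leRHS](_ : _ = (lam ^+ (2 * M) / b ^+ L0) * ((K1 * K2) / (s * (1 + M%:R)))); last first.
  by field; rewrite !gt_eqF.
rewrite [leLHS](_ : _ = (lam ^+ (2 * M) / b ^+ L0) * (g3 ^+ M)^-1); last by field; rewrite !gt_eqF.
rewrite ler_pM2l ?divr_gt0// ler_pdivlMr ?mulr_gt0//.
by rewrite ler_pdivrMl// [leRHS]mulrC.
Qed.

End GrowthWeight.

(** * Hölder estimates for the boundary map and its inverse *)

Theorem theorem5p4 (R : realType)
  (A : finType) (adm : rel A) (x0 : tmc adm)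
  (mu : probability (BSigma x0) R) (phi : seq A -> Sigma x0 -> R)
  (mix : mixing x0) (noninv : ~ bijective (@theta A adm x0))
  (mu_inv : theta_invariant mu) (mu_pos : positive_on_cylinders mu)
  (phi_jac : inverse_jacobian mu phi) (phi_gm : gibbs_markov phi)
  (G : groupType) (kappa : Sigma x0 -> G)
  (kappa_loc : forall x y : Sigma x0, letter x 0%N = letter y 0%N ->
     kappa x = kappa y)
  (T_trans : transitive_ext kappa)
  (T_transient : transient phi kappa)
  (S : seq G) (S_gen : sym_generating S)
  (delta : R) (delta_gt0 : 0 < delta) (G_hyp : hyperbolic S delta)
  (green_sym : exists2 C0 : R, 1 <= C0 & forall (x : Sigma x0) (g : G),
     let Rc := Rconv phi kappa in
     (((C0^-1)%:E * green phi kappa Rc (XX 1%g) (x, g)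
        <= green phi kappa Rc (XX g) (x, 1%g)) /\
      (green phi kappa Rc (XX g) (x, 1%g)
        <= C0%:E * green phi kappa Rc (XX 1%g) (x, g)))%E)
  (lamv : R) (lamv_bnd : 2 `^ (- (2 * delta)^-1) < lamv < 1)
  (lam : R) (lam_bnd : 0 < lam < 1)
  (lam_cond : lambda_condition phi kappa S delta lam)
  (r : R) (r_bnd : 1 <= r <= Rconv phi kappa) :
  let dG := boundary (R := R) S in
  let Mr := martin_boundary phi kappa r in
  let dv := dvisual S lamv in
  let dM := dMartin phi kappa S lam r in
  let Xi_r := Xi phi kappa r in
  let alpha := ln lam / ln lamv in
  let beta (eps : R) := (2 * ln lam - ln (growth S + eps)) / ln lamv in
  exists Xi_inv : set (Sigma x0 * G) -> set (nat -> G),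
    dist_homeo dG Mr dv dM Xi_r Xi_inv /\
    holder dG dv dM alpha Xi_r /\
    forall eps : R, 0 < eps ->
      (exists2 K : R, 1 <= K & forall s t, dG s -> dG t ->
         K^-1 * dv s t `^ beta eps <= dM (Xi_r s) (Xi_r t)
         <= K * dv s t `^ alpha) /\
      holder Mr dM dv (beta eps)^-1 Xi_inv.
Proof.
move=> dG Mr dv dM Xi_r alpha beta.
have [f [f_gt0 f_right f_left f_small Gr_cmp]] := green_profile mu_pos phi_jac phi_gm kappa_loc
  T_trans T_transient S_gen green_sym r_bnd.
pose Gr h p := greenR phi kappa r h p.
have lamc : exists2 C : R, 0 < C & forall x y n g g' h h',
    Defs.separated S delta n g g' h h' ->
    `|(Gr h (x, g) / Gr h (y, g')) / (Gr h' (x, g) / Gr h' (y, g')) - 1| <= C * lam ^+ n.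
  by have [C C0 hC] := lam_cond; exists C => // x y n g g' h h'; exact: hC.
have K_gt0 : forall h p, 0 < martinK phi kappa r h p := ratioK_gt0 f_gt0 Gr_cmp.
have [bK bK1 hbK] := lnK_bound S_gen f_gt0 f_right f_left Gr_cmp.
have [dK dK0 hdK] := lnK_diff S_gen delta_gt0 G_hyp f_gt0 f_right f_left Gr_cmp lam_bnd lamc.
have gap := kernel_gap S_gen delta_gt0 G_hyp (x0 : Sigma x0) f_gt0 f_right f_left f_small Gr_cmp lamc.
have f_small2 : forall e, 0 < e -> exists n : nat, forall g, (n <= wlen S g)%N -> f g <= e.
  by move=> e /f_small [n hn]; exists n => g /hn [].
have Gr_pos : forall h p, 0 < greenR phi kappa r h p := Gr_gt0 f_gt0 Gr_cmp.
have Gr_le : exists2 C, 0 < C & forall x h g, greenR phi kappa r h (x, g) <= C * f (h^-1 * g)%g.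
  by have [C C0 hC] := Gr_cmp; exists C => // x h g; have [] := hC x h g.
have [cw cw0 hcw] := coef_upper S_gen lam_bnd f_small2 Gr_pos Gr_le.
have [aw aw0 haw] := coef_lower S_gen lam_bnd Gr_pos bK1 hbK.
have clogK h p : martin_pts phi kappa r p -> ln (martinK phi kappa r h (iter n (extension kappa) p))
    @[n --> \oo] --> limK phi kappa r h p by exact: (cvg_lnK K_gt0 hbK).
have [L0 hL0] := limK_gap S_gen delta_gt0 G_hyp clogK gap.
have XE := XiE S_gen delta_gt0 G_hyp lam_bnd K_gt0 hbK dK0 hdK.
have pt := boundary_point kappa_loc T_trans S_gen delta_gt0 G_hyp.
have /andP[l0 l1] := lam_bnd.
have v0 : 0 < lamv := lamv_gt0 lamv_bnd.
have v1 : lamv < 1 by case/andP: lamv_bnd.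
have v01 : 0 < lamv < 1 by rewrite v0.
have lnv : ln lamv < 0 by rewrite ln_lt0.
have lnl : ln lam < 0 by rewrite ln_lt0.
have alpha0 : 0 < alpha by rewrite /alpha nmulr_rgt0// invr_lt0.
have dv0 s t : 0 <= dv s t := dvisual_ge0 S lamv s t.
have dM0 : forall P Q, Mr P -> Mr Q -> 0 <= dM P Q.
  by move=> P Q MP MQ; exact: (dMartin_ge0 S_gen lam_bnd K_gt0 bK1 hbK cw0 hcw).
have XiM s : dG s -> Mr (Xi_r s).
  by move=> ds; have [p sp] := pt s ds; have [mp E] := XE s p ds sp; exists p.
have bnd_fin s t : dG s -> dG t -> s <> t ->
    bdry_gprod S s t = (fine (bdry_gprod (R := R) S s t))%:E /\ 0 <= fine (bdry_gprod (R := R) S s t).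
  move=> ds dt st; have b0 := bdry_gprod_ge0 S_gen ds dt; split; last exact: fine_ge0.
  rewrite fineK// ge0_fin_numE// lt_neqAle leey andbT; apply/eqP => E.
  by apply: st; exact: (bdry_gprod_inf S_gen delta_gt0 G_hyp ds dt E).
have upper : exists2 K : R, 0 < K & forall s t, dG s -> dG t ->
    dM (Xi_r s) (Xi_r t) <= K * dv s t `^ alpha.
  pose D := dK * (cw^-1 * (1 - lam)^-1 ^+ 2).
  have D0 : 0 < D.
    by rewrite mulr_gt0// mulr_gt0 ?invr_gt0// exprn_gt0// invr_gt0; move: l1; lra.
  (* The power of [lam] repays the loss [1 + 2 * delta] between boundary product and orbits, and 4
     is the constant of [dvisual_ge]. *)
  exists (D * lam `^ (- 1 - 2 * delta) * 4 `^ alpha); first by rewrite pmulr_lgt0 ?powR_gt0// pmulr_lgt0 ?powR_gt0.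
  move=> s t ds dt; have [p sp] := pt s ds; have [q tq] := pt t dt.
  have [mp Xp] := XE s p ds sp; have [mq Xq] := XE t q dt tq.
  have rhs0 : 0 <= D * lam `^ (- 1 - 2 * delta) * 4 `^ alpha * dv s t `^ alpha.
    by apply: mulr_ge0 (powR_ge0 _ _); apply: mulr_ge0 (powR_ge0 _ _); apply: mulr_ge0 (powR_ge0 _ _); exact: ltW.
  have [st|/eqP st] := eqVneq s t.
    have E : dM (Xi_r s) (Xi_r s) = 0.
      by rewrite /dM /Xi_r Xp; exact: (dMartin_self S_gen lam_bnd K_gt0 bK1 hbK cw0 hcw mp).
    by rewrite -st in rhs0 *; rewrite E; exact: rhs0.
  have [bE N0] := bnd_fin s t ds dt st; set N := fine _ in bE N0.
  rewrite /dM /Xi_r Xp Xq.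
  have [n0 hn0] := bdry_gprod_lower (a := N - 1) S_gen delta_gt0 G_hyp ds dt sp tq
    ltac:(by rewrite bE lte_fin; lra).
  have := dMartin_upper S_gen lam_bnd K_gt0 bK1 hbK dK0 hdK cw0 hcw (N := N - 1 - 2 * delta) mp mq
     (ex_intro _ n0 (fun n nn => hn0 n n nn nn)).
  move=> /le_trans; apply; rewrite -/D.
  have -> : lam `^ (N - 1 - 2 * delta) = lam `^ (- 1 - 2 * delta) * lam `^ N.
    by rewrite -powRD; [congr (_ `^ _); lra|rewrite (gt_eqF l0) implybT].
  rewrite mulrA -[leRHS]mulrA; apply: ler_wpM2l.
    by apply: mulr_ge0; [exact: ltW|exact: powR_ge0].
  rewrite -powRM// -(powR_ln N v01 l0); apply: ge0_ler_powR.
  - exact: (ltW alpha0).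
  - by rewrite nnegrE powR_ge0.
  - by rewrite nnegrE mulr_ge0.
  by have := dvisual_ge S_gen delta_gt0 G_hyp lamv_bnd ds dt; rewrite bE.
(* The sign of [beta eps] depends on [growth], which is controlled once a boundary point makes all
   spheres nonempty. *)
have lower eps : 0 < eps -> (exists s, dG s) -> 0 < beta eps /\
    exists2 K : R, 0 < K & forall s t, dG s -> dG t ->
    dv s t `^ beta eps <= K * dM (Xi_r s) (Xi_r t).
  move=> e0 [s0 ds0]; have infG := unbounded_boundary S_gen ds0.
  have gb := growth_base S_gen infG lam_bnd e0.
  set b := lam ^+ 2 / _ in gb; have /andP[b0 b1] := gb.
  have g0 : 0 < growth S + eps :> R.
    by have := growth_ge1 R S_gen infG; lra.
  have betaE : beta eps = ln b / ln lamv.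
    by rewrite /beta /b ln_div ?posrE ?exprn_gt0// lnXn// mulr_natl.
  have lnb : ln b < 0 by rewrite ln_lt0.
  have beta0 : 0 < beta eps by rewrite betaE nmulr_rgt0// invr_lt0.
  split=> //; have [K K0 hK] := growth_weight S_gen infG L0 lam_bnd aw0 e0.
  exists K => // s t ds dt.
  have [p sp] := pt s ds; have [q tq] := pt t dt.
  have [mp Xp] := XE s p ds sp; have [mq Xq] := XE t q dt tq.
  have [st|/eqP st] := eqVneq s t.
    rewrite -st /dv (dvisual_self S_gen delta_gt0 G_hyp lamv ds) powR0 ?gt_eqF//.
    by apply: mulr_ge0; [exact: ltW|apply: dM0; exact: XiM].
  have [bE N0] := bnd_fin s t ds dt st.
  have [h [hN hgap]] := hL0 s t p q ds dt st mp mq sp tq.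
  set N := fine _ in bE N0 hN.
  apply: (@le_trans _ _ (b `^ N)).
    rewrite betaE -(powR_ln N v01 b0); apply: ge0_ler_powR.
    - by rewrite -betaE; exact: ltW.
    - by rewrite nnegrE; exact: dv0.
    - by rewrite nnegrE powR_ge0.
    by have := dvisual_le lamv ds dt; rewrite bE.
  apply: le_trans (hK h N hN) _; apply: ler_wpM2l; first exact: ltW.
  apply: le_trans (haw h) _; rewrite /dM /Xi_r Xp Xq.
  exact: (dMartin_lower S_gen lam_bnd K_gt0 bK1 hbK cw0 hcw mp mq hgap).
(* Injectivity is read off from the lower estimate, with the arbitrary choice [eps = 1]. *)
have Xi_inj s t : dG s -> dG t -> Xi_r s = Xi_r t -> s = t.
  move=> ds dt st; have [//|b0 [K K0 hK]] := lower 1 ltr01; first by exists s.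
  have [q tq] := pt t dt; have [mq Xq] := XE t q dt tq.
  have d0 : dM (Xi_r s) (Xi_r t) = 0.
    by rewrite st /dM /Xi_r Xq; exact: (dMartin_self S_gen lam_bnd K_gt0 bK1 hbK cw0 hcw mq).
  apply: (dvisual_eq0 S_gen delta_gt0 G_hyp lamv_bnd ds dt).
  have := hK s t ds dt; rewrite d0 mulr0 => h.
  have /powR_eq0_eq0 // : dv s t `^ beta 1 = 0 by apply/eqP; rewrite eq_le h powR_ge0.
have XiN : forall P, Mr P -> exists2 s, dG s & Xi_r s = P.
  by move=> P MP; exact: (Xi_surj kappa_loc T_trans S_gen delta_gt0 G_hyp lam_bnd K_gt0 hbK dK0 hdK MP).
pose Xi_inv P := xget set0 [set s | dG s /\ Xi_r s = P].
have invP P : Mr P -> dG (Xi_inv P) /\ Xi_r (Xi_inv P) = P.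
  by move=> /XiN [s ds sP]; apply: (@xgetPex _ set0 [set s | dG s /\ Xi_r s = P]); exists s.
have hold_inv eps : 0 < eps -> holder Mr dM dv (beta eps)^-1 Xi_inv.
  (* Without points in the Martin boundary the estimate is vacuous; otherwise [Xi_inv] supplies the
     boundary point that [lower] asks for. *)
  move=> e0; have [[P MP]|no] := pselect (exists P, Mr P); last first.
    by exists 1 => // P Q MP; case: no; exists P.
  have [ds0 _] := invP P MP; have [|b0 [K K0 hK]] := lower eps e0; first by exists (Xi_inv P).
  exists (K `^ (beta eps)^-1); first exact: powR_gt0.
  move=> P' Q' MP' MQ'; have [ds Es] := invP P' MP'; have [dt Et] := invP Q' MQ'.
  have := hK _ _ ds dt; rewrite Es Et => h.
  have -> : dv (Xi_inv P') (Xi_inv Q') = (dv (Xi_inv P') (Xi_inv Q') `^ beta eps) `^ (beta eps)^-1.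
    by rewrite -powRrM mulfV ?gt_eqF// powRr1// dv0.
  rewrite -powRM ?(ltW K0) ?dM0//; apply: ge0_ler_powR h.
  - by rewrite invr_ge0 ltW.
  - by rewrite nnegrE powR_ge0.
  by rewrite nnegrE mulr_ge0 ?(ltW K0) ?dM0.
have hold : holder dG dv dM alpha Xi_r := upper.
exists Xi_inv; split.
  split.
  - split=> [s ds|s t /set_mem ds /set_mem dt|P MP]; [exact: XiM|exact: Xi_inj|].
    by have [ds sP] := invP P MP; exists (Xi_inv P).
  - move=> s /set_mem ds; have [di Ei] := invP _ (XiM s ds); exact: Xi_inj.
  - by move=> P /set_mem MP; have [] := invP P MP.
  - exact: holder_continuous alpha0 _ hold.
  have [[P MP]|no] := pselect (exists P, Mr P); last by move=> P MP; case: no; exists P.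
  have [ds0 _] := invP P MP; have [|b0 _] := lower 1 ltr01; first by exists (Xi_inv P).
  by apply: holder_continuous (hold_inv 1 ltr01); rewrite ?invr_gt0.
split=> // eps e0; split; last exact: hold_inv.
have [[s0 ds0]|no] := pselect (exists s, dG s); last first.
  by exists 1 => // s t ds; case: no; exists s.
have [|b0 [K K0 hK]] := lower eps e0; first by exists s0.
have [K' K'0 hK'] := upper.
have K1 : 1 <= 1 + K + K' by move: (K0) (K'0); lra.
exists (1 + K + K') => // s t ds dt; apply/andP; split.
  rewrite mulrC ler_pdivrMr ?(lt_le_trans ltr01 K1)// mulrC.
  apply: le_trans (hK s t ds dt) _; apply: ler_wpM2r; first by apply: dM0; exact: XiM.
  by move: K'0; lra.
apply: le_trans (hK' s t ds dt) _; apply: ler_wpM2r; first exact: powR_ge0.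
by move: K0; lra.
Qed.
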